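(* Let $\Omega=\Omega(u,v)$ be a solution in $E^4$ of the Betchov-Da Rios equation $\Omega_v=\Omega_u\times\Omega_{uu}\times\Omega_{uuu}$ whose $u$-parameter curves are unit speed, with ED$^2$-frame field $\{T,E,D,N\}$ and associated functions $\kappa,\sigma,\tau$ (notation and standing assumptions as in the context). The soliton surface $S:\Omega=\Omega(u,v)$ is Wintgen ideal (superconformal) if and only if $a_{23}=0$ and $a_{34}=\kappa^2\tau(\kappa-2\sigma)$ hold, where $$a_{23}=\frac{-1}{\tau\kappa^2}\Big(-3\kappa^3\tau\sigma\sigma_u+\kappa^5\tau_u+2\kappa^4\tau\kappa_u-2\tau\kappa_u^3-\kappa^2\sigma^2(3\kappa\tau_u+5\tau\kappa_u)+2\kappa\kappa_u(\kappa_u\tau_u+2\tau\kappa_{uu})+\kappa^3\tau_{uuu}+\kappa^2(5\kappa_u\tau_{uu}+6\tau_u\kappa_{uu}+2\tau\kappa_{uuu})\Big),$$ $$a_{34}=\frac1\kappa\Big(\big(\kappa\tau\sigma^2-4\kappa_u\tau_u-\kappa\tau_{uu}\big)\kappa-2\big(\kappa_u^2+\kappa\kappa_{uu}\big)\tau\Big).$$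
   Context: $E^4$ is Euclidean 4-space with inner product $\langle\cdot,\cdot\rangle$, and $x\times y\times z$ is the usual alternating ternary vector product of $E^4$ (with a fixed sign convention, e.g. $\langle w,x\times y\times z\rangle=\det(w,x,y,z)$). Subscripts $u,v$ denote partial derivatives. All functions are assumed sufficiently smooth on an open domain of the $(u,v)$-plane. ED$^2$-frame field: for each $v$, the unit speed curve $u\mapsto\Omega(u,v)$ lies on an oriented hypersurface of $E^4$; $T=\Omega_u$ and $N(u,v)$ is the unit normal of the hypersurface at $\Omega(u,v)$. One is in the case where $\{N,T,\Omega_{uu}\}$ is linearly dependent; $E$ is the normalization of $\Omega_{uuu}-\langle\Omega_{uuu},N\rangle N-\langle\Omega_{uuu},T\rangle T$ (assumed nonzero), and $D=N\times T\times E$. Associated functions: $\kappa=\kappa_n=\langle T_u,N\rangle$, $\sigma=\kappa_g^2=\langle E_u,D\rangle$ (the superscript in $\kappa_g^2$ is an index, not a power), $\tau=\tau_g^1=\langle E_u,N\rangle$. The frame satisfies $T_u=\kappa N$, $E_u=\sigma D+\tau N$, $D_u=-\sigma E$, $N_u=-\kappa T-\tau E$. Standing assumption: $\kappa$ and $\tau$ are nowhere zero. A surface in $E^4$ is Wintgen ideal (superconformal) if $K+|K_N|=\|\vec H\|^2$ holds at all its points, where $K$ is the Gaussian curvature, $\vec H$ the mean curvature vector field (half the trace of the second fundamental form), and $K_N$ the Gaussian torsion, defined as follows. $\{E,N\}$ is the orthonormal normal frame of $S$. Let $g_{11}=\langle\Omega_u,\Omega_u\rangle$, $g_{12}=\langle\Omega_u,\Omega_v\rangle$,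 $g_{22}=\langle\Omega_v,\Omega_v\rangle$, and $\mathcal W=\kappa^2\tau$ (so $\mathcal W^2=g_{11}g_{22}-g_{12}^2$). Let $c_{11}^1=\langle\Omega_{uu},E\rangle$, $c_{12}^1=\langle\Omega_{uv},E\rangle$, $c_{22}^1=\langle\Omega_{vv},E\rangle$, and let $c_{ij}^2$ be the same with $N$ in place of $E$. Then $$K_N=\frac{g_{11}(c_{12}^1c_{22}^2-c_{12}^2c_{22}^1)-g_{12}(c_{11}^1c_{22}^2-c_{11}^2c_{22}^1)+g_{22}(c_{11}^1c_{12}^2-c_{11}^2c_{12}^1)}{\mathcal W^3}.$$ *)

(* Defs.v *)
(* Stdlib reals with Coquelicot. *)
From Stdlib Require Export Reals.
From Coquelicot Require Export Coquelicot.
Open Scope R_scope.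

(* Euclidean 4-space, with Coquelicot's normed-module structure of a product;
   the additive operations are [plus], [minus], [scal], [zero]. *)
Notation E4 := (R * R * R * R)%type.

Definition x1 (p : E4) : R := fst (fst (fst p)).
Definition x2 (p : E4) : R := snd (fst (fst p)).
Definition x3 (p : E4) : R := snd (fst p).
Definition x4 (p : E4) : R := snd p.

Definition inner (p q : E4) : R :=
  x1 p * x1 q + x2 p * x2 q + x3 p * x3 q + x4 p * x4 q.

Definition enorm (p : E4) : R := sqrt (inner p p).

Definition det3 (a1 a2 a3 b1 b2 b3 c1 c2 c3 : R) : R :=
  a1 * (b2 * c3 - b3 * c2) - a2 * (b1 * c3 - b3 * c1) + a3 * (b1 * c2 - b2 * c1).

(* Sign convention: <w, x * y * z> = det (w, x, y, z), the entries being the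
   cofactors of the first row. *)
Definition cross (x y z : E4) : E4 :=
  (   det3 (x2 x) (x3 x) (x4 x) (x2 y) (x3 y) (x4 y) (x2 z) (x3 z) (x4 z),
    - det3 (x1 x) (x3 x) (x4 x) (x1 y) (x3 y) (x4 y) (x1 z) (x3 z) (x4 z),
      det3 (x1 x) (x2 x) (x4 x) (x1 y) (x2 y) (x4 y) (x1 z) (x2 z) (x4 z),
    - det3 (x1 x) (x2 x) (x3 x) (x1 y) (x2 y) (x3 y) (x1 z) (x2 z) (x3 z)).

(* The two coordinates of the (u,v)-plane, also used as tensor indices. *)
Inductive coord : Type := U | V.

Definition sum_coord (f : coord -> R) : R := f U + f V.

Definition pd (i : coord) (f : R -> R -> R) (u v : R) : R :=
  match i with
  | U => Derive (fun t => f t v) u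
  | V => Derive (fun t => f u t) v
  end.

Definition pdE (i : coord) (F : R -> R -> E4) (u v : R) : E4 :=
  (pd i (fun s t => x1 (F s t)) u v,
   pd i (fun s t => x2 (F s t)) u v,
   pd i (fun s t => x3 (F s t)) u v,
   pd i (fun s t => x4 (F s t)) u v).

Fixpoint C_k (k : nat) (Dom : R * R -> Prop) (f : R -> R -> R) : Prop :=
  (forall u v, Dom (u, v) -> continuity_2d_pt f u v) /\
  match k with
  | 0%nat => True
  | S k' =>
      (forall u v, Dom (u, v) ->
         ex_derive (fun t => f t v) u /\ ex_derive (fun t => f u t) v) /\
      C_k k' Dom (pd U f) /\ C_k k' Dom (pd V f)
  end.

Definition smooth (Dom : R * R -> Prop) (f : R -> R -> R) : Prop :=
  forall k, C_k k Dom f.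

Definition smoothE (Dom : R * R -> Prop) (F : R -> R -> E4) : Prop :=
  smooth Dom (fun u v => x1 (F u v)) /\ smooth Dom (fun u v => x2 (F u v)) /\
  smooth Dom (fun u v => x3 (F u v)) /\ smooth Dom (fun u v => x4 (F u v)).

(* M is a hypersurface of E^4 oriented by the unit normal field nu: near each of
   its points M is the zero set of a C^1 function with nowhere zero gradient,
   and nu is the normalized gradient. *)
Definition oriented_hypersurface (M : E4 -> Prop) (nu : E4 -> E4) : Prop :=
  forall p, M p ->
    exists (f : E4 -> R) (grad : E4 -> E4),
      locally p (fun q =>
        (M q <-> f q = 0) /\
        filterdiff f (locally q) (fun w => inner (grad q) w) /\
        continuous grad q /\
        grad q <> zero /\
        (M q -> nu q = scal (/ enorm (grad q)) (grad q))).

Definition lin_dep3 (x y z : E4) : Prop :=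
  exists a b c : R, ~ (a = 0 /\ b = 0 /\ c = 0) /\
    plus (plus (scal a x) (scal b y)) (scal c z) = zero.

Section Frame.

Variables (Om N : R -> R -> E4).

Definition Om_u : R -> R -> E4 := pdE U Om.
Definition Om_v : R -> R -> E4 := pdE V Om.
Definition Om_uu : R -> R -> E4 := pdE U Om_u.
Definition Om_uuu : R -> R -> E4 := pdE U Om_uu.

Definition frameT : R -> R -> E4 := Om_u.

(* Om_uuu minus its components along N and T. *)
Definition frameE_raw (u v : R) : E4 :=
  minus (minus (Om_uuu u v) (scal (inner (Om_uuu u v) (N u v)) (N u v)))
        (scal (inner (Om_uuu u v) (frameT u v)) (frameT u v)).

Definition frameE (u v : R) : E4 :=
  scal (/ enorm (frameE_raw u v)) (frameE_raw u v).

Definition frameD (u v : R) : E4 := cross (N u v) (frameT u v) (frameE u v).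

Definition kappa (u v : R) : R := inner (pdE U frameT u v) (N u v).
Definition sigma (u v : R) : R := inner (pdE U frameE u v) (frameD u v).
Definition tau (u v : R) : R := inner (pdE U frameE u v) (N u v).

(* The frame {T, E, D, N} over Dom in the linearly dependent case.  The equations
   T_u = kappa N, E_u = sigma D + tau N, D_u = - sigma E and
   N_u = - kappa T - tau E are consequences, hence not required. *)
Record ED2_frame (Dom : R * R -> Prop) : Prop := {
  ED2_unit_speed : forall u v, Dom (u, v) -> inner (Om_u u v) (Om_u u v) = 1;
  ED2_normal : forall v, exists (M : E4 -> Prop) (nu : E4 -> E4),
    oriented_hypersurface M nu /\
    forall u, Dom (u, v) -> M (Om u v) /\ N u v = nu (Om u v);
  ED2_normal_smooth : smoothE Dom N;
  ED2_dep : forall u v, Dom (u, v) -> lin_dep3 (N u v) (frameT u v) (Om_uu u v);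
  ED2_raw : forall u v, Dom (u, v) -> frameE_raw u v <> zero;
  ED2_kappa : forall u v, Dom (u, v) -> kappa u v <> 0;
  ED2_tau : forall u v, Dom (u, v) -> tau u v <> 0
}.

Definition betchov_da_rios (Dom : R * R -> Prop) : Prop :=
  forall u v, Dom (u, v) ->
    Om_v u v = cross (Om_u u v) (Om_uu u v) (Om_uuu u v).

Definition g (i j : coord) (u v : R) : R := inner (pdE i Om u v) (pdE j Om u v).

Definition det_g (u v : R) : R := g U U u v * g V V u v - g U V u v * g U V u v.

Definition g_inv (i j : coord) (u v : R) : R :=
  match i, j with
  | U, U => g V V u v / det_g u v
  | V, V => g U U u v / det_g u v
  | _, _ => - g U V u v / det_g u v
  end.

(* Gamma k i j = Gamma^k_ij, for the Levi-Civita connection of g. *)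
Definition Gamma (k i j : coord) (u v : R) : R :=
  / 2 * sum_coord (fun l => g_inv k l u v *
    (pd i (g j l) u v + pd j (g i l) u v - pd l (g i j) u v)).

(* The component along d_l of
   R(d_u, d_v) d_v = nabla_u nabla_v d_v - nabla_v nabla_u d_v. *)
Definition Riem_uvv (l : coord) (u v : R) : R :=
  pd U (Gamma l V V) u v - pd V (Gamma l U V) u v
  + sum_coord (fun m => Gamma m V V u v * Gamma l U m u v
                        - Gamma m U V u v * Gamma l V m u v).

Definition gauss_curvature (u v : R) : R :=
  sum_coord (fun l => g U l u v * Riem_uvv l u v) / det_g u v.

(* Coefficients of the second fundamental form with respect to the orthonormal
   normal frame {E, N}: c1 along E, c2 along N. *)
Definition c1 (i j : coord) (u v : R) : R :=
  inner (pdE j (pdE i Om) u v) (frameE u v).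
Definition c2 (i j : coord) (u v : R) : R :=
  inner (pdE j (pdE i Om) u v) (N u v).

Definition second_form (i j : coord) (u v : R) : E4 :=
  plus (scal (c1 i j u v) (frameE u v)) (scal (c2 i j u v) (N u v)).

(* Half the trace of the second fundamental form with respect to g; the mixed
   term accounts for both (U,V) and (V,U). *)
Definition mean_curvature (u v : R) : E4 :=
  scal (/ 2)
    (plus (plus (scal (g_inv U U u v) (second_form U U u v))
                (scal (2 * g_inv U V u v) (second_form U V u v)))
          (scal (g_inv V V u v) (second_form V V u v))).

Definition W (u v : R) : R := (kappa u v) ^ 2 * tau u v.

Definition gauss_torsion (u v : R) : R :=
  (g U U u v * (c1 U V u v * c2 V V u v - c2 U V u v * c1 V V u v)
   - g U V u v * (c1 U U u v * c2 V V u v - c2 U U u v * c1 V V u v)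
   + g V V u v * (c1 U U u v * c2 U V u v - c2 U U u v * c1 U V u v))
  / (W u v) ^ 3.

Definition wintgen_ideal (Dom : R * R -> Prop) : Prop :=
  forall u v, Dom (u, v) ->
    gauss_curvature u v + Rabs (gauss_torsion u v)
    = (enorm (mean_curvature u v)) ^ 2.

Definition a23 (u v : R) : R :=
  let k := kappa u v in let s := sigma u v in let t := tau u v in
  let k_u := pd U kappa u v in
  let k_uu := pd U (pd U kappa) u v in
  let k_uuu := pd U (pd U (pd U kappa)) u v in
  let s_u := pd U sigma u v in
  let t_u := pd U tau u v in
  let t_uu := pd U (pd U tau) u v in
  let t_uuu := pd U (pd U (pd U tau)) u v in
  - 1 / (t * k ^ 2) *
  (- 3 * k ^ 3 * t * s * s_u + k ^ 5 * t_u + 2 * k ^ 4 * t * k_u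
   - 2 * t * k_u ^ 3
   - k ^ 2 * s ^ 2 * (3 * k * t_u + 5 * t * k_u)
   + 2 * k * k_u * (k_u * t_u + 2 * t * k_uu)
   + k ^ 3 * t_uuu
   + k ^ 2 * (5 * k_u * t_uu + 6 * t_u * k_uu + 2 * t * k_uuu)).

Definition a34 (u v : R) : R :=
  let k := kappa u v in let s := sigma u v in let t := tau u v in
  let k_u := pd U kappa u v in
  let k_uu := pd U (pd U kappa) u v in
  let t_u := pd U tau u v in
  let t_uu := pd U (pd U tau) u v in
  1 / k *
  ((k * t * s ^ 2 - 4 * k_u * t_u - k * t_uu) * k
   - 2 * (k_u ^ 2 + k * k_uu) * t).

End Frame.

(* Main.v *)
(* The structure equations of the frame give Omega_v = W D, so that the metric is
   du^2 + W^2 dv^2 with curvature - W_uu / W, and a23 = <E_v, D>, a34 = - <N_v, D>.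
   With b = a34 / W, the Wintgen equality at a point reads
   a23^2 / W^2 + (|kappa - b| - 2 |sigma|)^2 = 0, i.e. a23 = 0 and b = kappa -+ 2 sigma.

   The other sign has to be excluded: if b = kappa + 2 sigma with sigma <> 0 somewhere,
   then this holds on an open set, and the structure equations become an overdetermined
   system there.  Equality of mixed derivatives turns it into polynomial relations with
   integer coefficients, closed under two derivations.  At a point where a suitable
   nonconstant ratio takes a rational value with prescribed residue modulo a prime p,
   the relations, viewed as linear in the monomials, have full rank modulo p, and
   Nakayama's lemma then makes all monomials vanish, which is absurd. *)

Require Import Defs.
From Stdlib Require Import Lra Lia ZArith List Classical Ranalysis5.
Import ListNotations.
Open Scope R_scope.

(** * Smooth functions on an open set of the plane *)

(** The range of the ratio is unknown; all that can be said is that it contains an interval. A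
    specific rational value is therefore out of reach, but the fractions a / b with b = 1 and a = r
    modulo p are dense, and modulo p they all give the same substitution. One prime and one residue
    thus serve every solution, and full rank is decided by a computation with small numbers, without
    storing elimination cofactors. Real numbers cannot be reduced modulo p; the rank statement says
    instead that the finitely generated group spanned by the values of the monomials lies in its own
    multiple by p, and Nakayama's lemma then makes it zero.

    The linear equations that determine the new derivatives lose rank where sigma = - kappa. That
    locus forms a second case with its own variables and derivations. There no ratio is known to
    vary, so the rank argument only shows that a certain ratio is constant, and solutions with
    constant ratio are excluded by hand. *)

Lemma is_derive_Rmult (f g : R -> R) x df dg :
  is_derive f x df -> is_derive g x dg -> is_derive (fun t => f t * g t) x (df * g x + f x * dg).
Proof. intros Hf Hg. exact (is_derive_mult f g x df dg Hf Hg Rmult_comm). Qed.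

(** Restriction to a coordinate line, so that both partial derivatives fall under one statement
    about functions of one variable. *)
Definition line (i : coord) (f : R -> R -> R) (u v : R) : R -> R :=
  match i with U => fun t => f t v | V => fun t => f u t end.

Definition at_coord (i : coord) (u v : R) : R := match i with U => u | V => v end.

Lemma pd_line i f u v : pd i f u v = Derive (line i f u v) (at_coord i u v).
Proof. destruct i; reflexivity. Qed.

Lemma line_at i f u v : line i f u v (at_coord i u v) = f u v.
Proof. destruct i; reflexivity. Qed.

Section OpenSet.

Variable O : R * R -> Prop.
Hypothesis hO : open O.

Lemma open_box u v : O (u, v) ->
  exists e : posreal, forall u' v', Rabs (u' - u) < e -> Rabs (v' - v) < e -> O (u', v').
Proof.
  intros H. destruct (hO _ H) as [e He]. exists e. intros u' v' H1 H2.
  apply He. split; assumption.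
Qed.

Lemma open_locally_2d (P : R -> R -> Prop) u v :
  (forall u v, O (u, v) -> P u v) -> O (u, v) -> locally_2d P u v.
Proof.
  intros HP H. destruct (open_box _ _ H) as [e He]. exists e. intros; apply HP; auto.
Qed.

Lemma open_line (P : R -> R -> Prop) i u v :
  (forall u v, O (u, v) -> P u v) -> O (u, v) ->
  locally (at_coord i u v) (fun t => match i with U => P t v | V => P u t end).
Proof.
  intros HP H. destruct (open_box _ _ H) as [e He]. exists e. intros t Ht.
  assert (Hz : Rabs (u - u) < e /\ Rabs (v - v) < e).
  { rewrite !Rminus_diag, Rabs_R0. split; apply cond_pos. }
  destruct i; simpl in *; apply HP, He; solve [exact Ht | apply Hz].
Qed.

Lemma line_ext i f g u v :
  (forall u v, O (u, v) -> f u v = g u v) -> O (u, v) ->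
  locally (at_coord i u v) (fun t => line i f u v t = line i g u v t).
Proof.
  intros H Huv. generalize (open_line (fun u v => f u v = g u v) i u v H Huv).
  apply filter_imp. destruct i; auto.
Qed.

Lemma pd_ext i f g u v :
  (forall u v, O (u, v) -> f u v = g u v) -> O (u, v) -> pd i f u v = pd i g u v.
Proof.
  intros H Huv. rewrite !pd_line. apply Derive_ext_loc, line_ext; auto.
Qed.

Lemma C_k_ext k f g :
  (forall u v, O (u, v) -> f u v = g u v) -> C_k k O f -> C_k k O g.
Proof.
  revert f g; induction k as [|k IH]; intros f g H [Hc Hd]; split.
  1, 3: intros u v Huv; apply (continuity_2d_pt_ext_loc f); auto;
    apply (open_locally_2d (fun u v => f u v = g u v)); auto.
  - exact I.
  - destruct Hd as (He & HU & HV). split; [|split].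
    + intros u v Huv. destruct (He u v Huv) as [E1 E2]. split.
      * apply (ex_derive_ext_loc (line U f u v)); [|exact E1]. apply (line_ext U); auto.
      * apply (ex_derive_ext_loc (line V f u v)); [|exact E2]. apply (line_ext V); auto.
    + apply (IH (pd U f)); auto. intros; apply pd_ext; auto.
    + apply (IH (pd V f)); auto. intros; apply pd_ext; auto.
Qed.

Lemma C_k_pred k f : C_k (S k) O f -> C_k k O f.
Proof.
  revert f; induction k as [|k IH]; intros f [Hc (He & HU & HV)]; split; auto.
Qed.

(** Induction step of the closure properties below. An explicit formula for the derivatives has to
    agree with [pd] on O only; as O is open, the agreement passes to all further derivatives. *)
Lemma C_k_intro k f (f' : coord -> R -> R -> R) :
  (forall u v, O (u, v) -> continuity_2d_pt f u v) ->
  (forall i u v, O (u, v) -> is_derive (line i f u v) (at_coord i u v) (f' i u v)) ->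
  (forall i, C_k k O (f' i)) -> C_k (S k) O f.
Proof.
  intros Hc Hd Hk. split; [exact Hc|]. split; [|split].
  - intros u v Huv. split; [exists (f' U u v); apply (Hd U)|exists (f' V u v); apply (Hd V)];
      auto.
  - apply (C_k_ext k (f' U)); auto. intros u v Huv. symmetry. rewrite pd_line.
    apply is_derive_unique, Hd; exact Huv.
  - apply (C_k_ext k (f' V)); auto. intros u v Huv. symmetry. rewrite pd_line.
    apply is_derive_unique, Hd; exact Huv.
Qed.

Lemma C_k_derive k f i u v :
  C_k (S k) O f -> O (u, v) -> is_derive (line i f u v) (at_coord i u v) (pd i f u v).
Proof.
  intros [_ [He _]] Huv. rewrite pd_line. apply Derive_correct.
  destruct i; apply (He u v Huv).
Qed.

Lemma C_k_pd k f i : C_k (S k) O f -> C_k k O (pd i f).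
Proof. intros [_ (_ & HU & HV)]; destruct i; assumption. Qed.

Lemma C_k_const k c : C_k k O (fun _ _ => c).
Proof.
  revert c; induction k as [|k IH]; intros c.
  - split; auto. intros; apply continuity_2d_pt_const.
  - apply (C_k_intro k _ (fun _ _ _ => 0)); auto.
    + intros; apply continuity_2d_pt_const.
    + intros i u v _. destruct i;
        apply (is_derive_const (K := R_AbsRing) (V := R_NormedModule) c).
Qed.

Lemma C_k_plus k f g : C_k k O f -> C_k k O g -> C_k k O (fun u v => f u v + g u v).
Proof.
  revert f g; induction k as [|k IH]; intros f g Hf Hg.
  - split; auto. intros u v Huv. apply continuity_2d_pt_plus; [apply Hf|apply Hg]; auto.
  - apply (C_k_intro k _ (fun i u v => pd i f u v + pd i g u v)).
    + intros u v Huv. apply continuity_2d_pt_plus; [apply Hf|apply Hg]; auto.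
    + intros i u v Huv.
      assert (H1 := C_k_derive _ _ i u v Hf Huv). assert (H2 := C_k_derive _ _ i u v Hg Huv).
      destruct i; apply (is_derive_plus _ _ _ _ _ H1 H2).
    + intros i. apply IH; apply C_k_pd; assumption.
Qed.

Lemma C_k_mult k f g : C_k k O f -> C_k k O g -> C_k k O (fun u v => f u v * g u v).
Proof.
  revert f g; induction k as [|k IH]; intros f g Hf Hg.
  - split; auto. intros u v Huv. apply continuity_2d_pt_mult; [apply Hf|apply Hg]; auto.
  - apply (C_k_intro k _ (fun i u v => pd i f u v * g u v + f u v * pd i g u v)).
    + intros u v Huv. apply continuity_2d_pt_mult; [apply Hf|apply Hg]; auto.
    + intros i u v Huv.
      assert (H1 := C_k_derive _ _ i u v Hf Huv). assert (H2 := C_k_derive _ _ i u v Hg Huv).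
      destruct i; exact (is_derive_mult _ _ _ _ _ H1 H2 (fun n m => Rmult_comm n m)).
    + intros i. apply C_k_plus; apply IH; auto using C_k_pd, C_k_pred.
Qed.

Lemma C_k_inv k f :
  (forall u v, O (u, v) -> f u v <> 0) -> C_k k O f -> C_k k O (fun u v => / f u v).
Proof.
  intros H0; induction k as [|k IH]; intros Hf.
  - split; auto. intros u v Huv. apply continuity_2d_pt_inv; [apply Hf|]; auto.
  - apply (C_k_intro k _ (fun i u v => (-1) * pd i f u v * (/ f u v * / f u v))).
    + intros u v Huv. apply continuity_2d_pt_inv; [apply Hf|]; auto.
    + intros i u v Huv.
      assert (H1 := C_k_derive _ _ i u v Hf Huv).
      assert (H2 : line i f u v (at_coord i u v) <> 0) by (rewrite line_at; auto).
      generalize (is_derive_inv _ _ _ H1 H2). rewrite line_at.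
      replace (- pd i f u v / f u v ^ 2) with ((-1) * pd i f u v * (/ f u v * / f u v))
        by (field; auto).
      destruct i; auto.
    + intros i. apply C_k_mult; [apply C_k_mult|apply C_k_mult];
        auto using C_k_pd, C_k_pred, C_k_const.
Qed.

Lemma C_k_sqrt k f :
  (forall u v, O (u, v) -> 0 < f u v) -> C_k k O f -> C_k k O (fun u v => sqrt (f u v)).
Proof.
  intros H0; induction k as [|k IH]; intros Hf.
  - split; auto. intros u v Huv. apply (continuity_1d_2d_pt_comp sqrt); [|apply Hf; auto].
    apply continuity_pt_sqrt. left; auto.
  - apply (C_k_intro k _ (fun i u v => pd i f u v * / (2 * sqrt (f u v)))).
    + intros u v Huv. apply (continuity_1d_2d_pt_comp sqrt); [|apply Hf; auto].
      apply continuity_pt_sqrt. left; auto.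
    + intros i u v Huv.
      assert (H1 := C_k_derive _ _ i u v Hf Huv).
      assert (H2 : 0 < line i f u v (at_coord i u v)) by (rewrite line_at; auto).
      generalize (is_derive_sqrt _ _ _ H1 H2). rewrite line_at. destruct i; auto.
    + intros i. apply C_k_mult; [apply C_k_pd; auto|].
      apply C_k_inv.
      * intros u v Huv. assert (0 < sqrt (f u v)) by (apply sqrt_lt_R0; auto). lra.
      * apply C_k_mult; [apply C_k_const|apply IH; apply C_k_pred; auto].
Qed.

Lemma smooth_ext f g :
  (forall u v, O (u, v) -> f u v = g u v) -> smooth O f -> smooth O g.
Proof. intros H Hf k; apply (C_k_ext k f); auto. Qed.

Lemma smooth_pd i f : smooth O f -> smooth O (pd i f).
Proof. intros Hf k; apply C_k_pd, Hf. Qed.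

Lemma smooth_const c : smooth O (fun _ _ => c).
Proof. intros k; apply C_k_const. Qed.

Lemma smooth_plus f g : smooth O f -> smooth O g -> smooth O (fun u v => f u v + g u v).
Proof. intros Hf Hg k; apply C_k_plus; auto. Qed.

Lemma smooth_mult f g : smooth O f -> smooth O g -> smooth O (fun u v => f u v * g u v).
Proof. intros Hf Hg k; apply C_k_mult; auto. Qed.

Lemma smooth_opp f : smooth O f -> smooth O (fun u v => - f u v).
Proof.
  intros Hf. apply (smooth_ext (fun u v => (-1) * f u v)); [intros; ring|].
  apply smooth_mult; [apply smooth_const|exact Hf].
Qed.

Lemma smooth_minus f g : smooth O f -> smooth O g -> smooth O (fun u v => f u v - g u v).
Proof. intros Hf Hg. apply smooth_plus; [|apply smooth_opp]; assumption. Qed.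

Lemma smooth_inv f :
  (forall u v, O (u, v) -> f u v <> 0) -> smooth O f -> smooth O (fun u v => / f u v).
Proof. intros H Hf k; apply C_k_inv; auto. Qed.

Lemma smooth_div f g :
  (forall u v, O (u, v) -> g u v <> 0) -> smooth O f -> smooth O g ->
  smooth O (fun u v => f u v / g u v).
Proof. intros H Hf Hg. apply smooth_mult; [|apply smooth_inv]; auto. Qed.

Lemma smooth_pow f n : smooth O f -> smooth O (fun u v => f u v ^ n).
Proof.
  intros Hf. induction n as [|n IH]; simpl; [apply smooth_const|].
  apply smooth_mult; assumption.
Qed.

Lemma smooth_sqrt f :
  (forall u v, O (u, v) -> 0 < f u v) -> smooth O f -> smooth O (fun u v => sqrt (f u v)).
Proof. intros H Hf k; apply C_k_sqrt; auto. Qed.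

Lemma smooth_is_derive i f u v :
  smooth O f -> O (u, v) -> is_derive (line i f u v) (at_coord i u v) (pd i f u v).
Proof. intros Hf; apply (C_k_derive 0), Hf. Qed.

Lemma smooth_is_derive_U f u v :
  smooth O f -> O (u, v) -> is_derive (fun t => f t v) u (pd U f u v).
Proof. apply (smooth_is_derive U). Qed.

Lemma smooth_is_derive_V f u v :
  smooth O f -> O (u, v) -> is_derive (fun t => f u t) v (pd V f u v).
Proof. apply (smooth_is_derive V). Qed.

Lemma smooth_continuity_2d f u v : smooth O f -> O (u, v) -> continuity_2d_pt f u v.
Proof. intros Hf. apply (proj1 (Hf 0%nat)). Qed.

Lemma pd_plus i f g u v : smooth O f -> smooth O g -> O (u, v) ->
  pd i (fun u v => f u v + g u v) u v = pd i f u v + pd i g u v.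
Proof.
  intros Hf Hg Huv. rewrite pd_line. apply is_derive_unique.
  assert (H1 := smooth_is_derive i f u v Hf Huv).
  assert (H2 := smooth_is_derive i g u v Hg Huv).
  destruct i; apply (is_derive_plus _ _ _ _ _ H1 H2).
Qed.

Lemma pd_mult i f g u v : smooth O f -> smooth O g -> O (u, v) ->
  pd i (fun u v => f u v * g u v) u v = pd i f u v * g u v + f u v * pd i g u v.
Proof.
  intros Hf Hg Huv. rewrite pd_line. apply is_derive_unique.
  assert (H1 := smooth_is_derive i f u v Hf Huv).
  assert (H2 := smooth_is_derive i g u v Hg Huv).
  destruct i; exact (is_derive_mult _ _ _ _ _ H1 H2 (fun n m => Rmult_comm n m)).
Qed.

Lemma pd_const i c u v : pd i (fun _ _ => c) u v = 0.
Proof. destruct i; exact (Derive_const c _). Qed.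

Lemma pd_comm f u v : smooth O f -> O (u, v) -> pd V (pd U f) u v = pd U (pd V f) u v.
Proof.
  intros Hf Huv. symmetry.
  apply (Schwarz f u v).
  - apply (open_locally_2d (fun u v => ex_derive (fun z => f z v) u /\ ex_derive (fun z => f u
      z) v
      /\ ex_derive (fun z => Derive (fun x => f z x) v) u
      /\ ex_derive (fun z => Derive (fun x => f x z) u) v)); auto.
    intros x y Hxy. repeat split.
    + exists (pd U f x y). apply smooth_is_derive_U; auto.
    + exists (pd V f x y). apply smooth_is_derive_V; auto.
    + exists (pd U (pd V f) x y). apply (smooth_is_derive_U (pd V f)); auto using smooth_pd.
    + exists (pd V (pd U f) x y). apply (smooth_is_derive_V (pd U f)); auto using smooth_pd.
  - apply (smooth_continuity_2d (pd U (pd V f))); auto using smooth_pd.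
  - apply (smooth_continuity_2d (pd V (pd U f))); auto using smooth_pd.
Qed.

End OpenSet.

Lemma smooth_subset (O O' : R * R -> Prop) f :
  (forall p, O' p -> O p) -> smooth O f -> smooth O' f.
Proof.
  intros H Hf k. specialize (Hf k). revert f Hf; induction k as [|k IH]; intros f [Hc Hd].
  - split; auto.
  - destruct Hd as (He & HU & HV). split; [auto|]. split; [auto|]. split; apply IH; auto.
Qed.

(** * Integer polynomials and linear algebra modulo a prime *)

Definition mono := list nat.
Definition poly := list (mono * Z).

Fixpoint mono_eval (rho : nat -> R) (i : nat) (m : mono) : R :=
  match m with
  | [] => 1
  | e :: m' => rho i ^ e * mono_eval rho (S i) m'
  end.

(** The polynomial read as a linear form in independent unknowns, one for each monomial; the linear
    algebra works with this, and [eval] is the special case of actual monomial values. *)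
Definition lin (X : mono -> R) (f : poly) : R :=
  fold_right (fun c r => IZR (snd c) * X (fst c) + r) 0 f.

Definition eval (rho : nat -> R) (f : poly) : R := lin (mono_eval rho 0) f.

Fixpoint mono_cmp (m n : mono) : comparison :=
  match m, n with
  | [], [] => Eq
  | [], _ => Lt
  | _, [] => Gt
  | d :: m', e :: n' =>
      match Nat.compare d e with Eq => mono_cmp m' n' | c => c end
  end.

Lemma mono_cmp_eq m n : mono_cmp m n = Eq -> m = n.
Proof.
  revert n; induction m as [|d m IH]; intros [|e n]; simpl; try discriminate; auto.
  destruct (Nat.compare d e) eqn:H; try discriminate.
  apply Nat.compare_eq in H; subst; intros H; f_equal; auto.
Qed.

(** Merge of lists sorted by decreasing monomial; the inner fixpoint recurses on g while f stays
    fixed. The value is right for arbitrary lists ([lin_padd]), so the order is not carried along as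
    an invariant. *)
Fixpoint padd (f g : poly) {struct f} : poly :=
  let fix aux (g : poly) : poly :=
    match f, g with
    | [], _ => g
    | _, [] => f
    | (m, c) :: f', (n, d) :: g' =>
        match mono_cmp m n with
        | Gt => (m, c) :: padd f' g
        | Lt => (n, d) :: aux g'
        | Eq => if Z.eqb (c + d) 0 then padd f' g' else (m, c + d)%Z :: padd f' g'
        end
    end
  in aux g.

Lemma lin_cons X m c f : lin X ((m, c) :: f) = IZR c * X m + lin X f.
Proof. reflexivity. Qed.

Lemma lin_padd X f g : lin X (padd f g) = lin X f + lin X g.
Proof.
  revert g; induction f as [|[m c] f IH]; intros g.
  - destruct g; unfold lin; simpl; ring.
  - induction g as [|[n d] g IHg].
    + simpl; ring.
    + cbn [padd]. destruct (mono_cmp m n) eqn:Hc.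
      * apply mono_cmp_eq in Hc; subst n.
        destruct (Z.eqb_spec (c + d) 0) as [H0|H0].
        -- rewrite IH, !lin_cons. assert (IZR c + IZR d = 0) by (rewrite <- plus_IZR, H0; auto).
           replace (IZR c) with (- IZR d) by lra. ring.
        -- rewrite !lin_cons, IH, plus_IZR. ring.
      * change (lin X ((n, d) :: padd ((m, c) :: f) g)
                = lin X ((m, c) :: f) + lin X ((n, d) :: g)).
        rewrite lin_cons, IHg, !lin_cons. ring.
      * rewrite lin_cons, IH, !lin_cons. ring.
Qed.

Definition pscale (k : Z) (f : poly) : poly :=
  map (fun c => (fst c, k * snd c)%Z) f.

Lemma lin_pscale X k f : lin X (pscale k f) = IZR k * lin X f.
Proof.
  induction f as [|[m c] f IH]; [unfold lin; simpl; ring|].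
  change (lin X ((m, (k * c)%Z) :: pscale k f) = IZR k * lin X ((m, c) :: f)).
  rewrite !lin_cons, mult_IZR, IH. ring.
Qed.

Fixpoint mono_mul (m n : mono) : mono :=
  match m, n with
  | [], _ => n
  | _, [] => m
  | d :: m', e :: n' => (d + e)%nat :: mono_mul m' n'
  end.

Lemma mono_eval_mul rho i m n :
  mono_eval rho i (mono_mul m n) = mono_eval rho i m * mono_eval rho i n.
Proof.
  revert i n; induction m as [|d m IH]; intros i [|e n]; simpl; try ring.
  rewrite IH, pow_add; ring.
Qed.

Definition pmul_term (m : mono) (k : Z) (f : poly) : poly :=
  map (fun c => (mono_mul m (fst c), k * snd c)%Z) f.

Lemma eval_pmul_term rho m k f :
  eval rho (pmul_term m k f) = IZR k * mono_eval rho 0 m * eval rho f.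
Proof.
  unfold eval; induction f as [|[n c] f IH]; [unfold lin; simpl; ring|].
  change (lin (mono_eval rho 0) ((mono_mul m n, (k * c)%Z) :: pmul_term m k f)
          = IZR k * mono_eval rho 0 m * lin (mono_eval rho 0) ((n, c) :: f)).
  rewrite !lin_cons, mult_IZR, mono_eval_mul, IH. ring.
Qed.

Fixpoint pmul (f g : poly) : poly :=
  match f with
  | [] => []
  | (m, c) :: f' => padd (pmul_term m c g) (pmul f' g)
  end.

Lemma eval_padd rho f g : eval rho (padd f g) = eval rho f + eval rho g.
Proof. apply lin_padd. Qed.

Lemma eval_pscale rho k f : eval rho (pscale k f) = IZR k * eval rho f.
Proof. apply lin_pscale. Qed.

Lemma eval_pmul rho f g : eval rho (pmul f g) = eval rho f * eval rho g.
Proof.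
  induction f as [|[m c] f IH]; simpl.
  - unfold eval; simpl; ring.
  - rewrite eval_padd, eval_pmul_term, IH. unfold eval; simpl; ring.
Qed.

Definition pconst (n : nat) (k : Z) : poly := [(repeat 0%nat n, k)].

Fixpoint var_mono (n i : nat) : mono :=
  match n, i with
  | O, _ => []
  | S n', O => 1%nat :: repeat 0%nat n'
  | S n', S i' => 0%nat :: var_mono n' i'
  end.

Definition pvar (n i : nat) : poly := [(var_mono n i, 1%Z)].

Lemma mono_eval_zeros rho j n : mono_eval rho j (repeat 0%nat n) = 1.
Proof. revert j; induction n as [|n IH]; intros j; simpl; rewrite ?IH; ring. Qed.

Lemma mono_eval_var rho n j i :
  (i < n)%nat -> mono_eval rho j (var_mono n i) = rho (j + i)%nat.
Proof.
  revert j i; induction n as [|n IH]; intros j [|i] H; simpl; try lia.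
  - rewrite mono_eval_zeros, Nat.add_0_r; ring.
  - rewrite IH by lia. replace (S j + i)%nat with (j + S i)%nat by lia. ring.
Qed.

Lemma eval_pvar rho n i : (i < n)%nat -> eval rho (pvar n i) = rho i.
Proof.
  intros H. unfold eval, pvar; cbn [lin fold_right fst snd].
  rewrite mono_eval_var by auto; simpl; ring.
Qed.

Lemma eval_pconst rho n k : eval rho (pconst n k) = IZR k.
Proof. unfold eval, pconst; simpl. rewrite mono_eval_zeros; ring. Qed.

(** * Formal derivations of integer polynomials *)

Fixpoint mono_dec (i : nat) (m : mono) : nat * mono :=
  match m, i with
  | [], _ => (0%nat, [])
  | e :: m', O => (e, pred e :: m')
  | e :: m', S i' => let (k, m'') := mono_dec i' m' in (k, e :: m'')
  end.

Fixpoint partial (i : nat) (f : poly) : poly :=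
  match f with
  | [] => []
  | (m, c) :: f' =>
      let (k, m') := mono_dec i m in
      match k with
      | O => partial i f'
      | _ => (m', Z.of_nat k * c)%Z :: partial i f'
      end
  end.

(** The derivation of the polynomial ring that sends the variables, counted from i, to the entries
    of [ds]. *)
Fixpoint deriv_from (i : nat) (ds : list poly) (f : poly) : poly :=
  match ds with
  | [] => []
  | d :: ds' => padd (pmul (partial i f) d) (deriv_from (S i) ds' f)
  end.

Definition deriv := deriv_from 0.

Fixpoint mono_dsum (rho : nat -> R) (j : nat) (dl : list R) (m : mono) : R :=
  match m, dl with
  | e :: m', d :: dl' =>
      INR e * d * rho j ^ pred e * mono_eval rho (S j) m'
      + rho j ^ e * mono_dsum rho (S j) dl' m'
  | _, _ => 0
  end.

Lemma is_derive_cst (a x : R) : is_derive (fun _ : R => a) x 0.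
Proof. apply (is_derive_const (K := R_AbsRing) (V := R_NormedModule) a). Qed.

Lemma is_derive_mono_eval (rho : R -> nat -> R) t0 dl j m :
  (forall i, is_derive (fun t => rho t (j + i)%nat) t0 (nth i dl 0)) ->
  is_derive (fun t => mono_eval (rho t) j m) t0 (mono_dsum (rho t0) j dl m).
Proof.
  revert j dl; induction m as [|e m IH]; intros j dl H; simpl.
  - destruct dl; apply is_derive_cst.
  - assert (H0 := H O). rewrite Nat.add_0_r in H0.
    assert (HS : forall i, is_derive (fun t => rho t (S j + i)%nat) t0 (nth i (tl dl) 0)).
    { intros i. replace (S j + i)%nat with (j + S i)%nat by lia.
      generalize (H (S i)). destruct dl; simpl; [destruct i; auto | auto]. }
    specialize (IH _ _ HS).
    evar_last.
    { apply (is_derive_mult (fun t => rho t j ^ e) (fun t => mono_eval (rho t) (S j) m) t0).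
      - apply is_derive_pow. exact H0.
      - exact IH.
      - intros; apply Rmult_comm. }
    destruct dl as [|d dl]; simpl in *.
    + destruct m; simpl; unfold plus, mult; simpl; ring.
    + unfold plus, mult; simpl; ring.
Qed.

Fixpoint poly_dsum (rho : nat -> R) (i : nat) (dl : list R) (f : poly) : R :=
  match dl with
  | [] => 0
  | d :: dl' => eval rho (partial i f) * d + poly_dsum rho (S i) dl' f
  end.

Lemma eval_cons rho m c f : eval rho ((m, c) :: f) = IZR c * mono_eval rho 0 m + eval rho f.
Proof. reflexivity. Qed.

Lemma eval_partial_cons rho i m c f :
  eval rho (partial i ((m, c) :: f)) =
  IZR c * (INR (fst (mono_dec i m)) * mono_eval rho 0 (snd (mono_dec i m)))
  + eval rho (partial i f).
Proof.
  simpl. destruct (mono_dec i m) as [[|k] m']; cbn [fst snd].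
  - simpl; ring.
  - rewrite eval_cons, mult_IZR, <- INR_IZR_INZ. ring.
Qed.

(** The same sum as [mono_dsum], arranged by variables as [deriv_from] produces it; [mono_dsum]
    follows the factors of the monomial, as the product rule does. *)
Fixpoint mono_psum (rho : nat -> R) (j i : nat) (dl : list R) (m : mono) : R :=
  match dl with
  | [] => 0
  | d :: dl' =>
      INR (fst (mono_dec i m)) * mono_eval rho j (snd (mono_dec i m)) * d
      + mono_psum rho j (S i) dl' m
  end.

Lemma mono_psum_nil rho j i dl : mono_psum rho j i dl [] = 0.
Proof. revert i; induction dl; intros i; simpl; [|rewrite IHdl]; destruct i; simpl; ring. Qed.

Lemma mono_psum_cons rho j i dl e m :
  mono_psum rho j (S i) dl (e :: m) = rho j ^ e * mono_psum rho (S j) i dl m.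
Proof.
  revert i; induction dl as [|d dl IH]; intros i; simpl; [ring|].
  cbn [mono_psum]. rewrite IH. cbn [mono_dec]. destruct (mono_dec i m); simpl; ring.
Qed.

Lemma mono_psum_dsum rho j dl m : mono_psum rho j 0 dl m = mono_dsum rho j dl m.
Proof.
  revert j dl; induction m as [|e m IH]; intros j dl.
  - rewrite mono_psum_nil; destruct dl; reflexivity.
  - destruct dl as [|d dl]; [reflexivity|].
    cbn [mono_psum mono_dsum]. rewrite mono_psum_cons, IH. simpl. ring.
Qed.

Lemma poly_dsum_cons rho i dl m c f :
  poly_dsum rho i dl ((m, c) :: f) =
  IZR c * mono_psum rho 0 i dl m + poly_dsum rho i dl f.
Proof.
  revert i; induction dl as [|d dl IH]; intros i.
  - simpl; ring.
  - cbn [poly_dsum mono_psum]. rewrite eval_partial_cons, IH. ring.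
Qed.

Lemma is_derive_eval_dsum (rho : R -> nat -> R) t0 dl f :
  (forall i, is_derive (fun t => rho t i) t0 (nth i dl 0)) ->
  is_derive (fun t => eval (rho t) f) t0 (poly_dsum (rho t0) 0 dl f).
Proof.
  intros H. induction f as [|[m c] f IH].
  - replace (poly_dsum (rho t0) 0 dl []) with 0.
    + apply (is_derive_cst 0).
    + generalize 0%nat; clear; induction dl as [|d dl IH]; intros i; simpl; auto.
      rewrite <- IH. unfold eval; simpl; ring.
  - rewrite poly_dsum_cons, mono_psum_dsum.
    apply (is_derive_plus (fun t => IZR c * mono_eval (rho t) 0 m) (fun t => eval (rho t) f)).
    + apply (is_derive_scal (fun t => mono_eval (rho t) 0 m)).
      apply is_derive_mono_eval; exact H.
    + exact IH.
Qed.

Lemma eval_deriv_from rho i ds f (w : R) :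
  poly_dsum rho i (map (fun d => w * eval rho d) ds) f = w * eval rho (deriv_from i ds f).
Proof.
  revert i; induction ds as [|d ds IH]; intros i; simpl.
  - unfold eval; simpl; ring.
  - rewrite IH, eval_padd, eval_pmul; ring.
Qed.

(** The factor [w] takes up what is not polynomial in the derivatives, such as a denominator. Past
    the end of [ds] the default [[]] evaluates to 0, so the remaining variables count as
    constant. *)
Lemma is_derive_eval (rho : R -> nat -> R) t0 w ds f :
  (forall i, is_derive (fun t => rho t i) t0 (w * eval (rho t0) (nth i ds []))) ->
  is_derive (fun t => eval (rho t) f) t0 (w * eval (rho t0) (deriv ds f)).
Proof.
  intros H. unfold deriv. rewrite <- eval_deriv_from. apply is_derive_eval_dsum.
  intros i. specialize (H i).
  replace (nth i _ 0) with (w * eval (rho t0) (nth i ds [])); auto.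
  destruct (Nat.lt_ge_cases i (length ds)) as [Hi|Hi].
  - rewrite (nth_indep _ 0 (w * eval (rho t0) [])) by (rewrite length_map; exact Hi).
    rewrite (map_nth (fun d => w * eval (rho t0) d)); reflexivity.
  - rewrite !nth_overflow by (rewrite ?length_map; exact Hi).
    unfold eval; simpl; ring.
Qed.

(** * Nakayama's lemma and Gaussian elimination modulo p *)

Fixpoint zdot (cs : list Z) (l : list R) : R :=
  match cs, l with
  | c :: cs', x :: l' => IZR c * x + zdot cs' l'
  | _, _ => 0
  end.

Fixpoint zcomb (a : Z) (cs : list Z) (b : Z) (ds : list Z) (n : nat) : list Z :=
  match n with
  | O => []
  | S n' => (a * hd 0 cs + b * hd 0 ds)%Z :: zcomb a (tl cs) b (tl ds) n'
  end.

Lemma zdot_zcomb a cs b ds l :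
  zdot (zcomb a cs b ds (length l)) l = IZR a * zdot cs l + IZR b * zdot ds l.
Proof.
  revert cs ds; induction l as [|x l IH]; intros cs ds.
  - destruct cs, ds; simpl; ring.
  - cbn [length zcomb zdot]. rewrite IH, plus_IZR, !mult_IZR.
    destruct cs, ds; simpl; try (destruct l; simpl); ring.
Qed.

(* Nakayama's lemma for the localization at p of the subgroup of R generated by l. *)
Lemma nakayama (p : Z) (l : list R) :
  (1 < p)%Z ->
  (forall x, In x l -> exists a cs, (a mod p = 1)%Z /\ IZR a * x = IZR p * zdot cs l) ->
  forall x, In x l -> x = 0.
Proof.
  intros Hp. induction l as [|x0 l IH]; intros H x Hx; [destruct Hx|].
  destruct (H x0 (or_introl eq_refl)) as (a0 & cs0 & Ha0 & E0).
  (* Moving the x0 term of the right side to the left changes the coefficient by a multiple of p, so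
     it stays congruent to 1. *)
  assert (Hb : exists b cs, (b mod p = 1)%Z /\ IZR b * x0 = IZR p * zdot cs l).
  { exists (a0 - p * hd 0 cs0)%Z, (tl cs0). split.
    - replace (a0 - p * hd 0 cs0)%Z with (a0 + (- hd 0 cs0) * p)%Z by ring.
      rewrite Z.mod_add by lia. exact Ha0.
    - rewrite minus_IZR, mult_IZR.
      destruct cs0 as [|c cs0]; simpl in E0 |- *.
      + replace (zdot [] l) with 0 by (destruct l; reflexivity). lra.
      + lra. }
  destruct Hb as (b & ds & Hb & Eb).
  assert (Hl : forall y, In y l -> y = 0).
  { apply IH. intros y Hy.
    destruct (H y (or_intror Hy)) as (a & cs & Ha & Ea).
    (* After multiplication by b, the term b x0 on the right is replaced by p times a combination of
       l; this removes x0 from the relation for y. *)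
    exists (b * a)%Z, (zcomb (p * hd 0 cs)%Z ds b (tl cs) (length l)). split.
    - rewrite Z.mul_mod, Hb, Ha, Z.mul_1_l by lia. apply Z.mod_1_l; exact Hp.
    - rewrite zdot_zcomb, !mult_IZR.
      assert (E : zdot cs (x0 :: l) = IZR (hd 0%Z cs) * x0 + zdot (tl cs) l).
      { destruct cs; simpl; [destruct l; simpl|]; ring. }
      rewrite E in Ea.
      transitivity (IZR b * (IZR a * y)); [ring|]. rewrite Ea.
      transitivity (IZR p * (IZR (hd 0%Z cs) * (IZR b * x0) + IZR b * zdot (tl cs) l)); [ring|].
      rewrite Eb. ring. }
  destruct Hx as [<-|Hx]; [|auto].
  assert (Z0 : zdot ds l = 0).
  { clear - Hl. revert ds; induction l as [|y l IH]; intros [|d ds]; simpl; auto.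
    rewrite (Hl y) by (left; reflexivity). rewrite IH; [ring|].
    intros z Hz; apply Hl; right; exact Hz. }
  rewrite Z0, Rmult_0_r in Eb.
  apply Rmult_integral in Eb as [Eb|Eb]; [|exact Eb].
  apply eq_IZR in Eb; subst b. rewrite Z.mod_0_l in Hb by lia. discriminate.
Qed.

(* Pivot rows are kept sorted by decreasing leading monomial. *)
Definition pmod (p : Z) (f : poly) : poly :=
  filter (fun c => negb (Z.eqb (snd c) 0)) (map (fun c => (fst c, (snd c) mod p)%Z) f).

(** The recursion comes from p = (p / a) a + (p mod a). The result is not proved to be an inverse;
    instead [solved] checks that each leading coefficient is 1. *)
Fixpoint inv_mod (fuel : nat) (p a : Z) : Z :=
  match fuel with
  | O => 1
  | S n => if Z.eqb a 1 then 1
           else (- (p / a) * inv_mod n p (p mod a))%Z mod p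
  end.

Definition normalize (p : Z) (f : poly) : poly :=
  match f with
  | [] => []
  | (m, c) :: _ => pmod p (pscale (inv_mod 64 p c) f)
  end.

Fixpoint insert_row (p : Z) (row : poly) (pivots : list poly) : list poly :=
  match row with
  | [] => pivots
  | (m, c) :: _ =>
      match pivots with
      | [] => [normalize p row]
      | pv :: rest =>
          match pv with
          | [] => pv :: insert_row p row rest
          | (n, _) :: _ =>
              match mono_cmp m n with
              | Eq => pv :: insert_row p (pmod p (padd row (pscale (- c) pv))) rest
              | Gt => normalize p row :: pivots
              | Lt => pv :: insert_row p row rest
              end
          end
      end
  end.

Definition eliminate (p : Z) (rows : list poly) : list poly :=
  fold_left (fun pivots row => insert_row p (pmod p row) pivots) rows [].

Definition mono_eqb (m n : mono) : bool :=
  match mono_cmp m n with Eq => true | _ => false end.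

Definition mono_mem (m : mono) (l : list mono) : bool := existsb (mono_eqb m) l.

(* No back substitution: modulo p, the leading monomial of a pivot row vanishes as
   soon as the leading monomials of the later rows do. *)
Fixpoint solved (pivots : list poly) : option (list mono) :=
  match pivots with
  | [] => Some []
  | row :: rest =>
      match solved rest, row with
      | Some leads, (m, c) :: tail =>
          if (Z.eqb c 1 && forallb (fun t => mono_mem (fst t) leads) tail)%bool
          then Some (m :: leads) else None
      | _, _ => None
      end
  end.

Definition full_rank (p : Z) (cols : list mono) (rows : list poly) : bool :=
  match solved (eliminate p rows) with
  | Some leads => forallb (fun m => mono_mem m leads) cols
  | None => false
  end.

Section Rank.

Variables (p : Z) (X : mono -> R) (cols : list mono).
Hypothesis Hp : (1 < p)%Z.
Hypothesis HX : forall m, ~ In m cols -> X m = 0.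

(** Membership in p times the additive group generated by the values of [X]. Congruences modulo p
    between real numbers are read in this sense, and row operations modulo p respect it. *)
Definition pdiv (x : R) : Prop := exists e : poly, x = IZR p * lin X e.

Lemma pdiv_0 : pdiv 0.
Proof. exists []; unfold lin; simpl; ring. Qed.

Lemma pdiv_plus x y : pdiv x -> pdiv y -> pdiv (x + y).
Proof. intros [e ->] [f ->]. exists (padd e f). rewrite lin_padd; ring. Qed.

Lemma pdiv_scal k x : pdiv x -> pdiv (IZR k * x).
Proof. intros [e ->]. exists (pscale k e). rewrite lin_pscale; ring. Qed.

Lemma pdiv_multiple k m : pdiv (IZR (p * k) * X m).
Proof. exists [(m, k)]. unfold lin; simpl. rewrite mult_IZR; ring. Qed.

Lemma pdiv_pmod f : pdiv (lin X f) <-> pdiv (lin X (pmod p f)).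
Proof.
  assert (H : pdiv (lin X f - lin X (pmod p f)) /\ pdiv (lin X (pmod p f) - lin X f)).
  { induction f as [|[m c] f [IH1 IH2]].
    - split; replace (_ - _) with 0 by (unfold lin; simpl; ring); apply pdiv_0.
    - assert (E : lin X (pmod p ((m, c) :: f))
                  = IZR (c mod p) * X m + lin X (pmod p f)).
      { unfold pmod; simpl. destruct (Z.eqb_spec (c mod p) 0) as [->|]; simpl;
          [ring|reflexivity]. }
      rewrite E, lin_cons.
      assert (Ec : IZR c = IZR (p * (c / p)) + IZR (c mod p)).
      { rewrite <- plus_IZR, <- Z.div_mod by lia. reflexivity. }
      split.
      + replace (_ - _) with (IZR (p * (c / p)) * X m + (lin X f - lin X (pmod p f)))
          by (rewrite Ec; ring).
        apply pdiv_plus; [apply pdiv_multiple|exact IH1].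
      + replace (_ - _) with (IZR (-1) * (IZR (p * (c / p)) * X m) + (lin X (pmod p f) - lin X f))
          by (rewrite Ec; simpl; ring).
        apply pdiv_plus; [apply pdiv_scal, pdiv_multiple|exact IH2]. }
  destruct H as [H1 H2]. split; intros H.
  - replace (lin X (pmod p f)) with (lin X f + (lin X (pmod p f) - lin X f)) by ring.
    apply pdiv_plus; auto.
  - replace (lin X f) with (lin X (pmod p f) + (lin X f - lin X (pmod p f))) by ring.
    apply pdiv_plus; auto.
Qed.

Definition pdiv_row (f : poly) : Prop := pdiv (lin X f).

Lemma pdiv_normalize f : pdiv_row f -> pdiv_row (normalize p f).
Proof.
  unfold pdiv_row, normalize. destruct f as [|[m c] f]; auto. intros H.
  apply -> pdiv_pmod. rewrite lin_pscale. apply pdiv_scal; exact H.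
Qed.

Lemma pdiv_insert_row row pivots :
  pdiv_row row -> Forall pdiv_row pivots -> Forall pdiv_row (insert_row p row pivots).
Proof.
  revert row; induction pivots as [|pv rest IH]; intros row Hr Hpv.
  - destruct row as [|[m c] row]; simpl; auto.
    constructor; auto. apply (pdiv_normalize ((m, c) :: row)); exact Hr.
  - inversion Hpv as [|? ? H1 H2]; subst.
    destruct row as [|[m c] row]; [exact Hpv|].
    destruct pv as [|[n d] pv]; cbn [insert_row].
    + constructor; auto.
    + destruct (mono_cmp m n).
      * constructor; auto. apply IH; auto.
        apply -> pdiv_pmod. rewrite lin_padd, lin_pscale.
        apply pdiv_plus; auto. apply pdiv_scal; exact H1.
      * constructor; auto.
      * constructor; auto. apply (pdiv_normalize ((m, c) :: row)); exact Hr.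
Qed.

Lemma pdiv_eliminate rows :
  Forall pdiv_row rows -> Forall pdiv_row (eliminate p rows).
Proof.
  unfold eliminate. assert (H0 : Forall pdiv_row []) by constructor.
  revert H0. generalize (@nil poly).
  induction rows as [|row rows IH]; intros pivots H0 H; simpl; auto.
  inversion H; subst. apply IH; auto.
  apply pdiv_insert_row; auto. apply -> pdiv_pmod; assumption.
Qed.

Lemma mono_mem_In m l : mono_mem m l = true -> In m l.
Proof.
  unfold mono_mem. intros H. apply existsb_exists in H as (n & Hn & E).
  unfold mono_eqb in E. destruct (mono_cmp m n) eqn:Hc; try discriminate.
  apply mono_cmp_eq in Hc; subst; exact Hn.
Qed.

Lemma pdiv_solved pivots leads :
  Forall pdiv_row pivots -> solved pivots = Some leads ->
  forall m, In m leads -> pdiv (X m).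
Proof.
  revert leads; induction pivots as [|row rest IH]; intros leads Hpv Hs m Hm.
  - inversion Hs; subst; destruct Hm.
  - inversion Hpv as [|? ? H1 H2]; subst. simpl in Hs.
    destruct (solved rest) as [leads'|]; [|discriminate].
    destruct row as [|[n c] tail]; [discriminate|].
    destruct (Z.eqb_spec c 1) as [->|]; [|discriminate]. simpl in Hs.
    destruct (forallb _ tail) eqn:Ht; [|discriminate].
    inversion Hs; subst. destruct Hm as [<-|Hm]; [|apply (IH _ H2 eq_refl _ Hm)].
    assert (Htail : pdiv (lin X tail)).
    { clear - IH H2 Ht. induction tail as [|[k e] tail IHt]; [apply pdiv_0|].
      simpl in Ht. apply andb_prop in Ht as [Hk Ht].
      rewrite lin_cons. apply pdiv_plus; [|auto].
      apply pdiv_scal. apply (IH _ H2 eq_refl). apply mono_mem_In; exact Hk. }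
    unfold pdiv_row in H1. rewrite lin_cons in H1.
    replace (X n) with (1 * X n + lin X tail + IZR (-1) * lin X tail) by (simpl; ring).
    apply pdiv_plus; [exact H1|]. apply pdiv_scal; exact Htail.
Qed.

Lemma lin_zdot e : exists cs, lin X e = zdot cs (map X cols).
Proof.
  induction e as [|[m c] e [cs IH]].
  - exists []. destruct cols; reflexivity.
  - rewrite lin_cons, IH.
    assert (H : exists ds, X m = zdot ds (map X cols)).
    { destruct (in_dec (list_eq_dec Nat.eq_dec) m cols) as [Hm|Hm].
      - clear IH HX. induction cols as [|n l IHl]; [destruct Hm|].
        destruct Hm as [->|Hm].
        + exists [1%Z]. simpl. destruct (map X l); simpl; ring.
        + destruct (IHl Hm) as [ds E]. exists (0%Z :: ds). simpl. rewrite <- E. ring.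
      - rewrite (HX m Hm). exists []. destruct (map X cols); reflexivity. }
    destruct H as [ds ->].
    exists (zcomb c ds 1 cs (length (map X cols))). rewrite zdot_zcomb. ring.
Qed.

(** Full rank modulo p puts every [X m] into p times the group generated by the values on [cols];
    this is the hypothesis of [nakayama] with all coefficients a equal to 1. *)
Lemma full_rank_zero rows :
  Forall (fun f => pdiv_row f) rows -> full_rank p cols rows = true ->
  forall m, In m cols -> X m = 0.
Proof.
  intros Hr Hf m Hm. unfold full_rank in Hf.
  destruct (solved (eliminate p rows)) as [leads|] eqn:Hs; [|discriminate].
  assert (Hd : forall n, In n cols -> pdiv (X n)).
  { intros n Hn. apply (pdiv_solved _ _ (pdiv_eliminate _ Hr) Hs).
    apply mono_mem_In. rewrite forallb_forall in Hf. apply Hf; exact Hn. }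
  apply (nakayama p (map X cols) Hp).
  - intros x Hx. apply in_map_iff in Hx as (n & <- & Hn).
    destruct (Hd n Hn) as [e E]. destruct (lin_zdot e) as [cs Ecs].
    exists 1%Z, cs. split; [apply Z.mod_1_l; exact Hp|].
    rewrite E, Ecs. ring.
  - apply in_map; exact Hm.
Qed.

End Rank.

(** * Polynomial expressions and their normal forms *)

Inductive pexpr : Type :=
  | PC (c : Z) | PV (i : nat)
  | PAdd (e1 e2 : pexpr) | PSub (e1 e2 : pexpr) | PMul (e1 e2 : pexpr)
  | PPow (e : pexpr) (n : nat).

Fixpoint peval (rho : nat -> R) (e : pexpr) : R :=
  match e with
  | PC c => IZR c
  | PV i => rho i
  | PAdd e1 e2 => peval rho e1 + peval rho e2
  | PSub e1 e2 => peval rho e1 - peval rho e2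
  | PMul e1 e2 => peval rho e1 * peval rho e2
  | PPow e1 n => peval rho e1 ^ n
  end.

Fixpoint ppow (n : nat) (f : poly) (k : nat) : poly :=
  match k with O => pconst n 1 | S k' => pmul f (ppow n f k') end.

Fixpoint norm (n : nat) (e : pexpr) : poly :=
  match e with
  | PC c => if Z.eqb c 0 then [] else pconst n c
  | PV i => pvar n i
  | PAdd e1 e2 => padd (norm n e1) (norm n e2)
  | PSub e1 e2 => padd (norm n e1) (pscale (-1) (norm n e2))
  | PMul e1 e2 => pmul (norm n e1) (norm n e2)
  | PPow e1 k => ppow n (norm n e1) k
  end.

Fixpoint vars_below (n : nat) (e : pexpr) : bool :=
  match e with
  | PC _ => true
  | PV i => Nat.ltb i n
  | PAdd e1 e2 | PSub e1 e2 | PMul e1 e2 => (vars_below n e1 && vars_below n e2)%bool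
  | PPow e1 _ => vars_below n e1
  end.

Lemma eval_norm rho n e : vars_below n e = true -> eval rho (norm n e) = peval rho e.
Proof.
  induction e; simpl; intros H; try (apply andb_prop in H as [H1 H2]).
  - destruct (Z.eqb_spec c 0) as [->|]; [reflexivity|apply eval_pconst].
  - apply eval_pvar. apply Nat.ltb_lt; exact H.
  - rewrite eval_padd, IHe1, IHe2 by assumption; reflexivity.
  - rewrite eval_padd, eval_pscale, IHe1, IHe2 by assumption; ring.
  - rewrite eval_pmul, IHe1, IHe2 by assumption; reflexivity.
  - induction n0 as [|k IHk]; simpl; [apply eval_pconst|].
    rewrite eval_pmul, IHe, IHk by assumption; reflexivity.
Qed.

Lemma eval_norm_mul rho n f g :
  eval rho (norm n (PMul f g)) = eval rho (norm n f) * eval rho (norm n g).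
Proof. apply eval_pmul. Qed.

(** * Polynomial relations between smooth functions *)

Definition env (fs : list (R -> R -> R)) (u v : R) (j : nat) : R :=
  nth j fs (fun _ _ => 0) u v.

Lemma is_derive_env O i fs u v w ds f :
  open O -> Forall (smooth O) fs -> O (u, v) ->
  (forall j, (j < length fs)%nat ->
     pd i (nth j fs (fun _ _ => 0)) u v = w * eval (env fs u v) (nth j ds [])) ->
  (length ds <= length fs)%nat ->
  is_derive (line i (fun u v => eval (env fs u v) f) u v) (at_coord i u v)
    (w * eval (env fs u v) (deriv ds f)).
Proof.
  intros hO Hfs Huv Hd Hlen.
  assert (H : forall j, is_derive (line i (nth j fs (fun _ _ => 0)) u v) (at_coord i u v)
                (w * eval (env fs u v) (nth j ds []))).
  { intros j. destruct (Nat.lt_ge_cases j (length fs)) as [Hj|Hj].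
    - rewrite <- Hd by exact Hj. apply smooth_is_derive with O; [|exact Huv].
      apply Forall_nth; auto.
    - rewrite (nth_overflow fs), (nth_overflow ds) by lia.
      replace (w * eval (env fs u v) []) with 0 by (unfold eval; simpl; ring).
      destruct i; apply is_derive_cst. }
  destruct i.
  - apply (is_derive_eval (fun t => env fs t v) u w ds f H).
  - apply (is_derive_eval (fun t => env fs u t) v w ds f H).
Qed.

(** A relation that holds on an open set may be differentiated, and the factor w has no zero and
    cancels. Relations are thereby stable under the formal derivation. *)
Lemma deriv_zero O i fs ds f (w : R -> R -> R) :
  open O -> Forall (smooth O) fs -> (length ds <= length fs)%nat ->
  (forall u v, O (u, v) -> w u v <> 0) ->
  (forall u v j, O (u, v) -> (j < length fs)%nat ->
     pd i (nth j fs (fun _ _ => 0)) u v = w u v * eval (env fs u v) (nth j ds [])) ->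
  (forall u v, O (u, v) -> eval (env fs u v) f = 0) ->
  forall u v, O (u, v) -> eval (env fs u v) (deriv ds f) = 0.
Proof.
  intros hO Hfs Hlen Hw Hd Hf u v Huv.
  assert (E := is_derive_env O i fs u v (w u v) ds f hO Hfs Huv (fun j => Hd u v j Huv) Hlen).
  apply is_derive_unique in E.
  assert (E0 : pd i (fun u v => eval (env fs u v) f) u v = 0).
  { transitivity (pd i (fun _ _ => 0) u v); [|apply pd_const].
    apply (pd_ext O hO); assumption. }
  rewrite pd_line in E0. rewrite E in E0. clear E; rename E0 into E.
  apply Rmult_integral in E as [E|E]; [|exact E].
  elim (Hw u v Huv E).
Qed.

(* Equality of the mixed derivatives of x, where x_u = num / den and x_v = w * dm. *)
Lemma mixed_poly O fs x (w w' : R -> R -> R) DD TT num den dm u v dw :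
  open O -> Forall (smooth O) fs -> smooth O x ->
  (length DD <= length fs)%nat -> (length TT <= length fs)%nat ->
  (forall u v j, O (u, v) -> (j < length fs)%nat ->
     pd V (nth j fs (fun _ _ => 0)) u v = w u v * eval (env fs u v) (nth j DD [])) ->
  (forall u v j, O (u, v) -> (j < length fs)%nat ->
     pd U (nth j fs (fun _ _ => 0)) u v = w' u v * eval (env fs u v) (nth j TT [])) ->
  (forall u v, O (u, v) -> eval (env fs u v) den * pd U x u v = eval (env fs u v) num) ->
  (forall u v, O (u, v) -> pd V x u v = w u v * eval (env fs u v) dm) ->
  O (u, v) -> is_derive (fun t => w t v) u dw ->
  eval (env fs u v) den
    * (dw * eval (env fs u v) dm + w u v * (w' u v * eval (env fs u v) (deriv TT dm)))
  + w u v * eval (env fs u v) (deriv DD den) * pd U x u v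
  = w u v * eval (env fs u v) (deriv DD num).
Proof.
  intros hO Hfs Hx HlD HlT HV HU Hu Hv Huv Hw.
  assert (HDV : forall f, is_derive (fun t => eval (env fs u t) f) v
     (w u v * eval (env fs u v) (deriv DD f))).
  { intros f. apply (is_derive_env O V fs u v (w u v) DD f hO Hfs Huv
      (fun j => HV u v j Huv) HlD). }
  assert (HDU : is_derive (fun t => eval (env fs t v) dm) u
     (w' u v * eval (env fs u v) (deriv TT dm))).
  { apply (is_derive_env O U fs u v (w' u v) TT dm hO Hfs Huv
      (fun j => HU u v j Huv) HlT). }
  assert (I2 : pd V (pd U x) u v = dw * eval (env fs u v) dm
    + w u v * (w' u v * eval (env fs u v) (deriv TT dm))).
  { rewrite (pd_comm O hO x u v Hx Huv).
    transitivity (pd U (fun u v => w u v * eval (env fs u v) dm) u v);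
      [apply (pd_ext O hO); assumption|].
    apply is_derive_unique. apply (is_derive_Rmult _ _ _ _ _ Hw HDU). }
  rewrite <- I2.
  assert (E1 := is_derive_Rmult _ _ _ _ _ (HDV den)
    (smooth_is_derive_V O (pd U x) u v (smooth_pd O U x Hx) Huv)).
  assert (E2 := HDV num).
  apply is_derive_unique in E1. apply is_derive_unique in E2.
  assert (E0 := pd_ext O hO V _ _ u v Hu Huv).
  assert (E := eq_trans (eq_sym E1) (eq_trans E0 E2)).
  rewrite <- E. ring.
Qed.

Definition supported (cols : list mono) (f : poly) : bool :=
  forallb (fun c => mono_mem (fst c) cols) f.

Definition multiples (f : poly) (ms : list mono) : list poly :=
  map (fun m => pmul_term m 1 f) ms.

(* The rows are relations with integer coefficients, together with the
   multiples by ms of zp - r * lp, which holds modulo p. *)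
Definition rank_check (p r : Z) (cols : list mono) (zp lp : poly) (ms : list mono)
    (rows : list poly) : bool :=
  (forallb (supported cols) rows
   && forallb (supported cols) (multiples zp ms)
   && forallb (supported cols) (multiples lp ms)
   && full_rank p cols (multiples (padd zp (pscale (-r) lp)) ms ++ rows))%bool.

Lemma rank_check_zero p r cols zp lp ms rows rho a b :
  (1 < p)%Z -> (b mod p = 1)%Z -> (a mod p = r mod p)%Z ->
  IZR b * eval rho zp = IZR a * eval rho lp ->
  (forall f, In f rows -> eval rho f = 0) ->
  rank_check p r cols zp lp ms rows = true ->
  forall m, In m cols -> mono_eval rho 0 m = 0.
Proof.
  intros Hp Hb Ha Hab Hrows Hc.
  unfold rank_check in Hc. repeat (apply andb_prop in Hc as [Hc ?]).
  rename Hc into C1. rename H1 into C2. rename H0 into C3. rename H into C4.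
  rewrite forallb_forall in C1, C2, C3.
  (* Cut off outside [cols], so that only finitely many values generate the group; on supported
     polynomials [lin X] still agrees with [eval]. *)
  set (X m := if mono_mem m cols then mono_eval rho 0 m else 0).
  assert (Hmem : forall m, In m cols -> mono_mem m cols = true).
  { intros m Hm. apply existsb_exists. exists m. split; [exact Hm|].
    unfold mono_eqb. clear. induction m as [|e m IH]; simpl; [reflexivity|].
    rewrite Nat.compare_refl. exact IH. }
  assert (HX : forall m, ~ In m cols -> X m = 0).
  { intros m Hm. unfold X. destruct (mono_mem m cols) eqn:E; [|reflexivity].
    elim Hm. apply mono_mem_In; exact E. }
  assert (Hlin : forall f, supported cols f = true -> lin X f = eval rho f).
  { induction f as [|[m c] f IH]; intros Hf; [reflexivity|].
    simpl in Hf. apply andb_prop in Hf as [H1 H2].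
    rewrite lin_cons, eval_cons, IH by exact H2. unfold X. rewrite H1. reflexivity. }
  assert (Hall : Forall (pdiv_row p X) (multiples (padd zp (pscale (- r) lp)) ms ++ rows)).
  { apply Forall_app; split; apply Forall_forall.
    - intros f Hf. apply in_map_iff in Hf as (m & <- & Hm).
      assert (S1 := C2 _ (in_map (fun m => pmul_term m 1 zp) _ _ Hm)).
      assert (S2 := C3 _ (in_map (fun m => pmul_term m 1 lp) _ _ Hm)).
      cbv beta in S1, S2.
      assert (E : lin X (pmul_term m 1 (padd zp (pscale (- r) lp)))
                = lin X (pmul_term m 1 zp) + IZR (- r) * lin X (pmul_term m 1 lp)).
      { generalize (- r)%Z as r'. clear. intros r'.
        assert (P : forall f, lin X (pmul_term m 1 f) = lin (fun n => X (mono_mul m n)) f).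
        { induction f as [|[n c] f IH]; [reflexivity|].
          change (lin X ((mono_mul m n, (1 * c)%Z) :: pmul_term m 1 f)
            = lin (fun n => X (mono_mul m n)) ((n, c) :: f)).
          rewrite !lin_cons, IH, Z.mul_1_l. reflexivity. }
        rewrite !P, lin_padd, lin_pscale. reflexivity. }
      unfold pdiv_row, pdiv.
      (* With b = p (b / p) + 1 and a - r = p (a / p - r / p), integer quotients throughout, b zp =
         a lp becomes zp - r lp = p (- (b / p) zp + (a / p - r / p) lp). *)
      exists (padd (pscale (- (b / p)) (pmul_term m 1 zp))
                   (pscale ((a / p - r / p)) (pmul_term m 1 lp))).
      rewrite E, lin_padd, !lin_pscale, (Hlin _ S1), (Hlin _ S2), !eval_pmul_term.
      assert (Eb : IZR b = IZR p * IZR (b / p) + 1).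
      { rewrite <- mult_IZR, <- plus_IZR. f_equal.
        rewrite (Z.div_mod b p) at 1 by lia. rewrite Hb. reflexivity. }
      assert (Ea : IZR a = IZR p * IZR (a / p) + IZR (r mod p)).
      { rewrite <- mult_IZR, <- plus_IZR. f_equal.
        rewrite (Z.div_mod a p) at 1 by lia. rewrite Ha. reflexivity. }
      assert (Er : IZR r = IZR p * IZR (r / p) + IZR (r mod p)).
      { rewrite <- mult_IZR, <- plus_IZR. f_equal. apply Z.div_mod. lia. }
      assert (Hz : eval rho zp = IZR a * eval rho lp - IZR p * IZR (b / p) * eval rho zp).
      { rewrite <- Hab, Eb. ring. }
      rewrite !opp_IZR, minus_IZR. rewrite Hz at 1. rewrite Ea, Er. ring.
    - intros f Hf. unfold pdiv_row. rewrite (Hlin _ (C1 f Hf)), (Hrows f Hf). apply pdiv_0. }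
  intros m Hm.
  assert (E := full_rank_zero p X cols Hp HX _ Hall C4 m Hm).
  unfold X in E. rewrite (Hmem m Hm) in E. exact E.
Qed.

(** * Rational values of nonconstant functions *)

Lemma rational_between (p r : Z) (c d : R) : (1 < p)%Z -> c < d ->
  exists a b : Z, (0 < b)%Z /\ (b mod p = 1)%Z /\ (a mod p = r mod p)%Z /\
    c < IZR a / IZR b < d.
Proof.
  intros Hp Hcd.
  assert (Hp' : 1 < IZR p) by (apply (IZR_lt 1); exact Hp).
  (* The fractions with numerators r + k p over a fixed b are p / b apart; b = 1 + j p is taken so
     large that this gap is less than d - c. *)
  set (j := up (IZR p / (d - c))).
  assert (Hj : IZR p / (d - c) < IZR j) by apply archimed.
  assert (Hj0 : 0 < IZR p / (d - c)) by (apply Rdiv_lt_0_compat; lra).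
  assert (Hjz : (0 < j)%Z) by (apply lt_IZR; lra).
  set (b := (1 + j * p)%Z).
  assert (Hb : (0 < b)%Z) by (unfold b; nia).
  assert (Hb' : 0 < IZR b) by (apply (IZR_lt 0); exact Hb).
  assert (Hbd : IZR p < (d - c) * IZR b).
  { apply Rmult_lt_reg_r with (/ (d - c)); [apply Rinv_0_lt_compat; lra|].
    replace ((d - c) * IZR b * / (d - c)) with (IZR b) by (field; lra).
    fold (IZR p / (d - c)). apply Rlt_trans with (1 := Hj). apply IZR_lt. unfold b. nia. }
  set (k := up ((c * IZR b - IZR r) / IZR p)).
  destruct (archimed ((c * IZR b - IZR r) / IZR p)) as [K1 K2]. fold k in K1, K2.
  exists (r + k * p)%Z, b. split; [exact Hb|]. split; [|split].
  - unfold b. rewrite Z.mod_add by lia. apply Z.mod_1_l; exact Hp.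
  - apply Z.mod_add; lia.
  - rewrite plus_IZR, mult_IZR.
    assert (E : IZR p * ((c * IZR b - IZR r) / IZR p) = c * IZR b - IZR r) by (field; lra).
    split.
    + apply Rmult_lt_reg_r with (IZR b); [exact Hb'|].
      unfold Rdiv. rewrite Rmult_assoc, Rinv_l, Rmult_1_r by lra. nra.
    + apply Rmult_lt_reg_r with (IZR b); [exact Hb'|].
      unfold Rdiv. rewrite Rmult_assoc, Rinv_l, Rmult_1_r by lra. nra.
Qed.

Lemma ivt_between (g : R -> R) t0 t1 y :
  (forall t, Rmin t0 t1 <= t <= Rmax t0 t1 -> continuity_pt g t) ->
  Rmin (g t0) (g t1) < y < Rmax (g t0) (g t1) ->
  exists t, Rmin t0 t1 <= t <= Rmax t0 t1 /\ g t = y.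
Proof.
  intros Hc Hy.
  assert (Hlt : Rmin t0 t1 < Rmax t0 t1).
  { destruct (Req_dec t0 t1) as [<-|Hne].
    - rewrite Rmin_left, Rmax_left in Hy by lra. lra.
    - unfold Rmin, Rmax. destruct (Rle_dec t0 t1); lra. }
  set (lo := Rmin t0 t1) in *. set (hi := Rmax t0 t1) in *.
  assert (Hy' : Rmin (g lo) (g hi) < y < Rmax (g lo) (g hi)).
  { unfold lo, hi, Rmin, Rmax in *. destruct (Rle_dec t0 t1); auto.
    destruct (Rle_dec (g t0) (g t1)), (Rle_dec (g t1) (g t0)); lra. }
  destruct (Rle_lt_dec (g lo) (g hi)) as [Hle|Hle].
  - rewrite Rmin_left, Rmax_right in Hy' by lra.
    destruct (IVT_interv (fun t => g t - y) lo hi) as (t & Ht & E); try lra.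
    + intros t Ht. apply continuity_pt_minus; [auto|apply continuity_pt_const; intros ? ?; auto].
    + exists t; split; [exact Ht|lra].
  - rewrite Rmin_right, Rmax_left in Hy' by lra.
    destruct (IVT_interv (fun t => y - g t) lo hi) as (t & Ht & E); try lra.
    + intros t Ht. apply continuity_pt_minus; [apply continuity_pt_const; intros ? ?; auto|auto].
    + exists t; split; [exact Ht|lra].
Qed.

Lemma nonconstant_of_derive (g : R -> R) t0 g' (e : posreal) :
  is_derive g t0 g' -> g' <> 0 ->
  exists t1, Rabs (t1 - t0) < e /\ g t1 <> g t0.
Proof.
  intros Hg H0. apply NNPP. intros Hn. apply H0.
  apply (is_derive_unique g t0) in Hg. rewrite <- Hg.
  rewrite (Derive_ext_loc g (fun _ => g t0)); [apply Derive_const|].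
  exists e. intros t Ht. apply NNPP. intros H. apply Hn. exists t. split; [exact Ht|exact H].
Qed.

Section OpenSet.

Variable O : R * R -> Prop.
Hypothesis hO : open O.

Lemma open_neq f c : smooth O f -> open (fun p => O p /\ f (fst p) (snd p) <> c).
Proof.
  intros Hf [u v] [Huv Hne]. simpl in Hne.
  assert (Hc := smooth_continuity_2d O f u v Hf Huv).
  assert (He : 0 < Rabs (f u v - c)) by (apply Rabs_pos_lt; lra).
  destruct (Hc (mkposreal _ He)) as [d Hd].
  destruct (open_box O hO u v Huv) as [e Hbox].
  assert (Hm : 0 < Rmin d e) by (apply Rmin_case; apply cond_pos).
  exists (mkposreal _ Hm). intros [u' v'] [B1 B2]. simpl in *.
  change (Rabs (u' - u) < Rmin d e) in B1. change (Rabs (v' - v) < Rmin d e) in B2.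
  assert (L1 := Rmin_l d e). assert (L2 := Rmin_r d e).
  split; [apply Hbox; lra|]. intros E.
  specialize (Hd u' v' ltac:(lra) ltac:(lra)). rewrite E, Rabs_minus_sym in Hd. lra.
Qed.

(** Along a coordinate line in O the function is continuous and not constant, so its values fill an
    interval, and the fractions with the prescribed residues are dense. *)
Lemma takes_rational_value (p r : Z) i f u v :
  (1 < p)%Z -> smooth O f -> O (u, v) -> pd i f u v <> 0 ->
  exists u' v' a b, O (u', v') /\ (0 < b)%Z /\ (b mod p = 1)%Z /\ (a mod p = r mod p)%Z /\
    IZR b * f u' v' = IZR a.
Proof.
  intros Hp Hf Huv Hne.
  destruct (open_box O hO u v Huv) as [e Hbox].
  assert (Hd := smooth_is_derive O i f u v Hf Huv).
  destruct (nonconstant_of_derive _ _ _ e Hd Hne) as (t1 & Ht1 & Hv).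
  set (t0 := at_coord i u v) in *. set (g := line i f u v) in *.
  assert (HO : forall t, Rmin t0 t1 <= t <= Rmax t0 t1 ->
             O (match i with U => (t, v) | V => (u, t) end)).
  { intros t Ht.
    assert (Ht' : Rabs (t - t0) < e).
    { apply Rle_lt_trans with (2 := Ht1). unfold Rmin, Rmax in Ht. unfold Rabs.
      destruct (Rle_dec t0 t1), (Rcase_abs (t - t0)), (Rcase_abs (t1 - t0)); lra. }
    assert (He := cond_pos e).
    destruct i; apply Hbox; try exact Ht'; rewrite Rminus_diag, Rabs_R0; exact He. }
  destruct (rational_between p r (Rmin (g t0) (g t1)) (Rmax (g t0) (g t1)) Hp)
    as (a & b & Hb0 & Hb & Ha & Hy).
  { unfold Rmin, Rmax. destruct (Rle_dec (g t0) (g t1)); lra. }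
  destruct (ivt_between g t0 t1 (IZR a / IZR b)) as (t & Ht & E); auto.
  { intros t Ht. apply continuity_pt_filterlim.
    apply (ex_derive_continuous (K := R_AbsRing) (V := R_NormedModule) g).
    specialize (HO t Ht). exists (pd i f (match i with U => t | V => u end)
        (match i with U => v | V => t end)).
    unfold g. destruct i.
    - apply (smooth_is_derive_U O f t v Hf HO).
    - apply (smooth_is_derive_V O f u t Hf HO). }
  assert (Hb' : 0 < IZR b) by (apply (IZR_lt 0); exact Hb0).
  exists (match i with U => t | V => u end), (match i with U => v | V => t end), a, b.
  repeat split; auto.
  - specialize (HO t Ht). destruct i; exact HO.
  - replace (f _ _) with (g t) by (unfold g; destruct i; reflexivity).
    rewrite E. field. lra.
Qed.

Lemma mixed_derivatives x A B u v dA dB :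
  smooth O x ->
  (forall u v, O (u, v) -> pd U x u v = A u v) ->
  (forall u v, O (u, v) -> pd V x u v = B u v) ->
  O (u, v) ->
  is_derive (fun t => A u t) v dA -> is_derive (fun t => B t v) u dB -> dA = dB.
Proof.
  intros Hx HA HB Huv H1 H2.
  assert (E := pd_comm O hO x u v Hx Huv).
  rewrite (pd_ext O hO V (pd U x) A u v HA Huv) in E.
  rewrite (pd_ext O hO U (pd V x) B u v HB Huv) in E.
  apply is_derive_unique in H1. apply is_derive_unique in H2.
  unfold pd in E. rewrite <- H1, <- H2. exact E.
Qed.

End OpenSet.

(** * The mirror system: the case k <> s *)

Declare Scope pexpr_scope.
Delimit Scope pexpr_scope with pe.
Bind Scope pexpr_scope with pexpr.
Notation "f + g" := (PAdd f g) : pexpr_scope.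
Notation "f - g" := (PSub f g) : pexpr_scope.
Notation "f * g" := (PMul f g) : pexpr_scope.
Notation "f ^ k" := (PPow f k%nat) : pexpr_scope.
Notation "# k" := (PC k%Z) (at level 5) : pexpr_scope.

(** All monomials of weighted degree exactly n, where [ws] lists the weights of the variables. *)
Fixpoint monos (ws : list nat) (n : nat) : list mono :=
  match ws with
  | [] => match n with O => [[]] | _ => [] end
  | w :: ws' =>
      flat_map (fun e => map (cons e) (monos ws' (n - w * e)))
        (filter (fun e => Nat.leb (w * e) n) (seq 0 (S n)))
  end.

(* Computer algebra certificate.  TT and DD represent the derivations den d/du and
   (2 k s / (om t)) d/dv on polynomials in (k, s, l, m).  The equality of the mixed
   derivatives of l forces m_u = num / den, and that of m then leaves the relation
   rel = 0.  The relation and its first three v-derivatives are quadratic in (l, m);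
   101 and 7 are chosen so that, where s / k is a rational congruent to 7 modulo 101,
   they are independent modulo 101. *)
Module Gen.
Local Open Scope pexpr_scope.
Definition cols (n : nat) : list mono :=
  filter (fun m => match m with [_; _; x; y] => Nat.eqb (x + y) 0 || Nat.eqb (x + y) 2
                   | _ => false end)%bool%nat (monos [1; 1; 1; 1]%nat n).
Definition k := PV 0.
Definition s := PV 1.
Definition l := PV 2.
Definition m := PV 3.
Definition ku := (#2 * k - s) * m - #2 * l * s.
Definition su := k * m - #2 * l * s.
Definition lu := #2 * k * s + s ^ 2 - l ^ 2 - k ^ 2.
Definition num := #7*k^4*s^2 - #3*k^5*s - #3*k^4*l*m + #4*k^4*m^2 + #9*k^3*s^3
    + #15*k^3*s*l^2 - #30*k^3*s*l*m + #8*k^3*s*m^2 - #13*k^2*s^4 + #9*k^2*s^2*l^2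
    + #11*k^2*s^2*l*m - #30*k^2*s^2*m^2 - #4*k*s^5 + #46*k*s^3*l*m + #24*k*s^3*m^2
    - #24*s^4*l^2 - #24*s^4*l*m - #6*s^4*m^2.
Definition den := #2 * k * s * (#2 * k - s) * (k - s).
Definition Dk := #(-2) * k * s ^ 2.
Definition Ds := #2 * k * s * (k - #2 * s).
Definition Dl := k * (#8 * k * m - #12 * s * m - #2 * l * s - #6 * k * l)
  + #4 * s ^ 2 * m + #8 * l * s ^ 2.
Definition Dm := #4 * s * (ku - k * l).
Definition DD := map (norm 4) [Dk; Ds; Dl; Dm].
Definition TT := map (norm 4) [den * ku; den * su; den * lu; num].
Definition rel := #13*k^7*s^2 + #24*k^7*l*m - #32*k^7*m^2 + k^6*s^3 - #168*k^6*s*l^2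
    + #361*k^6*s*l*m - #128*k^6*s*m^2 - #138*k^5*s^4 + #19*k^5*s^2*l^2 - #708*k^5*s^2*l*m
    + #642*k^5*s^2*m^2 + #174*k^4*s^5 + #367*k^4*s^3*l^2 - #128*k^4*s^3*l*m
    - #718*k^4*s^3*m^2 - #7*k^3*s^6 + #27*k^3*s^4*l^2 + #488*k^3*s^4*l*m + #80*k^3*s^4*m^2
    - #27*k^2*s^7 - #133*k^2*s^5*l^2 + #315*k^2*s^5*l*m + #304*k^2*s^5*m^2 - #232*k*s^6*l^2
    - #472*k*s^6*l*m - #178*k*s^6*m^2 + #120*s^7*l^2 + #120*s^7*l*m + #30*s^7*m^2.
Definition factor := #4 * k * k * s * s * (k - s).
(** The equation m_uv = m_vu freed of denominators. With w = om t / (2 k s), whose logarithmic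
    u-derivative is 2 l - 3 k_u / k - s_u / s, the equation is multiplied by k s den^2 / w, and the
    left side below is the difference of its two members. *)
Lemma identity :
  padd (pmul (norm 4 (k * s))
          (padd (pmul (norm 4 den) (deriv DD (norm 4 num)))
                (pscale (-1) (pmul (norm 4 num) (deriv DD (norm 4 den))))))
    (pscale (-1) (padd
       (norm 4 (den ^ 2 * (#2 * l * k * s - #3 * ku * s - k * su) * Dm))
       (pmul (norm 4 (k * s * den)) (deriv TT (norm 4 Dm)))))
  = norm 4 (factor * rel).
Proof. vm_compute. reflexivity. Qed.
Definition row_monos (n : nat) : list mono :=
  map (fun m => m ++ [0; 0]%nat) (monos [1; 1]%nat n).
(** [rel] has degree 9, and [DD] raises the degree by 2 while keeping the degree in (l, m), so every
    row has degree 15. Once s = 7 k modulo 101, the unknowns left are k^15 and k^13 times l^2, l m,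
    m^2; hence four relations. *)
Definition rows : list poly :=
  let r0 := norm 4 rel in let r1 := deriv DD r0 in
  let r2 := deriv DD r1 in let r3 := deriv DD r2 in
  multiples r0 (row_monos 6) ++ multiples r1 (row_monos 4)
  ++ multiples r2 (row_monos 2) ++ multiples r3 (row_monos 0).
Lemma rank_check_true :
  rank_check 101 7 (cols 15) (norm 4 s) (norm 4 k) (cols 14) rows = true.
Proof. vm_compute. reflexivity. Qed.
End Gen.

(* What the structure equations become for k = kappa, s = - sigma, t = tau,
   l = W_u / W, om = - W where a23 = 0 and a34 = W (kappa + 2 sigma); the function m
   is defined by the equation for s_u. *)
Record mirror_system (O : R * R -> Prop) (k s t l m om : R -> R -> R) : Prop := {
  ms_open : open O;
  ms_k : smooth O k; ms_s : smooth O s; ms_t : smooth O t;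
  ms_l : smooth O l; ms_m : smooth O m; ms_om : smooth O om;
  ms_k0 : forall u v, O (u, v) -> k u v <> 0;
  ms_s0 : forall u v, O (u, v) -> s u v <> 0;
  ms_t0 : forall u v, O (u, v) -> t u v <> 0;
  ms_om0 : forall u v, O (u, v) -> om u v <> 0;
  ms_ku : forall u v, O (u, v) ->
    pd U k u v = (2 * k u v - s u v) * m u v - 2 * l u v * s u v;
  ms_su : forall u v, O (u, v) -> pd U s u v = k u v * m u v - 2 * l u v * s u v;
  ms_lu : forall u v, O (u, v) ->
    pd U l u v = - l u v ^ 2 - k u v ^ 2 + 2 * k u v * s u v + s u v ^ 2;
  ms_tu : forall u v, O (u, v) ->
    pd U t u v = t u v * (l u v - 2 * pd U k u v / k u v);
  ms_omu : forall u v, O (u, v) -> pd U om u v = l u v * om u v;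
  ms_kv : forall u v, O (u, v) -> pd V k u v = om u v * (- s u v * t u v);
  ms_sv : forall u v, O (u, v) -> pd V s u v = om u v * ((k u v - 2 * s u v) * t u v);
  ms_tv : forall u v, O (u, v) ->
    pd V t u v = om u v * (pd U m u v + l u v * m u v + 2 * s u v ^ 2)
}.

(* Discharges the side conditions of auto_derive. *)
Ltac ex_der :=
  repeat match goal with
  | |- _ /\ _ => split
  | |- True => exact I
  | Hf : smooth ?O ?f, H : ?O (?u, ?v) |- ex_derive (fun t => ?f t ?v) ?u =>
      exists (pd U f u v); exact (smooth_is_derive_U O f u v Hf H)
  | Hf : smooth ?O ?f, H : ?O (?u, ?v) |- ex_derive (fun t => ?f ?u t) ?v =>
      exists (pd V f u v); exact (smooth_is_derive_V O f u v Hf H)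
  end.

Ltac to_pd H :=
  repeat match type of H with
  | context [Derive (fun x => ?f x ?v) ?u] =>
      change (Derive (fun x => f x v) u) with (pd U f u v) in H
  | context [Derive (fun x => ?f ?u x) ?v] =>
      change (Derive (fun x => f u x) v) with (pd V f u v) in H
  end.

Ltac peval_env :=
  rewrite ?eval_norm by reflexivity; cbn [peval]; unfold env; cbn [nth].

Section Generic.

Variables (O : R * R -> Prop) (k s t l m om : R -> R -> R).
Hypothesis H : mirror_system O k s t l m om.
Hypothesis Hks : forall u v, O (u, v) -> k u v <> s u v.
Hypothesis H2ks : forall u v, O (u, v) -> 2 * k u v <> s u v.

(** The mixed derivatives of k and of s are two linear equations in m_v and l_v. In both, l_v has
    the coefficient - 2 s, so their difference gives (k - s) m_v; this is where k <> s enters. *)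
Lemma gen_mv_lv u v : O (u, v) ->
  pd V m u v = om u v * (2 * t u v *
    (((2 * k u v - s u v) * m u v - 2 * l u v * s u v) / k u v - l u v)) /\
  pd V l u v = om u v * (t u v * (
    (-12 * s u v * m u v + 8 * k u v * m u v - 2 * l u v * s u v - 6 * k u v * l u v
     + (4 * s u v ^ 2 * m u v + 8 * l u v * s u v ^ 2) / k u v) / (2 * s u v))).
Proof.
  intros Huv. destruct H.
  assert (E1 := mixed_derivatives O ms_open0 k _ _ u v _ _ ms_k1 ms_ku0 ms_kv0 Huv
     ltac:(auto_derive; [ex_der|reflexivity]) ltac:(auto_derive; [ex_der|reflexivity])).
  assert (E2 := mixed_derivatives O ms_open0 s _ _ u v _ _ ms_s1 ms_su0 ms_sv0 Huv
     ltac:(auto_derive; [ex_der|reflexivity]) ltac:(auto_derive; [ex_der|reflexivity])).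
  to_pd E1. to_pd E2.
  rewrite ms_kv0, ms_sv0, ms_su0, ms_omu0, ms_tu0, ms_ku0 in E1 by exact Huv.
  rewrite ms_kv0, ms_sv0, ms_ku0, ms_su0, ms_omu0, ms_tu0, ms_ku0 in E2 by exact Huv.
  specialize (Hks u v Huv). specialize (ms_k2 u v Huv). specialize (ms_s2 u v Huv).
  apply Rminus_diag_eq in E1. apply Rminus_diag_eq in E2.
  assert (Em : pd V m u v = om u v * (2 * t u v *
    (((2 * k u v - s u v) * m u v - 2 * l u v * s u v) / k u v - l u v))).
  { apply Rminus_diag_uniq. apply Rmult_eq_reg_l with (k u v - s u v); [|lra].
    rewrite Rmult_0_r.
    match type of E1 with ?a = _ => match type of E2 with ?b = _ =>
      transitivity (a - b); [field; exact ms_k2|rewrite E1, E2; ring] end end. }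
  split; [exact Em|].
  rewrite Em in E2. apply Rminus_diag_uniq. apply Rmult_eq_reg_l with (-2 * s u v); [|lra].
  rewrite Rmult_0_r, <- E2. field. split; assumption.
Qed.

Definition mu_num (k s l m : R) : R :=
  -3*k^5*s + 7*k^4*s^2 - 3*k^4*l*m + 4*k^4*m^2 + 9*k^3*s^3 + 15*k^3*s*l^2 - 30*k^3*s*l*m
    + 8*k^3*s*m^2 - 13*k^2*s^4 + 9*k^2*s^2*l^2 + 11*k^2*s^2*l*m - 30*k^2*s^2*m^2 - 4*k*s^5
    + 46*k*s^3*l*m + 24*k*s^3*m^2 - 24*s^4*l^2 - 24*s^4*l*m - 6*s^4*m^2.

Definition mu_den (k s : R) : R := 2 * k * s * (2 * k - s) * (k - s).

Lemma mu_den_neq0 u v : O (u, v) -> mu_den (k u v) (s u v) <> 0.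
Proof.
  intros Huv. unfold mu_den.
  assert (H0 := ms_k0 _ _ _ _ _ _ _ H u v Huv).
  assert (H1 := ms_s0 _ _ _ _ _ _ _ H u v Huv).
  specialize (Hks u v Huv). specialize (H2ks u v Huv).
  repeat apply Rmult_integral_contrapositive_currified; lra.
Qed.

(** In l_uv = l_vu the only unknown is m_u. It occurs linearly, with a coefficient that vanishes
    only where k = s or 2 k = s. *)
Lemma gen_mu u v : O (u, v) ->
  pd U m u v = mu_num (k u v) (s u v) (l u v) (m u v) / mu_den (k u v) (s u v).
Proof.
  intros Huv. assert (Hd := mu_den_neq0 u v Huv). destruct H.
  assert (E := mixed_derivatives O ms_open0 l _ _ u v _ _ ms_l0 ms_lu0
     (fun u v h => proj2 (gen_mv_lv u v h)) Huv
     ltac:(auto_derive; [ex_der|reflexivity])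
     ltac:(auto_derive; [ex_der; auto; specialize (ms_s2 u v Huv); lra|reflexivity])).
  to_pd E.
  rewrite (proj2 (gen_mv_lv u v Huv)), ms_kv0, ms_sv0, ms_omu0, ms_lu0, ms_su0, ms_tu0,
    ms_ku0 in E by exact Huv.
  specialize (Hks u v Huv). specialize (H2ks u v Huv).
  specialize (ms_k2 u v Huv). specialize (ms_s2 u v Huv). specialize (ms_t2 u v Huv).
  specialize (ms_om2 u v Huv).
  apply Rminus_diag_eq in E. apply Rminus_diag_uniq.
  apply Rmult_eq_reg_l with (-2 * om u v * t u v * (2 * k u v - s u v) * (k u v - s u v)
     / (s u v * k u v)).
  - rewrite Rmult_0_r, <- E. unfold mu_num, mu_den. field. repeat split; lra.
  - unfold Rdiv. repeat apply Rmult_integral_contrapositive_currified; try lra.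
    apply Rinv_neq_0_compat. apply Rmult_integral_contrapositive_currified; lra.
Qed.

Let e u v := eval (env [k; s; l; m] u v).

Lemma gen_V u v j : O (u, v) -> (j < 4)%nat ->
  pd V (nth j [k; s; l; m] (fun _ _ => 0)) u v
  = om u v * t u v / (2 * k u v * s u v) * e u v (nth j Gen.DD []).
Proof.
  intros Huv Hj. assert (Hmv := gen_mv_lv u v Huv). destruct H. unfold e, Gen.DD.
  specialize (ms_k2 u v Huv). specialize (ms_s2 u v Huv).
  destruct j as [|[|[|[|j]]]]; [..|lia]; cbn [nth map];
    first [rewrite ms_kv0 by exact Huv | rewrite ms_sv0 by exact Huv
          | rewrite (proj2 Hmv) | rewrite (proj1 Hmv)];
    unfold Gen.Dk, Gen.Ds, Gen.Dl, Gen.Dm, Gen.ku, Gen.k, Gen.s, Gen.l, Gen.m;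
    peval_env; field; repeat split; lra.
Qed.

Lemma eval_den u v : e u v (norm 4 Gen.den) = mu_den (k u v) (s u v).
Proof. unfold e, mu_den, Gen.den, Gen.k, Gen.s. peval_env. ring. Qed.

Lemma gen_mu_poly u v : O (u, v) ->
  e u v (norm 4 Gen.den) * pd U m u v = e u v (norm 4 Gen.num).
Proof.
  intros Huv. rewrite eval_den, gen_mu by exact Huv.
  unfold e, mu_num, Gen.num, Gen.k, Gen.s, Gen.l, Gen.m. peval_env.
  field. apply mu_den_neq0; exact Huv.
Qed.

Lemma gen_U u v j : O (u, v) -> (j < 4)%nat ->
  pd U (nth j [k; s; l; m] (fun _ _ => 0)) u v
  = / mu_den (k u v) (s u v) * e u v (nth j Gen.TT []).
Proof.
  intros Huv Hj. assert (Hd := mu_den_neq0 u v Huv). assert (Hm := gen_mu_poly u v Huv).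
  rewrite eval_den in Hm. assert (Ed := eval_den u v). destruct H. unfold Gen.TT.
  destruct j as [|[|[|[|j]]]]; [..|lia]; cbn [nth map].
  4: rewrite <- Hm; field; exact Hd.
  all: cbn [norm]; unfold e in *; rewrite eval_pmul, Ed.
  - rewrite ms_ku0 by exact Huv. unfold Gen.ku, Gen.k, Gen.s, Gen.l, Gen.m.
    peval_env. field. exact Hd.
  - rewrite ms_su0 by exact Huv. unfold Gen.su, Gen.k, Gen.s, Gen.l, Gen.m.
    peval_env. field. exact Hd.
  - rewrite ms_lu0 by exact Huv. unfold Gen.lu, Gen.k, Gen.s, Gen.l, Gen.m.
    peval_env. field. exact Hd.
Qed.

Lemma gen_weight u v : O (u, v) ->
  is_derive (fun x => om x v * t x v / (2 * k x v * s x v)) u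
    (om u v * t u v / (2 * k u v * s u v)
     * (2 * l u v - 3 * pd U k u v / k u v - pd U s u v / s u v)).
Proof.
  intros Huv. destruct H. specialize (ms_k2 u v Huv). specialize (ms_s2 u v Huv).
  auto_derive; [ex_der; repeat apply Rmult_integral_contrapositive_currified; lra|].
  change (Derive (fun x => om x v) u) with (pd U om u v).
  change (Derive (fun x => t x v) u) with (pd U t u v).
  change (Derive (fun x => k x v) u) with (pd U k u v).
  change (Derive (fun x => s x v) u) with (pd U s u v).
  rewrite ms_omu0, ms_tu0 by exact Huv. field. split; assumption.
Qed.

(** All derivatives being known, the mixed derivatives of [m] leave an algebraic condition.
    [Gen.identity] exhibits it as a multiple of [rel], with a cofactor that vanishes only where k s
    (k - s) does. *)
Lemma gen_relation u v : O (u, v) -> e u v (norm 4 Gen.rel) = 0.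
Proof.
  intros Huv.
  assert (Hfs : Forall (smooth O) [k; s; l; m]) by (destruct H; repeat constructor; assumption).
  assert (I1 := mixed_poly O [k; s; l; m] m _ _ Gen.DD Gen.TT _ _ (norm 4 Gen.Dm)
    u v _ (ms_open _ _ _ _ _ _ _ H) Hfs (ms_m _ _ _ _ _ _ _ H) (le_n 4) (le_n 4)
    gen_V gen_U gen_mu_poly (fun x y h => gen_V x y 3%nat h (le_n 4)) Huv (gen_weight u v Huv)).
  cbv beta in I1. fold (e u v) in I1.
  assert (Hm := gen_mu_poly u v Huv). rewrite eval_den in Hm, I1.
  assert (Hd := mu_den_neq0 u v Huv).
  assert (Ha := f_equal (eval (env [k; s; l; m] u v)) Gen.identity).
  rewrite ?eval_padd, ?eval_pscale, ?eval_pmul, ?eval_padd, ?eval_pscale, ?eval_pmul,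
    !eval_norm_mul in Ha.
  fold (e u v) in Ha.
  assert (E1 : e u v (norm 4 Gen.k) = k u v) by (unfold e, Gen.k; peval_env; reflexivity).
  assert (E2 : e u v (norm 4 Gen.s) = s u v) by (unfold e, Gen.s; peval_env; reflexivity).
  assert (E3 : e u v (norm 4 (Gen.den ^ 2)) = mu_den (k u v) (s u v) ^ 2).
  { rewrite <- eval_den. unfold e. rewrite !eval_norm by reflexivity. reflexivity. }
  assert (E4 : e u v (norm 4 (#2 * Gen.l * Gen.k * Gen.s - #3 * Gen.ku * Gen.s - Gen.k * Gen.su))
    = 2 * l u v * k u v * s u v - 3 * pd U k u v * s u v - k u v * pd U s u v).
  { destruct H. rewrite ms_ku0, ms_su0 by exact Huv.
    unfold e, Gen.ku, Gen.su, Gen.k, Gen.s, Gen.l, Gen.m. peval_env. ring. }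
  assert (E5 : e u v (norm 4 Gen.factor) <> 0).
  { unfold e, Gen.factor, Gen.k, Gen.s. peval_env.
    assert (H0 := ms_k0 _ _ _ _ _ _ _ H u v Huv).
    assert (H1 := ms_s0 _ _ _ _ _ _ _ H u v Huv). specialize (Hks u v Huv).
    repeat apply Rmult_integral_contrapositive_currified; lra. }
  apply Rmult_eq_reg_l with (e u v (norm 4 Gen.factor)); [|exact E5].
  rewrite Rmult_0_r, <- Ha, E1, E2, E3, E4, eval_den. clear Ha E1 E2 E3 E4 E5.
  assert (Hk0 := ms_k0 _ _ _ _ _ _ _ H u v Huv).
  assert (Hs0 := ms_s0 _ _ _ _ _ _ _ H u v Huv).
  assert (Hw0 : om u v * t u v <> 0).
  { apply Rmult_integral_contrapositive_currified; [apply (ms_om0 _ _ _ _ _ _ _ H)|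
      apply (ms_t0 _ _ _ _ _ _ _ H)]; exact Huv. }
  revert I1 Hm Hd.
  generalize (e u v (norm 4 Gen.Dm)) (e u v (deriv Gen.TT (norm 4 Gen.Dm)))
    (e u v (deriv Gen.DD (norm 4 Gen.num))) (e u v (deriv Gen.DD (norm 4 Gen.den)))
    (e u v (norm 4 Gen.num)) (mu_den (k u v) (s u v)).
  intros e1 e2 e3 e4 e5 d I1 <- Hd.
  apply Rmult_eq_reg_l with (om u v * t u v / (2 * k u v * s u v)).
  - rewrite Rmult_0_r.
    transitivity (k u v * s u v * d * (om u v * t u v / (2 * k u v * s u v) * e3
       - om u v * t u v / (2 * k u v * s u v) * e4 * pd U m u v)
       - om u v * t u v / (2 * k u v * s u v)
         * (d ^ 2 * (2 * l u v * k u v * s u v - 3 * pd U k u v * s u v - k u v * pd U s u v) * e1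
            + k u v * s u v * d * e2)).
    + field. split; assumption.
    + rewrite <- I1. field. repeat split; assumption.
  - unfold Rdiv. apply Rmult_integral_contrapositive_currified; [exact Hw0|].
    apply Rinv_neq_0_compat. repeat apply Rmult_integral_contrapositive_currified; lra.
Qed.

(** The v-derivative of s / k is om t (k - s)^2 / k^2, which has no zero, so the ratio does take a
    rational value of residue 7. There every monomial in [cols] vanishes, in particular k^15. *)
Lemma generic_absurd u0 v0 : ~ O (u0, v0).
Proof.
  intros Huv0.
  assert (hO := ms_open _ _ _ _ _ _ _ H).
  assert (Hfs : Forall (smooth O) [k; s; l; m]) by (destruct H; repeat constructor; assumption).
  assert (Hr : smooth O (fun u v => s u v / k u v)).
  { apply (smooth_div O hO); destruct H; assumption. }
  assert (Hr' : pd V (fun u v => s u v / k u v) u0 v0 <> 0).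
  { destruct H. specialize (ms_k2 _ _ Huv0).
    replace (pd V _ u0 v0)
      with (om u0 v0 * t u0 v0 * ((k u0 v0 - s u0 v0) * (k u0 v0 - s u0 v0))
            * / k u0 v0 * / k u0 v0).
    - specialize (Hks _ _ Huv0). specialize (ms_om2 _ _ Huv0). specialize (ms_t2 _ _ Huv0).
      repeat apply Rmult_integral_contrapositive_currified; try apply Rinv_neq_0_compat;
        try assumption; lra.
    - symmetry. apply is_derive_unique. auto_derive; [ex_der; assumption|].
      change (Derive (fun x => s u0 x) v0) with (pd V s u0 v0).
      change (Derive (fun x => k u0 x) v0) with (pd V k u0 v0).
      rewrite ms_kv0, ms_sv0 by exact Huv0. field. assumption. }
  destruct (takes_rational_value O hO 101 7 V _ u0 v0 eq_refl Hr Huv0 Hr')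
    as (u & v & a & b & Huv & _ & Hb & Ha & E).
  assert (Hk := ms_k0 _ _ _ _ _ _ _ H u v Huv).
  assert (HD : forall f, (forall u v, O (u, v) -> e u v f = 0) ->
             forall u v, O (u, v) -> e u v (deriv Gen.DD f) = 0).
  { intros f Hf x y Hxy.
    refine (deriv_zero O V [k; s; l; m] Gen.DD f _ hO Hfs (le_n 4) _ gen_V Hf x y Hxy).
    intros x' y' Hxy'. destruct H.
    specialize (ms_om2 _ _ Hxy'). specialize (ms_t2 _ _ Hxy').
    specialize (ms_k2 _ _ Hxy'). specialize (ms_s2 _ _ Hxy').
    unfold Rdiv. repeat apply Rmult_integral_contrapositive_currified; auto.
    apply Rinv_neq_0_compat. repeat apply Rmult_integral_contrapositive_currified; lra. }
  assert (R0 := gen_relation). assert (R1 := HD _ R0). assert (R2 := HD _ R1).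
  assert (R3 := HD _ R2).
  assert (Hz : k u v ^ 15 = 0).
  { assert (Hm : forall n, In n (Gen.cols 15) -> mono_eval (env [k; s; l; m] u v) 0 n = 0).
    { apply (rank_check_zero 101 7 (Gen.cols 15) (norm 4 Gen.s) (norm 4 Gen.k) (Gen.cols 14)
        Gen.rows _ a b eq_refl Hb Ha).
      - unfold Gen.s, Gen.k. peval_env. rewrite <- E. field. exact Hk.
      - intros f Hf. unfold Gen.rows in Hf. rewrite !in_app_iff in Hf.
        destruct Hf as [Hf|[Hf|[Hf|Hf]]]; apply in_map_iff in Hf as (n & <- & _);
          rewrite eval_pmul_term.
        + rewrite (R0 u v Huv : eval _ _ = 0). ring.
        + rewrite (R1 u v Huv : eval _ _ = 0). ring.
        + rewrite (R2 u v Huv : eval _ _ = 0). ring.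
        + rewrite (R3 u v Huv : eval _ _ = 0). ring.
      - exact Gen.rank_check_true. }
    specialize (Hm [15; 0; 0; 0]%nat). unfold mono_eval, env in Hm. cbn [nth] in Hm.
    rewrite <- Hm; [ring|]. apply mono_mem_In. vm_compute. reflexivity. }
  exact (pow_nonzero _ _ Hk Hz).
Qed.

End Generic.

Lemma mirror_system_subset O O' k s t l m om :
  open O' -> (forall p, O' p -> O p) ->
  mirror_system O k s t l m om -> mirror_system O' k s t l m om.
Proof.
  intros hO' Hsub []; constructor; auto; apply (smooth_subset O); assumption.
Qed.

Lemma mirror_system_eq O k s t l m om u v :
  mirror_system O k s t l m om -> O (u, v) -> k u v = s u v.
Proof.
  intros H Huv. apply NNPP. intros Hne.
  set (O1 := fun p => O p /\ (k (fst p) (snd p) - s (fst p) (snd p)) <> 0).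
  assert (hO := ms_open _ _ _ _ _ _ _ H).
  assert (hO1 : open O1).
  { apply (open_neq O hO (fun u v => k u v - s u v)).
    destruct H; apply smooth_minus; assumption. }
  assert (Huv1 : O1 (u, v)) by (split; [exact Huv|simpl; lra]).
  assert (H1 : mirror_system O1 k s t l m om).
  { apply (mirror_system_subset O); auto. intros p []; assumption. }
  set (O2 := fun p => O1 p /\ (2 * k (fst p) (snd p) - s (fst p) (snd p)) <> 0).
  assert (hO2 : open O2).
  { apply (open_neq O1 hO1 (fun u v => 2 * k u v - s u v)).
    destruct H1; apply smooth_minus; auto. apply smooth_mult; auto. apply smooth_const; auto. }
  assert (H2 : mirror_system O2 k s t l m om).
  { apply (mirror_system_subset O1); auto. intros p []; assumption. }
  assert (He : forall x y, ~ O2 (x, y)).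
  { intros x y. apply (generic_absurd O2 k s t l m om H2).
    - intros x' y' [[_ Hx] _]; simpl in Hx; lra.
    - intros x' y' [_ Hx]; simpl in Hx; lra. }
  assert (Hs : forall x y, O1 (x, y) -> s x y = 2 * k x y).
  { intros x y Hxy. apply NNPP. intros Hn. apply (He x y). split; [exact Hxy|simpl; lra]. }
  (* On [O1] now s = 2 k, whose v-derivative reads - 3 om k t = - 4 om k t. *)
  assert (E := pd_ext O1 hO1 V s (fun x y => 2 * k x y) u v Hs Huv1).
  destruct H1.
  rewrite (pd_mult O1 V (fun _ _ => 2) k u v) in E;
    [|apply smooth_const; exact hO1|assumption|exact Huv1].
  rewrite pd_const, ms_sv0, ms_kv0, (Hs u v) in E by exact Huv1.
  specialize (ms_k2 u v Huv1). specialize (ms_t2 u v Huv1). specialize (ms_om2 u v Huv1).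
  assert (Hp : om u v * (k u v * t u v) = 0) by lra.
  revert Hp. repeat apply Rmult_integral_contrapositive_currified; assumption.
Qed.

(** * The mirror system: the case k = s *)

Definition pdrop (i : nat) (f : poly) : poly :=
  map (fun c => (snd (mono_dec i (fst c)), snd c)) f.

Definition divisible (i : nat) (f : poly) : bool :=
  forallb (fun c => Nat.ltb 0 (fst (mono_dec i (fst c)))) f.

Lemma mono_eval_dec rho i j m : (0 < fst (mono_dec i m))%nat ->
  mono_eval rho j m = rho (j + i)%nat * mono_eval rho j (snd (mono_dec i m)).
Proof.
  revert i j; induction m as [|e m IH]; intros i j Hi; [destruct i; simpl in Hi; lia|].
  destruct i as [|i].
  - simpl in *. rewrite Nat.add_0_r. destruct e as [|e]; [lia|]. simpl. ring.
  - simpl in *. specialize (IH i (S j)). destruct (mono_dec i m) as [d m']. simpl in *.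
    rewrite IH, Nat.add_succ_r by exact Hi. ring.
Qed.

Lemma eval_pdrop rho i f : divisible i f = true -> eval rho f = rho i * eval rho (pdrop i f).
Proof.
  induction f as [|[m c] f IH]; intros Hd; [unfold eval; simpl; ring|].
  simpl in Hd. apply andb_prop in Hd as [H1 H2]. apply Nat.ltb_lt in H1.
  change (pdrop i ((m, c) :: f)) with ((snd (mono_dec i m), c) :: pdrop i f).
  rewrite !eval_cons, IH, (mono_eval_dec rho i 0 m) by assumption. simpl. ring.
Qed.

(* Computer algebra certificate for the case k = s, in the variables z = h / s,
   a, q = l - 3 a, y, h, f = 6 y + c of weights 1, 1, 1, 2, 2, 2.  TT and DD represent
   d/du and (y / w) d/dv, and C1 is the relation min_relation.  Its derivatives are
   divisible by z, and a combination of those by y; 101 and 7 are chosen so that, where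
   z / l is a rational congruent to 7 modulo 101, the multiples of weight 9 of the nine
   relations in words have full rank modulo 101 on the monomials other than a y^4
   and z y^4. *)
Module Min.
Local Open Scope pexpr_scope.
Definition z := PV 0.
Definition a := PV 1.
Definition q := PV 2.
Definition y := PV 3.
Definition h := PV 4.
Definition f := PV 5.
Definition l := q + #3 * a.
Definition c := f - #6 * y.
Definition M := #36*a*a*a-#28*a*a*l+#5*a*l*l-#12*a*y-#26*a*h-#4*a*c+#2*l*y+#4*l*h+l*c.
Definition N := #48*a*a-#240*a*l-#120*l*l-#48*y-#96*h-#8*c.
Definition C1 := h * y + z * M + z * z * N.
(** [C1] = 0 divided by z = h / s and solved for y s. The function s, not polynomial in the chosen
    variables, thereby enters the derivations polynomially. *)
Definition ys := #(-1) * (M + z * N).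
Definition Tz := #4*l*z+#12*z*z.
Definition Ta := #6*a*a-#4*a*l-#6*y-#4*h-c.
Definition Tq := #2*h-l*l - #3*Ta.
Definition Ty := #2*y*(l-#6*a).
Definition Th := #6*a*h.
Definition Tf := #108*a*a*a-#84*a*a*l+#15*a*l*l-#78*a*h-#18*a*c-#6*l*y+#12*l*h+#3*l*c-ys + #6*Ty.
Definition dy := #12*a*a-#6*a*l-#12*y-#4*h-#2*c.
Definition Dz := #(-1)*z*c-#12*z*z*(a-#10*l)-#6*z*y.
Definition Da := y * (#6 * a - #2 * l).
Definition Dq := ys - #3 * Da.
Definition Dy := y * dy.
Definition Dh := #(-6) * h * y.
Definition Df := y*(#18*c+#108*y+#76*h-#12*a*l+#10*l*l)-#4*a*ys + #6*Dy.
Definition TT := map (norm 6) [Tz; Ta; Tq; Ty; Th; Tf].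
Definition DD := map (norm 6) [Dz; Da; Dq; Dy; Dh; Df].
(** Together with [q2], the coefficients for which D r5 + q1 r1 + q2 r5 becomes divisible by y. *)
Definition q1 := #10800*a*a*a-#14184*a*a*l+#20832*a*a*z+#3480*a*l*l-#98880*a*l*z-#8960*a*h
    -#1068*a*c+#2880*l*h+#960*l*c-#46080*z*h-#3840*z*c.
Definition q2 := c-#600*l*z-#172*a*z.
Definition T := deriv TT.
Definition D := deriv DD.
Definition r1 := norm 6 C1.
Definition r4' := padd (T r1) (pmul (norm 6 (#6*a-#2*l)) r1).
Definition r4 := pdrop 0 r4'.
Definition r5' := padd (D r1) (pmul (norm 6 (#6*y-dy)) r1).
Definition r5 := pdrop 0 r5'.
Definition r6' := padd (D r5) (padd (pmul (norm 6 q1) r1) (pmul (norm 6 q2) r5)).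
Definition r6 := pdrop 3 r6'.
(** Each relation is paired with its weight: [T] raises the weight by 1 and [D] by 2, while division
    by z lowers it by 1 and division by y by 2. *)
Definition words : list (nat * poly) :=
 [(4, r1); (4, r4); (5, r5); (5, r6); (5, T r4); (6, D r4); (6, T r6); (7, D r6); (6,
     T (T r4))]%nat.
Definition ws : list nat := [1;1;1;2;2;2]%nat.
Definition cols := filter (fun m => negb (Nat.eqb (nth 3 m 0%nat) 4 && Nat.eqb (nth 0 m 0
    + nth 1 m 0)%nat 1)) (monos ws 9).
(** The products with z and with l = q + 3 a have to stay within [cols]; those of y^4 would bring in
    z y^4 and a y^4. *)
Definition ratio_monos := filter (fun m => negb (Nat.eqb (nth 3 m 0%nat) 4)) (monos ws 8).
(** The multipliers contain no z, since modulo 101 the rows from [ratio_monos] replace z by 7 l. *)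
Definition rows :=
  flat_map (fun x => multiples (snd x) (map (cons 0%nat) (monos (tl ws) (9 - fst x)))) words.
Lemma r4_divisible : divisible 0 r4' = true.
Proof. vm_compute. reflexivity. Qed.
Lemma r5_divisible : divisible 0 r5' = true.
Proof. vm_compute. reflexivity. Qed.
Lemma r6_divisible : divisible 3 r6' = true.
Proof. vm_compute. reflexivity. Qed.
Lemma rank_check_true :
  rank_check 101 7 cols (norm 6 z) (norm 6 l) ratio_monos rows = true.
Proof. vm_compute. reflexivity. Qed.
End Min.

(* The mirror system when k = s, in terms of a = (m - 2 l) / 3, y = t^2 / 9, h = k^2,
   w = om t / 3, s = l_v / w; the function c is defined by the equation for a_u. *)
Record minimal_system (O : R * R -> Prop) (a l s y h c w : R -> R -> R) : Prop := {
  mn_open : open O;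
  mn_a : smooth O a; mn_l : smooth O l; mn_s : smooth O s; mn_y : smooth O y;
  mn_h : smooth O h; mn_c : smooth O c; mn_w : smooth O w;
  mn_y0 : forall u v, O (u, v) -> y u v <> 0;
  mn_h0 : forall u v, O (u, v) -> h u v <> 0;
  mn_w0 : forall u v, O (u, v) -> w u v <> 0;
  mn_au : forall u v, O (u, v) ->
    pd U a u v = 6 * a u v ^ 2 - 4 * a u v * l u v - 6 * y u v - 4 * h u v - c u v;
  mn_lu : forall u v, O (u, v) -> pd U l u v = 2 * h u v - l u v ^ 2;
  mn_yu : forall u v, O (u, v) -> pd U y u v = 2 * y u v * (l u v - 6 * a u v);
  mn_hu : forall u v, O (u, v) -> pd U h u v = 6 * a u v * h u v;
  mn_wu : forall u v, O (u, v) -> pd U w u v = w u v * (2 * l u v - 6 * a u v);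
  mn_av : forall u v, O (u, v) -> pd V a u v = w u v * (6 * a u v - 2 * l u v);
  mn_lv : forall u v, O (u, v) -> pd V l u v = w u v * s u v;
  mn_yv : forall u v, O (u, v) -> pd V y u v = w u v *
    (12 * a u v ^ 2 - 6 * a u v * l u v - 12 * y u v - 4 * h u v - 2 * c u v);
  mn_hv : forall u v, O (u, v) -> pd V h u v = w u v * (- 6 * h u v)
}.

Section Minimal.

Variables (O : R * R -> Prop) (a l s y h c w : R -> R -> R).
Hypothesis H : minimal_system O a l s y h c w.

Ltac mixed E x Hx Hu Hv Huv :=
  assert (E := mixed_derivatives _ ltac:(eassumption) x _ _ _ _ _ _ Hx Hu Hv Huv
     ltac:(auto_derive; [ex_der; auto|reflexivity]) ltac:(auto_derive; [ex_der;
         auto|reflexivity]));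
  to_pd E.

Lemma min_su u v : O (u, v) ->
  pd U s u v = (6 * a u v - 4 * l u v) * s u v - 12 * h u v.
Proof.
  intros Huv. destruct H. mixed E l mn_l0 mn_lu0 mn_lv0 Huv.
  rewrite mn_lv0, mn_hv0, mn_wu0 in E by exact Huv. specialize (mn_w2 u v Huv).
  apply Rmult_eq_reg_l with (w u v); [|exact mn_w2]. lra.
Qed.

Lemma min_cv u v : O (u, v) ->
  pd V c u v = w u v * (18 * c u v + 108 * y u v + 76 * h u v - 12 * a u v * l u v
                        - 4 * a u v * s u v + 10 * l u v ^ 2).
Proof.
  intros Huv. destruct H. mixed E a mn_a0 mn_au0 mn_av0 Huv.
  rewrite mn_lv0, mn_hv0, mn_wu0, mn_av0, mn_yv0, mn_au0, mn_lu0 in E by exact Huv.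
  apply Rminus_diag_eq in E. apply Rminus_diag_uniq.
  match type of E with ?x = _ => transitivity (- x) end; [ring|rewrite E; ring].
Qed.

Lemma min_cu u v : O (u, v) ->
  pd U c u v = 108 * a u v ^ 3 - 84 * a u v ^ 2 * l u v + 15 * a u v * l u v ^ 2
    - 78 * a u v * h u v - 18 * a u v * c u v - 6 * l u v * y u v + 12 * l u v * h u v
    + 3 * l u v * c u v - s u v * y u v.
Proof.
  intros Huv. destruct H. mixed E y mn_y1 mn_yu0 mn_yv0 Huv.
  rewrite mn_lv0, mn_wu0, mn_av0, mn_yv0, mn_au0, mn_lu0, mn_yu0, mn_hu0 in E by exact Huv.
  specialize (mn_w2 u v Huv).
  apply Rminus_diag_eq in E. apply Rminus_diag_uniq.
  apply Rmult_eq_reg_l with (2 * w u v); [|lra]. rewrite Rmult_0_r.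
  match type of E with ?x = _ => transitivity x end; [ring|exact E].
Qed.

Lemma min_sv u v : O (u, v) ->
  pd V s u v = w u v * ((s u v * c u v + 12 * h u v * (a u v - 10 * l u v)) / y u v).
Proof.
  intros Huv. assert (Hcu := min_cu). assert (Hcv := min_cv). assert (Hsu := min_su).
  destruct H. mixed E c mn_c0 Hcu Hcv Huv.
  rewrite mn_lv0, mn_wu0, mn_av0, mn_yv0, mn_au0, mn_lu0, mn_yu0, mn_hu0, mn_hv0,
    Hcu, Hcv, Hsu in E by exact Huv.
  specialize (mn_w2 u v Huv). specialize (mn_y2 u v Huv).
  apply Rminus_diag_eq in E. apply Rminus_diag_uniq.
  apply Rmult_eq_reg_l with (- y u v); [|lra]. rewrite Rmult_0_r.
  match type of E with ?x = _ => transitivity x end; [field; exact mn_y2|exact E].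
Qed.

(** The mixed derivatives of l, a, y and c have determined s_u, c_v, c_u and s_v. Those of s involve
    no further unknown and give the first algebraic relation. *)
Lemma min_relation u v : O (u, v) ->
  s u v ^ 2 * y u v
  + s u v * (36 * a u v ^ 3 - 28 * a u v ^ 2 * l u v + 5 * a u v * l u v ^ 2
      - 12 * a u v * y u v - 26 * a u v * h u v - 4 * a u v * c u v + 2 * l u v * y u v
      + 4 * l u v * h u v + l u v * c u v)
  + h u v * (48 * a u v ^ 2 - 240 * a u v * l u v - 120 * l u v ^ 2 - 48 * y u v
      - 96 * h u v - 8 * c u v) = 0.
Proof.
  intros Huv. assert (Hcu := min_cu). assert (Hcv := min_cv). assert (Hsu := min_su).
  assert (Hsv := min_sv). destruct H. mixed E s mn_s0 Hsu Hsv Huv.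
  rewrite Hsv, mn_lv0, mn_wu0, mn_av0, mn_au0, mn_lu0, mn_yu0, mn_hu0, mn_hv0,
    Hcu, Hsu in E by exact Huv.
  specialize (mn_w2 u v Huv). specialize (mn_y2 u v Huv).
  apply Rminus_diag_eq in E.
  apply Rmult_eq_reg_l with (- 3 * w u v / y u v).
  - rewrite Rmult_0_r.
    match type of E with ?x = _ => transitivity x end; [field; exact mn_y2|exact E].
  - unfold Rdiv. repeat apply Rmult_integral_contrapositive_currified; try lra.
    apply Rinv_neq_0_compat; exact mn_y2.
Qed.

End Minimal.

(** * Constancy of the ratio z / l when k = s *)

Section Ratio.

Variables (O : R * R -> Prop) (a l s y h c w : R -> R -> R).
Hypothesis H : minimal_system O a l s y h c w.
Hypothesis Hs0 : forall u v, O (u, v) -> s u v <> 0.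
Hypothesis Hl0 : forall u v, O (u, v) -> l u v <> 0.

Let z u v := h u v / s u v.
Let fs := [z; a; fun u v => l u v - 3 * a u v; y; h; fun u v => 6 * y u v + c u v].
Let e u v := eval (env fs u v).

Ltac min_poly :=
  repeat unfold Min.Tz, Min.Ta, Min.Tq, Min.Ty, Min.Th, Min.Tf, Min.Dz, Min.Da, Min.Dq,
    Min.Dy, Min.Dh, Min.Df, Min.dy, Min.C1, Min.ys, Min.M, Min.N, Min.c, Min.l,
    Min.z, Min.a, Min.q, Min.y, Min.h, Min.f;
  peval_env.

Lemma ratio_ys u v : O (u, v) -> e u v (norm 6 Min.ys) = y u v * s u v.
Proof.
  intros Huv. assert (E := min_relation _ _ _ _ _ _ _ _ H u v Huv). assert (Hs1 := Hs0 u v Huv).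
  unfold e, fs, z. min_poly. apply Rmult_eq_reg_l with (s u v); [|exact Hs1].
  match type of E with ?x = _ => apply Rplus_eq_reg_r with x end. rewrite E at 2.
  field. exact Hs1.
Qed.

Lemma ratio_U u v j : O (u, v) -> (j < 6)%nat ->
  pd U (nth j fs (fun _ _ => 0)) u v = 1 * e u v (nth j Min.TT []).
Proof.
  intros Huv Hj. assert (Hsu := min_su _ _ _ _ _ _ _ _ H u v Huv).
  assert (Hcu := min_cu _ _ _ _ _ _ _ _ H u v Huv). assert (Hs1 := Hs0 u v Huv).
  assert (Hys := ratio_ys u v Huv).
  destruct H. rewrite Rmult_1_l. unfold e, Min.TT, fs, z in *.
  rewrite eval_norm in Hys by reflexivity.
  destruct j as [|[|[|[|[|[|j]]]]]]; [..|lia]; cbn [nth map];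
    (etransitivity; [apply is_derive_unique; auto_derive; [ex_der; exact Hs1|reflexivity]|]);
    repeat match goal with |- context [Derive (fun x => ?f x ?v) ?u] =>
      change (Derive (fun x => f x v) u) with (pd U f u v) end;
    rewrite ?Hsu, ?Hcu, ?mn_au0, ?mn_lu0, ?mn_yu0, ?mn_hu0 by exact Huv.
  6: unfold Min.Tf; rewrite eval_norm by reflexivity; cbn [peval]; rewrite Hys.
  all: min_poly; field; assumption.
Qed.

Lemma ratio_V u v j : O (u, v) -> (j < 6)%nat ->
  pd V (nth j fs (fun _ _ => 0)) u v = w u v / y u v * e u v (nth j Min.DD []).
Proof.
  intros Huv Hj. assert (Hsv := min_sv _ _ _ _ _ _ _ _ H u v Huv).
  assert (Hcv := min_cv _ _ _ _ _ _ _ _ H u v Huv). assert (Hs1 := Hs0 u v Huv).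
  assert (Hys := ratio_ys u v Huv). assert (Hy0 := mn_y0 _ _ _ _ _ _ _ _ H u v Huv).
  destruct H. unfold e, Min.DD, fs, z in *.
  rewrite eval_norm in Hys by reflexivity.
  destruct j as [|[|[|[|[|[|j]]]]]]; [..|lia]; cbn [nth map];
    (etransitivity; [apply is_derive_unique; auto_derive; [ex_der; exact Hs1|reflexivity]|]);
    repeat match goal with |- context [Derive (fun x => ?f ?u x) ?v] =>
      change (Derive (fun x => f u x) v) with (pd V f u v) end;
    rewrite ?Hsv, ?Hcv, ?mn_av0, ?mn_lv0, ?mn_yv0, ?mn_hv0 by exact Huv.
  3: unfold Min.Dq; rewrite eval_norm by reflexivity; cbn [peval]; rewrite Hys.
  6: unfold Min.Df; rewrite eval_norm by reflexivity; cbn [peval]; rewrite Hys.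
  all: min_poly; field; repeat split; assumption.
Qed.

Lemma ratio_smooth : Forall (smooth O) fs.
Proof.
  assert (hO := mn_open _ _ _ _ _ _ _ _ H). destruct H. unfold fs, z.
  repeat constructor; try assumption.
  - apply (smooth_div O hO); assumption.
  - apply smooth_minus; try apply smooth_mult; try apply smooth_const; assumption.
  - apply smooth_plus; try apply smooth_mult; try apply smooth_const; assumption.
Qed.

Lemma ratio_T f : (forall u v, O (u, v) -> e u v f = 0) ->
  forall u v, O (u, v) -> e u v (Min.T f) = 0.
Proof.
  exact (deriv_zero O U fs Min.TT f _ (mn_open _ _ _ _ _ _ _ _ H) ratio_smooth (le_n 6)
    (fun _ _ _ => R1_neq_R0) ratio_U).
Qed.

Lemma ratio_D f : (forall u v, O (u, v) -> e u v f = 0) ->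
  forall u v, O (u, v) -> e u v (Min.D f) = 0.
Proof.
  refine (deriv_zero O V fs Min.DD f _ (mn_open _ _ _ _ _ _ _ _ H) ratio_smooth (le_n 6)
    _ ratio_V).
  intros u v Huv. apply Rmult_integral_contrapositive_currified;
    [|apply Rinv_neq_0_compat]; destruct H; auto.
Qed.

Lemma ratio_r1 u v : O (u, v) -> e u v Min.r1 = 0.
Proof.
  intros Huv. assert (E := min_relation _ _ _ _ _ _ _ _ H u v Huv). assert (Hs1 := Hs0 u v Huv).
  unfold e, Min.r1, fs, z. min_poly.
  apply Rmult_eq_reg_l with (s u v ^ 2 / h u v).
  - rewrite Rmult_0_r.
    match type of E with ?x = _ => transitivity x end; [|exact E].
    assert (Hh := mn_h0 _ _ _ _ _ _ _ _ H u v Huv). field. split; assumption.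
  - apply Rmult_integral_contrapositive_currified; [apply pow_nonzero; assumption|].
    apply Rinv_neq_0_compat, (mn_h0 _ _ _ _ _ _ _ _ H); assumption.
Qed.

Lemma ratio_drop i f f' u v : divisible i f = true -> f' = pdrop i f ->
  env fs u v i <> 0 -> e u v f = 0 -> e u v f' = 0.
Proof.
  intros Hd -> Hi E. unfold e in *. rewrite (eval_pdrop _ i f Hd) in E.
  apply Rmult_integral in E as [E|E]; [elim Hi|]; exact E.
Qed.

Lemma ratio_z0 u v : O (u, v) -> env fs u v 0 <> 0.
Proof.
  intros Huv. unfold env, fs, z. cbn [nth].
  apply Rmult_integral_contrapositive_currified; [apply (mn_h0 _ _ _ _ _ _ _ _ H)|
    apply Rinv_neq_0_compat]; auto.
Qed.

Lemma ratio_r4 u v : O (u, v) -> e u v Min.r4 = 0.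
Proof.
  intros Huv. apply (ratio_drop 0 Min.r4' _ _ _ Min.r4_divisible eq_refl (ratio_z0 u v Huv)).
  unfold e, Min.r4'. rewrite eval_padd, eval_pmul.
  rewrite (ratio_T _ ratio_r1 u v Huv : eval _ _ = 0), (ratio_r1 u v Huv : eval _ _ = 0). ring.
Qed.

Lemma ratio_r5 u v : O (u, v) -> e u v Min.r5 = 0.
Proof.
  intros Huv. apply (ratio_drop 0 Min.r5' _ _ _ Min.r5_divisible eq_refl (ratio_z0 u v Huv)).
  unfold e, Min.r5'. rewrite eval_padd, eval_pmul.
  rewrite (ratio_D _ ratio_r1 u v Huv : eval _ _ = 0), (ratio_r1 u v Huv : eval _ _ = 0). ring.
Qed.

Lemma ratio_r6 u v : O (u, v) -> e u v Min.r6 = 0.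
Proof.
  intros Huv. apply (ratio_drop 3 Min.r6' _ _ _ Min.r6_divisible eq_refl).
  { apply (mn_y0 _ _ _ _ _ _ _ _ H). exact Huv. }
  unfold e, Min.r6'. rewrite !eval_padd, !eval_pmul.
  rewrite (ratio_D _ ratio_r5 u v Huv : eval _ _ = 0), (ratio_r1 u v Huv : eval _ _ = 0),
    (ratio_r5 u v Huv : eval _ _ = 0). ring.
Qed.

(** At such a point z = 7 l modulo 101, and the rank certificate would make z^9 vanish, while z = h
    / s has no zero. *)
Lemma ratio_rational u v p q : O (u, v) -> (q mod 101 = 1)%Z -> (p mod 101 = 7 mod 101)%Z ->
  IZR q * (z u v / l u v) <> IZR p.
Proof.
  intros Huv Hq Hp E.
  assert (Hm : forall n, In n Min.cols -> mono_eval (env fs u v) 0 n = 0).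
  { apply (rank_check_zero 101 7 Min.cols (norm 6 Min.z) (norm 6 Min.l) Min.ratio_monos
      Min.rows _ p q eq_refl Hq Hp).
    - unfold Min.l, Min.z, Min.q, Min.a. peval_env. unfold fs. cbn [nth]. rewrite <- E.
      field. apply Hl0; exact Huv.
    - assert (HT := ratio_T). assert (HD := ratio_D).
      assert (R1 := ratio_r1). assert (R4 := ratio_r4). assert (R5 := ratio_r5).
      assert (R6 := ratio_r6).
      assert (Hw : forall x, In x Min.words -> e u v (snd x) = 0).
      { intros x Hx. unfold Min.words in Hx.
        repeat (destruct Hx as [<-|Hx]; [cbn [snd]; auto|]). destruct Hx. }
      intros f Hf. unfold Min.rows in Hf. apply in_flat_map in Hf as (x & Hx & Hf).
      apply in_map_iff in Hf as (n & <- & _). rewrite eval_pmul_term.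
      rewrite (Hw x Hx : eval _ _ = 0). ring.
    - exact Min.rank_check_true. }
  specialize (Hm [9; 0; 0; 0; 0; 0]%nat). unfold mono_eval in Hm.
  apply (pow_nonzero _ 9 (ratio_z0 u v Huv)). rewrite <- Hm; [ring|].
  apply mono_mem_In. vm_compute. reflexivity.
Qed.

(** A nonzero derivative would produce a rational value excluded by [ratio_rational]. In contrast to
    s / k in the other case, no derivative of z / l is known to be nonzero, so constant ratios still
    have to be refuted by explicit computation. *)
Lemma ratio_constant i u v : O (u, v) -> pd i (fun u v => z u v / l u v) u v = 0.
Proof.
  intros Huv. apply NNPP. intros Hne. assert (hO := mn_open _ _ _ _ _ _ _ _ H).
  destruct (takes_rational_value O hO 101 7 i (fun u v => z u v / l u v) u v eq_refl)
    as (u' & v' & p & q & Huv' & _ & Hq & Hp & E); try assumption.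
  - apply (smooth_div O hO); [assumption| |apply (mn_l _ _ _ _ _ _ _ _ H)].
    exact (Forall_inv ratio_smooth).
  - exact (ratio_rational u' v' p q Huv' Hq Hp E).
Qed.

Lemma pd_square i f g k u v : smooth O g -> (forall u v, O (u, v) -> f u v = k * g u v ^ 2) ->
  O (u, v) -> pd i f u v = 2 * k * g u v * pd i g u v.
Proof.
  intros Hg Hf Huv. assert (hO := mn_open _ _ _ _ _ _ _ _ H).
  rewrite (pd_ext O hO i f (fun u v => k * (g u v * g u v))) by
    (intros; rewrite ?Hf by assumption; try ring; assumption).
  rewrite (pd_mult O), (pd_mult O), pd_const by
    (try apply smooth_mult; try apply smooth_const; assumption).
  ring.
Qed.

Lemma pd_multiple i f g k u v : smooth O g -> (forall u v, O (u, v) -> f u v = k * g u v) ->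
  O (u, v) -> pd i f u v = k * pd i g u v.
Proof.
  intros Hg Hf Huv. assert (hO := mn_open _ _ _ _ _ _ _ _ H).
  rewrite (pd_ext O hO i f (fun u v => k * g u v)) by assumption.
  rewrite (pd_mult O), pd_const by (try apply smooth_const; assumption).
  ring.
Qed.

(** For z = r l with r constant, z_u = r l_u reads 4 l z + 12 z^2 = r (2 h - l^2); divide by 2 r. *)
Lemma ratio_quadratic u v : O (u, v) ->
  h u v = (5 / 2 + 6 * (z u v / l u v)) * (l u v * l u v).
Proof.
  intros Huv. assert (E := ratio_constant U u v Huv). assert (hO := mn_open _ _ _ _ _ _ _ _ H).
  assert (Hz := ratio_z0 u v Huv). change (z u v <> 0) in Hz. assert (Hl := Hl0 u v Huv).
  assert (Er : pd U z u v = pd U (fun u v => z u v / l u v) u v * l u v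
                            + z u v / l u v * pd U l u v).
  { transitivity (pd U (fun u v => z u v / l u v * l u v) u v).
    - apply (pd_ext O hO); [|exact Huv]. intros x x' Hxy. field. auto.
    - apply (pd_mult O U (fun u v => z u v / l u v) l);
        [|apply (mn_l _ _ _ _ _ _ _ _ H)|exact Huv].
      apply (smooth_div O hO); [assumption|exact (Forall_inv ratio_smooth)|
        apply (mn_l _ _ _ _ _ _ _ _ H)]. }
  rewrite E, (ratio_U u v 0 Huv ltac:(lia) : pd U z u v = _), (mn_lu _ _ _ _ _ _ _ _ H) in Er
    by exact Huv.
  revert Er. unfold e, Min.TT, fs. cbn [nth map]. min_poly. intros Er.
  assert (Ez : z u v = z u v / l u v * l u v) by (field; exact Hl).
  assert (Hr : z u v / l u v <> 0).
  { apply Rmult_integral_contrapositive_currified; [|apply Rinv_neq_0_compat]; assumption. }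
  revert Er Ez Hr. generalize (z u v / l u v). intros r Er Ez Hr. rewrite Ez in Er.
  apply Rmult_eq_reg_l with (2 * r); lra.
Qed.

(** The v-derivative of [ratio_quadratic], compared with h_v = - 6 w h and h = z s, gives - 6 z = 5
    l + 12 z, so the constant ratio is - 5/18. *)
Lemma ratio_values u v : O (u, v) -> h u v = 5 / 6 * l u v ^ 2 /\ s u v = - 3 * l u v.
Proof.
  intros Huv. assert (hO := mn_open _ _ _ _ _ _ _ _ H).
  assert (Hz := ratio_z0 u v Huv). change (z u v <> 0) in Hz.
  assert (Hl := Hl0 u v Huv). assert (Hs := Hs0 u v Huv).
  assert (Hw := mn_w0 _ _ _ _ _ _ _ _ H u v Huv).
  assert (Hsl := mn_l _ _ _ _ _ _ _ _ H).
  assert (Eq := ratio_quadratic u v Huv).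
  assert (E := pd_ext O hO V _ _ u v ratio_quadratic Huv).
  assert (Hr : smooth O (fun u v => z u v / l u v)).
  { apply (smooth_div O hO); try assumption. exact (Forall_inv ratio_smooth). }
  assert (Hc : forall k, smooth O (fun _ _ => k)) by (intros; apply smooth_const; exact hO).
  assert (H6 : smooth O (fun u v => 6 * (z u v / l u v))) by (apply smooth_mult; auto).
  rewrite (pd_mult O V (fun u v => 5 / 2 + 6 * (z u v / l u v)) (fun u v => l u v * l u v)),
    (pd_mult O V l l), (pd_plus O V (fun _ _ => 5 / 2) (fun u v => 6 * (z u v / l u v))),
    (pd_mult O V (fun _ _ => 6) (fun u v => z u v / l u v)), !pd_const,
    (ratio_constant V u v Huv), (mn_lv _ _ _ _ _ _ _ _ H u v Huv),
    (mn_hv _ _ _ _ _ _ _ _ H u v Huv) in E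
    by first [assumption | apply Hc | apply smooth_mult; assumption
             | apply smooth_plus; auto].
  assert (Ez : 18 * z u v = - 5 * l u v).
  { assert (Ezs : h u v = z u v * s u v) by (unfold z; field; exact Hs).
    assert (Ezl : z u v = z u v / l u v * l u v) by (field; exact Hl).
    rewrite Ezs in E.
    assert (Hws : w u v * s u v <> 0).
    { apply Rmult_integral_contrapositive_currified; assumption. }
    revert E Ezl. generalize (z u v / l u v). intros r E Ezl. rewrite Ezl in E |- *.
    apply Rmult_eq_reg_l with (w u v * s u v); [|exact Hws]. lra. }
  assert (E1 : h u v = 5 / 6 * l u v ^ 2).
  { rewrite Eq. replace (z u v) with (- 5 * l u v / 18) by lra. field. exact Hl. }
  split; [exact E1|].
  apply Rmult_eq_reg_l with (z u v); [|exact Hz].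
  transitivity (h u v); [unfold z; field; exact Hs|].
  rewrite E1. replace (z u v) with (- 5 * l u v / 18) by lra. field.
Qed.

(** All unknowns become multiples of powers of l: the equations for h_u, a_u and s_v give in turn a
    = 2 l / 9, then 6 y + c and y as multiples of l^2. As l_u = 2 l^2 / 3, the equation for y_u
    becomes - 2/3 l y = 4/3 l y. *)
Lemma ratio_absurd u v : ~ O (u, v).
Proof.
  intros Huv0. assert (hO := mn_open _ _ _ _ _ _ _ _ H). assert (Hv := ratio_values).
  assert (Ea : forall u v, O (u, v) -> a u v = 2 / 9 * l u v).
  { intros x x' Hx.
    assert (E := pd_square U h l (5 / 6) x x' (mn_l _ _ _ _ _ _ _ _ H)
      (fun u v h => proj1 (Hv u v h)) Hx).
    rewrite (mn_hu _ _ _ _ _ _ _ _ H), (mn_lu _ _ _ _ _ _ _ _ H), (proj1 (Hv x x' Hx)) in E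
      by exact Hx.
    apply Rmult_eq_reg_l with (5 * (l x x' * l x x')); [lra|].
    specialize (Hl0 x x' Hx). repeat apply Rmult_integral_contrapositive_currified; lra. }
  assert (Ef : forall u v, O (u, v) -> 6 * y u v + c u v = - (110 / 27) * l u v ^ 2).
  { intros x x' Hx.
    assert (E := pd_multiple U a l (2 / 9) x x' (mn_l _ _ _ _ _ _ _ _ H) Ea Hx).
    rewrite (mn_au _ _ _ _ _ _ _ _ H), (mn_lu _ _ _ _ _ _ _ _ H), (proj1 (Hv x x' Hx)),
      (Ea x x' Hx) in E by exact Hx. lra. }
  assert (Ey : forall u v, O (u, v) -> y u v = 770 / 81 * l u v ^ 2).
  { intros x x' Hx.
    assert (E := pd_multiple V s l (- 3) x x' (mn_l _ _ _ _ _ _ _ _ H)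
      (fun u v h => proj2 (Hv u v h)) Hx).
    assert (Hy := mn_y0 _ _ _ _ _ _ _ _ H x x' Hx).
    assert (Hw := mn_w0 _ _ _ _ _ _ _ _ H x x' Hx). specialize (Hl0 x x' Hx).
    rewrite (min_sv _ _ _ _ _ _ _ _ H), (mn_lv _ _ _ _ _ _ _ _ H), (proj1 (Hv x x' Hx)),
      (proj2 (Hv x x' Hx)), (Ea x x' Hx) in E by exact Hx.
    specialize (Ef x x' Hx).
    assert (E' : - 3 * c x x' - 880 / 9 * l x x' ^ 2 = 9 * y x x').
    { apply Rmult_eq_reg_l with (w x x' * l x x' / y x x').
      - transitivity (-3 * (w x x' * (-3 * l x x'))); [rewrite <- E|]; field; exact Hy.
      - unfold Rdiv. repeat apply Rmult_integral_contrapositive_currified; try assumption.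
        apply Rinv_neq_0_compat; exact Hy. }
    lra. }
  assert (E := pd_square U y l (770 / 81) u v (mn_l _ _ _ _ _ _ _ _ H) Ey Huv0).
  rewrite (mn_yu _ _ _ _ _ _ _ _ H), (mn_lu _ _ _ _ _ _ _ _ H), (proj1 (Hv u v Huv0)),
    (Ey u v Huv0), (Ea u v Huv0) in E by exact Huv0.
  apply (pow_nonzero _ 3 (Hl0 u v Huv0)). lra.
Qed.

End Ratio.

Lemma minimal_system_subset O O' a l s y h c w :
  open O' -> (forall p, O' p -> O p) ->
  minimal_system O a l s y h c w -> minimal_system O' a l s y h c w.
Proof.
  intros hO' Hsub []; constructor; auto; apply (smooth_subset O); assumption.
Qed.

(** If l vanished on an open set, l_u = 2 h - l^2 would give h = 0; if s did, s_u = (6 a - 4 l) s -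
    12 h would. So a nonempty O contains points where neither vanishes, and [ratio_absurd] applies
    near them. *)
Lemma minimal_system_absurd O a l s y h c w u v :
  minimal_system O a l s y h c w -> ~ O (u, v).
Proof.
  intros H Huv. assert (hO := mn_open _ _ _ _ _ _ _ _ H).
  set (O1 := fun p => O p /\ s (fst p) (snd p) <> 0).
  assert (H1 : minimal_system O1 a l s y h c w).
  { apply (minimal_system_subset O); [|intros p []; assumption|exact H].
    apply (open_neq O hO). apply (mn_s _ _ _ _ _ _ _ _ H). }
  assert (hO1 := mn_open _ _ _ _ _ _ _ _ H1).
  set (O2 := fun p => O1 p /\ l (fst p) (snd p) <> 0).
  assert (H2 : minimal_system O2 a l s y h c w).
  { apply (minimal_system_subset O1); [|intros p []; assumption|exact H1].
    apply (open_neq O1 hO1). apply (mn_l _ _ _ _ _ _ _ _ H1). }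
  assert (He : forall x y, ~ O2 (x, y)).
  { intros x x'. apply (ratio_absurd O2 a l s y h c w H2).
    - intros ? ? [[_ Hx] _]; exact Hx.
    - intros ? ? [_ Hx]; exact Hx. }
  assert (Hl : forall x x', O1 (x, x') -> l x x' = 0).
  { intros x x' Hx. apply NNPP. intros Hn. apply (He x x'). split; assumption. }
  assert (He1 : forall x y, ~ O1 (x, y)).
  { intros x x' Hx. assert (E := pd_ext O1 hO1 U l (fun _ _ => 0) x x' Hl Hx).
    rewrite pd_const, (mn_lu _ _ _ _ _ _ _ _ H1), (Hl x x' Hx) in E by exact Hx.
    apply (mn_h0 _ _ _ _ _ _ _ _ H1 x x' Hx). lra. }
  assert (Hs : forall x x', O (x, x') -> s x x' = 0).
  { intros x x' Hx. apply NNPP. intros Hn. apply (He1 x x'). split; assumption. }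
  assert (E := pd_ext O hO U s (fun _ _ => 0) u v Hs Huv).
  rewrite pd_const, (min_su _ _ _ _ _ _ _ _ H), (Hs u v Huv) in E by exact Huv.
  apply (mn_h0 _ _ _ _ _ _ _ _ H u v Huv). lra.
Qed.

(** For k = s the equations of k and s coincide, and their mixed derivatives determine only the
    v-derivative of m - 2 l = 3 a. Both l_v and a_u remain free; they become the unknowns s and c of
    [minimal_system]. *)
Lemma mirror_system_absurd O k s t l m om u v :
  mirror_system O k s t l m om -> ~ O (u, v).
Proof.
  intros H Huv0. assert (Heq := fun u v => mirror_system_eq O k s t l m om u v H).
  assert (hO := ms_open _ _ _ _ _ _ _ H).
  assert (Hk := ms_k _ _ _ _ _ _ _ H). assert (Ht := ms_t _ _ _ _ _ _ _ H).
  assert (Hl := ms_l _ _ _ _ _ _ _ H). assert (Hm := ms_m _ _ _ _ _ _ _ H).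
  assert (Ho := ms_om _ _ _ _ _ _ _ H).
  assert (Hc : forall r, smooth O (fun _ _ => r)) by (intros; apply smooth_const; exact hO).
  assert (ku : forall u v, O (u, v) -> pd U k u v = k u v * (m u v - 2 * l u v)).
  { intros x y Hx. rewrite (ms_ku _ _ _ _ _ _ _ H), <- (Heq x y Hx) by exact Hx. ring. }
  assert (kv : forall u v, O (u, v) -> pd V k u v = - (om u v * k u v * t u v)).
  { intros x y Hx. rewrite (ms_kv _ _ _ _ _ _ _ H), <- (Heq x y Hx) by exact Hx. ring. }
  assert (tu : forall u v, O (u, v) -> pd U t u v = t u v * (5 * l u v - 2 * m u v)).
  { intros x y Hx. rewrite (ms_tu _ _ _ _ _ _ _ H), ku by exact Hx. field.
    apply (ms_k0 _ _ _ _ _ _ _ H x y Hx). }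
  assert (omu := ms_omu _ _ _ _ _ _ _ H).
  assert (lu : forall u v, O (u, v) -> pd U l u v = 2 * k u v ^ 2 - l u v ^ 2).
  { intros x y Hx. rewrite (ms_lu _ _ _ _ _ _ _ H), <- (Heq x y Hx) by exact Hx. ring. }
  assert (Hw : forall u v, O (u, v) -> om u v * t u v / 3 <> 0).
  { intros x y Hx. assert (H1 := ms_om0 _ _ _ _ _ _ _ H x y Hx).
    assert (H2 := ms_t0 _ _ _ _ _ _ _ H x y Hx).
    apply Rmult_integral_contrapositive_currified; [|lra].
    apply Rmult_integral_contrapositive_currified; assumption. }
  set (a u v := (m u v - 2 * l u v) / 3).
  set (c u v := 6 * a u v ^ 2 - 4 * a u v * l u v - 6 * (t u v ^ 2 / 9) - 4 * k u v ^ 2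
                - pd U a u v).
  assert (Ha : smooth O a).
  { apply (smooth_div O hO); [intros; lra| |apply Hc].
    apply smooth_minus; auto. apply smooth_mult; auto. }
  assert (Ew : smooth O (fun u v => om u v * t u v / 3)).
  { apply (smooth_div O hO); [intros; lra| |apply Hc]. apply smooth_mult; auto. }
  assert (Hy : smooth O (fun u v => t u v ^ 2 / 9)).
  { apply (smooth_div O hO); [intros; lra| |apply Hc]. apply smooth_pow; auto. }
  assert (Hh : smooth O (fun u v => k u v ^ 2)) by (apply smooth_pow; auto).
  assert (Em : forall u v, O (u, v) -> pd U m u v = 3 * pd U a u v + 2 * pd U l u v).
  { intros x y Hx. transitivity (3 * ((1 * pd U m x y + - (2 * (1 * pd U l x y))) * / 3) + 2 *
      pd U l x y);
      [field|]. f_equal. f_equal. symmetry. apply is_derive_unique. unfold a.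
    auto_derive; [ex_der|]. reflexivity. }
  apply (minimal_system_absurd O a l (fun u v => pd V l u v / (om u v * t u v / 3))
    (fun u v => t u v ^ 2 / 9) (fun u v => k u v ^ 2) c
    (fun u v => om u v * t u v / 3) u v); [|exact Huv0].
  assert (Hl' := smooth_pd O V l Hl). assert (Ha' := smooth_pd O U a Ha).
  constructor; try assumption.
  - apply (smooth_div O hO); assumption.
  - unfold c. repeat first [apply smooth_minus | apply smooth_mult | apply smooth_pow]; auto.
  - intros x y Hx. apply Rmult_integral_contrapositive_currified; [|lra].
    apply pow_nonzero. apply (ms_t0 _ _ _ _ _ _ _ H x y Hx).
  - intros x y Hx. apply pow_nonzero. apply (ms_k0 _ _ _ _ _ _ _ H x y Hx).
  - intros x y Hx. unfold c. ring.
  - intros x y Hx. etransitivity; [apply is_derive_unique; auto_derive; [ex_der|reflexivity]|].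
    change (Derive (fun x => t x y) x) with (pd U t x y). rewrite tu by exact Hx.
    unfold a. field.
  - intros x y Hx. etransitivity; [apply is_derive_unique; auto_derive; [ex_der|reflexivity]|].
    change (Derive (fun x => k x y) x) with (pd U k x y). rewrite ku by exact Hx.
    unfold a. field.
  - intros x y Hx. etransitivity; [apply is_derive_unique; auto_derive; [ex_der|reflexivity]|].
    change (Derive (fun x => t x y) x) with (pd U t x y).
    change (Derive (fun x => om x y) x) with (pd U om x y). rewrite tu, omu by exact Hx.
    unfold a. field.
  - intros x y Hx.
    assert (E := mixed_derivatives O hO k _ _ x y _ _ Hk ku kv Hx
     ltac:(auto_derive; [ex_der|reflexivity]) ltac:(auto_derive; [ex_der|reflexivity])).
    to_pd E. rewrite kv, ku, omu, tu in E by exact Hx.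
    transitivity ((pd V m x y - 2 * pd V l x y) * / 3).
    + etransitivity; [apply is_derive_unique; unfold a; auto_derive; [ex_der|reflexivity]|].
      change (Derive (fun y => m x y) y) with (pd V m x y).
      change (Derive (fun y => l x y) y) with (pd V l x y). ring.
    + apply Rmult_eq_reg_l with (3 * k x y); [unfold a; lra|].
      assert (Hk0 := ms_k0 _ _ _ _ _ _ _ H x y Hx). lra.
  - intros x y Hx. field. specialize (Hw x y Hx). split; intros E; apply Hw; rewrite E; field.
  - intros x y Hx. etransitivity; [apply is_derive_unique; auto_derive; [ex_der|reflexivity]|].
    change (Derive (fun y => t x y) y) with (pd V t x y).
    rewrite (ms_tv _ _ _ _ _ _ _ H), <- (Heq x y Hx), (Em x y Hx), lu by exact Hx.
    unfold c, a. field.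
  - intros x y Hx. etransitivity; [apply is_derive_unique; auto_derive; [ex_der|reflexivity]|].
    change (Derive (fun y => k x y) y) with (pd V k x y). rewrite kv by exact Hx. field.
Qed.

(** * Vector calculus in Euclidean 4-space *)

Lemma E4_ext (p q : E4) : x1 p = x1 q -> x2 p = x2 q -> x3 p = x3 q -> x4 p = x4 q -> p = q.
Proof.
  destruct p as [[[? ?] ?] ?], q as [[[? ?] ?] ?]; unfold x1, x2, x3, x4; simpl; intros; subst.
  reflexivity.
Qed.

Lemma inner_comm p q : inner p q = inner q p.
Proof. unfold inner; ring. Qed.

Lemma inner_plus_l p q r : inner (plus p q) r = inner p r + inner q r.
Proof.
  unfold inner. change (x1 (plus p q)) with (x1 p + x1 q).
  change (x2 (plus p q)) with (x2 p + x2 q).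
  change (x3 (plus p q)) with (x3 p + x3 q). change (x4 (plus p q)) with (x4 p + x4 q). ring.
Qed.

Lemma inner_scal_l k p r : inner (scal k p) r = k * inner p r.
Proof.
  unfold inner. change (x1 (scal k p)) with (k * x1 p). change (x2 (scal k p)) with (k * x2 p).
  change (x3 (scal k p)) with (k * x3 p). change (x4 (scal k p)) with (k * x4 p). ring.
Qed.

Lemma inner_minus_l p q r : inner (minus p q) r = inner p r - inner q r.
Proof.
  unfold inner. change (x1 (minus p q)) with (x1 p - x1 q).
  change (x2 (minus p q)) with (x2 p - x2 q).
  change (x3 (minus p q)) with (x3 p - x3 q). change (x4 (minus p q)) with (x4 p - x4 q). ring.
Qed.

Lemma inner_plus_r p q r : inner r (plus p q) = inner r p + inner r q.
Proof. rewrite inner_comm, inner_plus_l, !(inner_comm r). reflexivity. Qed.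

Lemma inner_minus_r p q r : inner r (minus p q) = inner r p - inner r q.
Proof. rewrite inner_comm, inner_minus_l, !(inner_comm r). reflexivity. Qed.

Lemma inner_scal_r k p r : inner r (scal k p) = k * inner r p.
Proof. rewrite inner_comm, inner_scal_l, (inner_comm r). reflexivity. Qed.

Lemma inner_pos p : p <> zero -> 0 < inner p p.
Proof.
  intros H. destruct (Rle_lt_or_eq_dec 0 (inner p p)) as [Hp|Hp]; [unfold inner; nra|exact Hp|].
  elim H. unfold inner in Hp. apply E4_ext; change (x1 zero) with 0; change (x2 zero) with 0;
    change (x3 zero) with 0; change (x4 zero) with 0; nra.
Qed.

(** The left side is det(x, a, b, c) det(y, a, b, c), hence the determinant of the inner products of
    (x, a, b, c) with (y, a, b, c); the right side expands it along the row of x. *)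
Lemma gram_det x y a b c :
  inner x (cross a b c) * inner y (cross a b c) =
  inner x y * det3 (inner a a) (inner a b) (inner a c) (inner b a) (inner b b) (inner b c)
                   (inner c a) (inner c b) (inner c c)
  - inner x a * det3 (inner a y) (inner a b) (inner a c) (inner b y) (inner b b) (inner b c)
                   (inner c y) (inner c b) (inner c c)
  + inner x b * det3 (inner a y) (inner a a) (inner a c) (inner b y) (inner b a) (inner b c)
                   (inner c y) (inner c a) (inner c c)
  - inner x c * det3 (inner a y) (inner a a) (inner a b) (inner b y) (inner b a) (inner b b)
                   (inner c y) (inner c a) (inner c b).
Proof.
  unfold inner, cross, det3.
  destruct x as [[[? ?] ?] ?], y as [[[? ?] ?] ?], a as [[[? ?] ?] ?], b as [[[? ?] ?] ?],
    c as [[[? ?] ?] ?]. unfold x1, x2, x3, x4; cbn [fst snd]. ring.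
Qed.

Lemma filterdiff_pair {X Y Z : NormedModule R_AbsRing} (f : X -> Y) (g : X -> Z) x lf lg :
  filterdiff f (locally x) lf -> filterdiff g (locally x) lg ->
  filterdiff (fun t => (f t, g t)) (locally x) (fun t => (lf t, lg t)).
Proof.
  intros Hf Hg.
  apply (filterdiff_comp'_2 f g pair x lf lg pair Hf Hg).
  apply (filterdiff_ext (fun p => p)); [intros []; reflexivity|].
  apply (filterdiff_ext_lin _ (fun p => p)); [|intros []; reflexivity].
  apply filterdiff_id.
Qed.

Definition is_derive_E4 (c : R -> E4) (t : R) (c' : E4) : Prop :=
  is_derive (fun t => x1 (c t)) t (x1 c') /\ is_derive (fun t => x2 (c t)) t (x2 c') /\
  is_derive (fun t => x3 (c t)) t (x3 c') /\ is_derive (fun t => x4 (c t)) t (x4 c').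

Lemma is_derive_E4_filterdiff c t c' :
  is_derive_E4 c t c' -> filterdiff c (locally t) (fun y => scal y c').
Proof.
  intros (H1 & H2 & H3 & H4).
  apply (filterdiff_ext (fun t => (x1 (c t), x2 (c t), x3 (c t), x4 (c t)))).
  { intros y. destruct (c y) as [[[? ?] ?] ?]. reflexivity. }
  apply (filterdiff_ext_lin _
    (fun y : R => (scal y (x1 c'), scal y (x2 c'), scal y (x3 c'), scal y (x4 c')))).
  2: { intros y. destruct c' as [[[? ?] ?] ?]. reflexivity. }
  exact (filterdiff_pair _ _ _ _ _
    (filterdiff_pair _ _ _ _ _ (filterdiff_pair _ _ _ _ _ H1 H2) H3) H4).
Qed.

(** The defining function vanishes along the curve near t, so the chain rule makes its gradient
    orthogonal to c'. Continuity of c keeps nearby points where that function describes M. *)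
Lemma hypersurface_normal M nu c t c' :
  oriented_hypersurface M nu -> is_derive_E4 c t c' -> locally t (fun t => M (c t)) ->
  inner (nu (c t)) (nu (c t)) = 1 /\ inner (nu (c t)) c' = 0.
Proof.
  intros HM Hc HMc. assert (Hd := is_derive_E4_filterdiff _ _ _ Hc).
  destruct (HM (c t) (locally_singleton _ _ HMc)) as (f & grad & Hloc).
  destruct (locally_singleton _ _ Hloc) as (_ & Hf & _ & Hg0 & Hnu).
  rewrite (Hnu (locally_singleton _ _ HMc)).
  assert (Hp := inner_pos _ Hg0).
  assert (Hs : 0 < enorm (grad (c t))) by (apply sqrt_lt_R0; exact Hp).
  assert (Hn : enorm (grad (c t)) * enorm (grad (c t)) = inner (grad (c t)) (grad (c t))).
  { apply sqrt_sqrt. lra. }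
  assert (Hgc : inner (grad (c t)) c' = 0).
  { assert (Hfc := filterdiff_comp' c f t _ _ Hd Hf).
    assert (Hcont : continuous c t).
    { apply (filterdiff_continuous c t). eexists; exact Hd. }
    assert (H0 : filterdiff (fun _ : R => 0) (locally t) (fun y => inner (grad (c t))
        (scal y c'))).
    { apply (filterdiff_ext_locally (fun y => f (c y))); [|exact Hfc].
      assert (Hl := Hcont _ Hloc). unfold filtermap in Hl.
      generalize (filter_and _ _ HMc Hl). apply filter_imp. intros y [Hy (Hiff & _)].
      apply Hiff; exact Hy. }
    assert (H1 : is_derive (fun _ : R => 0) t (inner (grad (c t)) c')).
    { apply (filterdiff_ext_lin _ _ _ H0). intros y.
      rewrite inner_comm, inner_scal_l, inner_comm. reflexivity. }
    apply is_derive_unique in H1. rewrite Derive_const in H1. auto. }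
  split.
  - rewrite inner_scal_l, inner_comm, inner_scal_l, <- Hn. field. lra.
  - rewrite inner_scal_l, Hgc. ring.
Qed.

Section Fields.

Variable O : R * R -> Prop.
Hypothesis hO : open O.

Lemma pdE_ext i F G u v :
  (forall u v, O (u, v) -> F u v = G u v) -> O (u, v) -> pdE i F u v = pdE i G u v.
Proof.
  intros H Huv. unfold pdE.
  rewrite (pd_ext O hO i (fun s t => x1 (F s t)) (fun s t => x1 (G s t))),
    (pd_ext O hO i (fun s t => x2 (F s t)) (fun s t => x2 (G s t))),
    (pd_ext O hO i (fun s t => x3 (F s t)) (fun s t => x3 (G s t))),
    (pd_ext O hO i (fun s t => x4 (F s t)) (fun s t => x4 (G s t)))
    by (intros; rewrite ?H by assumption; auto).
  reflexivity.
Qed.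

Lemma smoothE_ext F G :
  (forall u v, O (u, v) -> F u v = G u v) -> smoothE O F -> smoothE O G.
Proof.
  intros H (H1 & H2 & H3 & H4).
  assert (Hx : forall x : E4 -> R, smooth O (fun u v => x (F u v)) -> smooth O (fun u v => x (G
      u v))).
  { intros x. apply (smooth_ext O hO). intros; rewrite H; auto. }
  repeat split; auto.
Qed.

Lemma smoothE_pdE i F : smoothE O F -> smoothE O (pdE i F).
Proof.
  intros (H1 & H2 & H3 & H4).
  split; [|split; [|split]]; [exact (smooth_pd O i _ H1)|exact (smooth_pd O i _ H2)
    |exact (smooth_pd O i _ H3)|exact (smooth_pd O i _ H4)].
Qed.

Lemma smooth_inner F G : smoothE O F -> smoothE O G -> smooth O (fun u v => inner (F u v)
    (G u v)).
Proof.
  intros (H1 & H2 & H3 & H4) (K1 & K2 & K3 & K4).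
  repeat apply (smooth_plus O hO); apply (smooth_mult O hO); assumption.
Qed.

Lemma smoothE_scal f F : smooth O f -> smoothE O F -> smoothE O (fun u v => scal (f u v) (F u v)).
Proof.
  intros Hf (H1 & H2 & H3 & H4).
  split; [|split; [|split]]; apply (smooth_mult O hO f); assumption.
Qed.

Lemma smoothE_minus F G : smoothE O F -> smoothE O G -> smoothE O (fun u v => minus (F u v)
    (G u v)).
Proof.
  intros (H1 & H2 & H3 & H4) (K1 & K2 & K3 & K4).
  split; [|split; [|split]]; [exact (smooth_minus O hO _ _ H1 K1)|exact (smooth_minus O hO _ _
      H2 K2)
    |exact (smooth_minus O hO _ _ H3 K3)|exact (smooth_minus O hO _ _ H4 K4)].
Qed.

Lemma smoothE_cross F G K : smoothE O F -> smoothE O G -> smoothE O K ->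
  smoothE O (fun u v => cross (F u v) (G u v) (K u v)).
Proof.
  intros (H1 & H2 & H3 & H4) (K1 & K2 & K3 & K4) (L1 & L2 & L3 & L4).
  assert (Hm := smooth_mult O hO). assert (Hi := smooth_minus O hO).
  assert (Hp := smooth_plus O hO).
  assert (Hd : forall a1 a2 a3 b1 b2 b3 c1 c2 c3,
    smooth O a1 -> smooth O a2 -> smooth O a3 -> smooth O b1 -> smooth O b2 -> smooth O b3 ->
    smooth O c1 -> smooth O c2 -> smooth O c3 ->
    smooth O (fun u v => det3 (a1 u v) (a2 u v) (a3 u v) (b1 u v) (b2 u v) (b3 u v)
                              (c1 u v) (c2 u v) (c3 u v))).
  { intros. unfold det3. auto 10. }
  split; [|split; [|split]]; unfold cross, x1, x2, x3, x4; cbn [fst snd];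
    try apply (smooth_opp O hO); apply Hd; assumption.
Qed.

Lemma pd_inner i F G u v : smoothE O F -> smoothE O G -> O (u, v) ->
  pd i (fun u v => inner (F u v) (G u v)) u v
  = inner (pdE i F u v) (G u v) + inner (F u v) (pdE i G u v).
Proof.
  intros (H1 & H2 & H3 & H4) (K1 & K2 & K3 & K4) Huv. unfold inner.
  rewrite (pd_plus O) , (pd_plus O), (pd_plus O), !(pd_mult O)
    by (try assumption; repeat apply (smooth_plus O hO); apply (smooth_mult O hO); assumption).
  unfold pdE, x1, x2, x3, x4. cbn [fst snd]. ring.
Qed.

Lemma pdE_scal i f F u v : smooth O f -> smoothE O F -> O (u, v) ->
  pdE i (fun u v => scal (f u v) (F u v)) u v
  = plus (scal (pd i f u v) (F u v)) (scal (f u v) (pdE i F u v)).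
Proof.
  intros Hf (H1 & H2 & H3 & H4) Huv.
  apply E4_ext; [exact (pd_mult O i f _ u v Hf H1 Huv)|exact (pd_mult O i f _ u v Hf H2 Huv)
    |exact (pd_mult O i f _ u v Hf H3 Huv)|exact (pd_mult O i f _ u v Hf H4 Huv)].
Qed.

Lemma pdE_comm F u v : smoothE O F -> O (u, v) -> pdE V (pdE U F) u v = pdE U (pdE V F) u v.
Proof.
  intros (H1 & H2 & H3 & H4) Huv.
  apply E4_ext; [exact (pd_comm O hO _ u v H1 Huv)|exact (pd_comm O hO _ u v H2 Huv)
    |exact (pd_comm O hO _ u v H3 Huv)|exact (pd_comm O hO _ u v H4 Huv)].
Qed.

Lemma pd_inner_const i F G k u v : smoothE O F -> smoothE O G ->
  (forall u v, O (u, v) -> inner (F u v) (G u v) = k) -> O (u, v) ->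
  inner (pdE i F u v) (G u v) = - inner (pdE i G u v) (F u v).
Proof.
  intros HF HG H Huv. assert (E := pd_inner i F G u v HF HG Huv).
  rewrite (pd_ext O hO i _ (fun _ _ => k) u v H Huv), pd_const in E.
  rewrite (inner_comm (pdE i G u v)). lra.
Qed.

(** The second-order terms cancel by F_uv = F_vu. Applied to pairs of frame vectors, this yields the
    Gauss, Codazzi and Ricci equations. *)
Lemma pd_inner_flat F G u v : smoothE O F -> smoothE O G -> O (u, v) ->
  pd V (fun u v => inner (pdE U F u v) (G u v)) u v
  - pd U (fun u v => inner (pdE V F u v) (G u v)) u v
  = inner (pdE U F u v) (pdE V G u v) - inner (pdE V F u v) (pdE U G u v).
Proof.
  intros HF HG Huv.
  rewrite (pd_inner V (pdE U F) G u v), (pd_inner U (pdE V F) G u v), pdE_comm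
    by auto using smoothE_pdE.
  ring.
Qed.

End Fields.

(** * Moving frames *)

(** The surface itself survives only through [mf_Tv], which is Omega_uv = (w D)_u for Omega_v = w
    D. *)
Record moving_frame (O : R * R -> Prop) (T E D N : R -> R -> E4)
    (k s t w : R -> R -> R) : Prop := {
  mf_open : open O;
  mf_sT : smoothE O T; mf_sE : smoothE O E; mf_sD : smoothE O D; mf_sN : smoothE O N;
  mf_sk : smooth O k; mf_ss : smooth O s; mf_st : smooth O t; mf_sw : smooth O w;
  mf_TT : forall u v, O (u, v) -> inner (T u v) (T u v) = 1;
  mf_EE : forall u v, O (u, v) -> inner (E u v) (E u v) = 1;
  mf_DD : forall u v, O (u, v) -> inner (D u v) (D u v) = 1;
  mf_NN : forall u v, O (u, v) -> inner (N u v) (N u v) = 1;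
  mf_TE : forall u v, O (u, v) -> inner (T u v) (E u v) = 0;
  mf_TD : forall u v, O (u, v) -> inner (T u v) (D u v) = 0;
  mf_TN : forall u v, O (u, v) -> inner (T u v) (N u v) = 0;
  mf_ED : forall u v, O (u, v) -> inner (E u v) (D u v) = 0;
  mf_EN : forall u v, O (u, v) -> inner (E u v) (N u v) = 0;
  mf_DN : forall u v, O (u, v) -> inner (D u v) (N u v) = 0;
  mf_Tu : forall u v, O (u, v) -> pdE U T u v = scal (k u v) (N u v);
  mf_Eu : forall u v, O (u, v) ->
    pdE U E u v = plus (scal (s u v) (D u v)) (scal (t u v) (N u v));
  mf_Du : forall u v, O (u, v) -> pdE U D u v = scal (- s u v) (E u v);
  mf_Nu : forall u v, O (u, v) ->
    pdE U N u v = minus (scal (- k u v) (T u v)) (scal (t u v) (E u v));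
  mf_Tv : forall u v, O (u, v) ->
    pdE V T u v = plus (scal (pd U w u v) (D u v)) (scal (- (w u v * s u v)) (E u v))
}.

(** An entry of the skew matrix that describes the motion of the frame in direction v. The row of T
    is given by [mf_Tv], so the unknown entries are <N_v, D>, <N_v, E> and <E_v, D>. *)
Definition rotation_v (A B : R -> R -> E4) (u v : R) : R := inner (pdE V A u v) (B u v).

Section MovingFrame.

Variables (O : R * R -> Prop) (T E D N : R -> R -> E4) (k s t w : R -> R -> R).
Hypothesis H : moving_frame O T E D N k s t w.

Local Notation hO := (mf_open _ _ _ _ _ _ _ _ _ H).
Local Notation sT := (mf_sT _ _ _ _ _ _ _ _ _ H).
Local Notation sE := (mf_sE _ _ _ _ _ _ _ _ _ H).
Local Notation sD := (mf_sD _ _ _ _ _ _ _ _ _ H).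
Local Notation sN := (mf_sN _ _ _ _ _ _ _ _ _ H).
Local Notation TT := (mf_TT _ _ _ _ _ _ _ _ _ H).
Local Notation EE := (mf_EE _ _ _ _ _ _ _ _ _ H).
Local Notation DD := (mf_DD _ _ _ _ _ _ _ _ _ H).
Local Notation NN := (mf_NN _ _ _ _ _ _ _ _ _ H).
Local Notation TE := (mf_TE _ _ _ _ _ _ _ _ _ H).
Local Notation TD := (mf_TD _ _ _ _ _ _ _ _ _ H).
Local Notation TN := (mf_TN _ _ _ _ _ _ _ _ _ H).
Local Notation ED := (mf_ED _ _ _ _ _ _ _ _ _ H).
Local Notation EN := (mf_EN _ _ _ _ _ _ _ _ _ H).
Local Notation DN := (mf_DN _ _ _ _ _ _ _ _ _ H).
Local Notation T_u := (mf_Tu _ _ _ _ _ _ _ _ _ H).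
Local Notation E_u := (mf_Eu _ _ _ _ _ _ _ _ _ H).
Local Notation D_u := (mf_Du _ _ _ _ _ _ _ _ _ H).
Local Notation N_u := (mf_Nu _ _ _ _ _ _ _ _ _ H).
Local Notation T_v := (mf_Tv _ _ _ _ _ _ _ _ _ H).

Local Notation P := (rotation_v N D).
Local Notation Q := (rotation_v N E).
Local Notation R_ := (rotation_v E D).

Lemma frame_smooth : smooth O P /\ smooth O Q /\ smooth O R_.
Proof. repeat split; apply (smooth_inner O hO); try apply smoothE_pdE;
    first [exact sN | exact sE | exact sD]. Qed.

Lemma flat F G a b u v : smoothE O F -> smoothE O G ->
  (forall u v, O (u, v) -> inner (pdE U F u v) (G u v) = a u v) ->
  (forall u v, O (u, v) -> inner (pdE V F u v) (G u v) = b u v) -> O (u, v) ->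
  pd V a u v - pd U b u v
  = inner (pdE U F u v) (pdE V G u v) - inner (pdE V F u v) (pdE U G u v).
Proof.
  intros HF HG Ha Hb Huv. rewrite <- (pd_inner_flat O hO F G u v HF HG Huv).
  rewrite (pd_ext O hO V _ _ u v Ha Huv), (pd_ext O hO U _ _ u v Hb Huv). reflexivity.
Qed.

Lemma skew i F G k' u v : smoothE O F -> smoothE O G ->
  (forall u v, O (u, v) -> inner (F u v) (G u v) = k') -> O (u, v) ->
  inner (pdE i G u v) (F u v) = - inner (pdE i F u v) (G u v).
Proof. intros HF HG HFG Huv. rewrite (pd_inner_const O hO i F G k'); auto. ring. Qed.

Ltac expand Huv :=
  rewrite ?T_u, ?E_u, ?D_u, ?N_u, ?T_v by exact Huv;
  rewrite ?inner_plus_l, ?inner_minus_l, ?inner_scal_l, ?inner_plus_r, ?inner_minus_r,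
      ?inner_scal_r,
    ?(inner_comm (E _ _) (T _ _)), ?(inner_comm (D _ _) (T _ _)), ?(inner_comm (N _ _) (T _ _)),
    ?(inner_comm (D _ _) (E _ _)), ?(inner_comm (N _ _) (E _ _)), ?(inner_comm (N _ _) (D _ _)),
    ?TT, ?EE, ?DD, ?NN, ?TE, ?TD, ?TN, ?ED, ?EN, ?DN by exact Huv.

Record rotation (u v : R) : Prop := {
  rot_TE : inner (pdE V T u v) (E u v) = - (w u v * s u v);
  rot_TD : inner (pdE V T u v) (D u v) = pd U w u v;
  rot_TN : inner (pdE V T u v) (N u v) = 0;
  rot_ET : inner (pdE V E u v) (T u v) = w u v * s u v;
  rot_DT : inner (pdE V D u v) (T u v) = - pd U w u v;
  rot_NT : inner (pdE V N u v) (T u v) = 0;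
  rot_DN : inner (pdE V D u v) (N u v) = - P u v;
  rot_EN : inner (pdE V E u v) (N u v) = - Q u v;
  rot_DE : inner (pdE V D u v) (E u v) = - R_ u v;
  rot_EE : inner (pdE V E u v) (E u v) = 0;
  rot_DD : inner (pdE V D u v) (D u v) = 0;
  rot_NN : inner (pdE V N u v) (N u v) = 0
}.

Lemma frame_rotation u v : O (u, v) -> rotation u v.
Proof.
  intros Huv.
  assert (HTE : inner (pdE V T u v) (E u v) = - (w u v * s u v)) by (expand Huv; ring).
  assert (HTD : inner (pdE V T u v) (D u v) = pd U w u v) by (expand Huv; ring).
  assert (HTN : inner (pdE V T u v) (N u v) = 0) by (expand Huv; ring).
  assert (S1 := skew V T E 0 u v sT sE TE Huv). assert (S2 := skew V T D 0 u v sT sD TD Huv).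
  assert (S3 := skew V T N 0 u v sT sN TN Huv). assert (S4 := skew V E D 0 u v sE sD ED Huv).
  assert (S5 := skew V E N 0 u v sE sN EN Huv). assert (S6 := skew V D N 0 u v sD sN DN Huv).
  assert (S7 := skew V E E 1 u v sE sE EE Huv). assert (S8 := skew V D D 1 u v sD sD DD Huv).
  assert (S9 := skew V N N 1 u v sN sN NN Huv).
  constructor; unfold rotation_v; lra.
Qed.

Ltac flat_solve F Huv :=
  let X := fresh in
  assert (X := frame_rotation _ _ Huv);
  rewrite ?pd_const in F; revert F; expand Huv;
  rewrite ?(inner_comm (T _ _) (pdE _ _ _ _)), ?(inner_comm (E _ _) (pdE _ _ _ _)),
    ?(inner_comm (D _ _) (pdE _ _ _ _)), ?(inner_comm (N _ _) (pdE _ _ _ _));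
  rewrite ?(rot_ET _ _ X), ?(rot_DT _ _ X), ?(rot_NT _ _ X), ?(rot_DN _ _ X), ?(rot_EN _ _ X),
    ?(rot_DE _ _ X), ?(rot_EE _ _ X), ?(rot_DD _ _ X), ?(rot_NN _ _ X).

Lemma pd_opp i f u v : smooth O f -> O (u, v) -> pd i (fun u v => - f u v) u v = - pd i f u v.
Proof.
  intros Hf Huv. rewrite (pd_ext O hO i _ (fun u v => -1 * f u v)) by (auto; intros; ring).
  rewrite (pd_mult O) by (auto; apply smooth_const; exact hO). rewrite pd_const. ring.
Qed.

(** Compatibility for the pair (T, N). Among the other five pairs, (T, E), (T, D) and (D, N)
    determine Q, P and R_, while (E, D) and (E, N) give s_v and t_v. *)
Lemma frame_kv u v : O (u, v) -> pd V k u v = - (w u v * s u v * t u v).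
Proof.
  intros Huv.
  assert (F := flat T N k (fun _ _ => 0) u v sT sN ltac:(intros x y Hxy; expand Hxy; ring)
    (fun x y h => rot_TN _ _ (frame_rotation x y h)) Huv).
  flat_solve F Huv. intros F; lra.
Qed.

Lemma frame_Q u v : O (u, v) ->
  k u v * Q u v = - (2 * pd U w u v * s u v + w u v * pd U s u v).
Proof.
  intros Huv. assert (sw := mf_sw _ _ _ _ _ _ _ _ _ H). assert (ss := mf_ss _ _ _ _ _ _ _ _ _ H).
  assert (F := flat T E (fun _ _ => 0) (fun u v => - (w u v * s u v)) u v sT sE
    ltac:(intros x y Hxy; expand Hxy; ring)
    (fun x y h => rot_TE _ _ (frame_rotation x y h)) Huv).
  rewrite (pd_opp U (fun u v => w u v * s u v)), (pd_mult O U w s) in F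
    by first [assumption | apply smooth_mult; [exact hO|assumption|assumption]].
  flat_solve F Huv. fold (Q u v). intros F; lra.
Qed.

Lemma frame_P u v : O (u, v) ->
  k u v * P u v = pd U (pd U w) u v - w u v * s u v ^ 2.
Proof.
  intros Huv.
  assert (F := flat T D (fun _ _ => 0) (pd U w) u v sT sD
    ltac:(intros x y Hxy; expand Hxy; ring)
    (fun x y h => rot_TD _ _ (frame_rotation x y h)) Huv).
  flat_solve F Huv. intros F; lra.
Qed.

Lemma frame_sv u v : O (u, v) -> pd V s u v = pd U R_ u v - t u v * P u v.
Proof.
  intros Huv.
  assert (F := flat E D s R_ u v sE sD ltac:(intros x y Hxy; expand Hxy; ring)
    (fun _ _ _ => eq_refl) Huv).
  flat_solve F Huv. intros F; lra.
Qed.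

Lemma frame_tv u v : O (u, v) ->
  pd V t u v = k u v * w u v * s u v - pd U Q u v + s u v * P u v.
Proof.
  intros Huv. destruct frame_smooth as (_ & sQ & _).
  assert (F := flat E N t (fun u v => - Q u v) u v sE sN ltac:(intros x y Hxy; expand Hxy; ring)
    (fun x y h => rot_EN _ _ (frame_rotation x y h)) Huv).
  rewrite pd_opp in F by assumption.
  flat_solve F Huv. fold (P u v). intros F; lra.
Qed.

Lemma frame_R u v : O (u, v) ->
  t u v * R_ u v = - (k u v * pd U w u v + pd U P u v + s u v * Q u v).
Proof.
  intros Huv. destruct frame_smooth as (sP & _).
  assert (F := flat D N (fun _ _ => 0) (fun u v => - P u v) u v sD sN
    ltac:(intros x y Hxy; expand Hxy; ring)
    (fun x y h => rot_DN _ _ (frame_rotation x y h)) Huv).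
  rewrite pd_opp in F by assumption.
  flat_solve F Huv. fold (Q u v). intros F; lra.
Qed.

End MovingFrame.

Ltac e4_ring := apply E4_ext; cbv -[Rplus Rmult Ropp Rminus pow]; ring.

Lemma inner_ext p q : (forall y, inner p y = inner q y) -> p = q.
Proof.
  intros H. assert (H1 := H (1, 0, 0, 0)). assert (H2 := H (0, 1, 0, 0)).
  assert (H3 := H (0, 0, 1, 0)). assert (H4 := H (0, 0, 0, 1)).
  destruct p as [[[? ?] ?] ?], q as [[[? ?] ?] ?].
  unfold inner, x1, x2, x3, x4 in H1, H2, H3, H4. simpl in H1, H2, H3, H4.
  repeat f_equal; lra.
Qed.

Lemma cross_perp a b c :
  inner (cross a b c) a = 0 /\ inner (cross a b c) b = 0 /\ inner (cross a b c) c = 0.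
Proof. unfold inner, cross, det3, x1, x2, x3, x4. simpl. repeat split; ring. Qed.

(** For orthonormal n, t, e, [gram_det] says that the cross product accounts for exactly what the
    other three components leave of <x, y>. *)
Lemma inner_expansion n t e x y :
  inner n n = 1 -> inner t t = 1 -> inner e e = 1 ->
  inner n t = 0 -> inner n e = 0 -> inner t e = 0 ->
  inner x y = inner x t * inner y t + inner x e * inner y e
    + inner x (cross n t e) * inner y (cross n t e) + inner x n * inner y n.
Proof.
  intros Hn Ht He Hnt Hne Hte. rewrite gram_det. unfold det3.
  rewrite (inner_comm t n), (inner_comm e n), (inner_comm e t), Hn, Ht, He, Hnt, Hne, Hte.
  rewrite (inner_comm n y), (inner_comm t y), (inner_comm e y). ring.
Qed.

Lemma inner_cross_self n t e :
  inner n n = 1 -> inner t t = 1 -> inner e e = 1 ->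
  inner n t = 0 -> inner n e = 0 -> inner t e = 0 ->
  inner (cross n t e) (cross n t e) = 1.
Proof.
  intros Hn Ht He Hnt Hne Hte.
  transitivity (det3 (inner n n) (inner n t) (inner n e) (inner t n) (inner t t) (inner t e)
                     (inner e n) (inner e t) (inner e e)).
  - unfold inner, cross, det3, x1, x2, x3, x4. simpl. ring.
  - unfold det3. rewrite (inner_comm t n), (inner_comm e n), (inner_comm e t), Hn, Ht, He,
      Hnt, Hne, Hte. ring.
Qed.

(** Only the component - k ta e of the last factor survives; its sign is absorbed by exchanging t
    and n. *)
Lemma cross_acceleration (n t e : E4) (k ta k' : R) :
  cross t (scal k n) (plus (scal k' n) (scal k (minus (scal (- k) t) (scal ta e))))
  = scal (k ^ 2 * ta) (cross n t e).
Proof.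
  destruct n as [[[? ?] ?] ?], t as [[[? ?] ?] ?], e as [[[? ?] ?] ?].
  e4_ring.
Qed.

(** * The frame of a soliton surface as a moving frame *)

Section Frame.

Variables (Dom : R * R -> Prop) (Om N : R -> R -> E4).
Hypothesis hDom : open Dom.
Hypothesis hOm : smoothE Dom Om.
Hypothesis hframe : ED2_frame Om N Dom.

Local Notation T := (frameT Om).
Local Notation E := (frameE Om N).
Local Notation D := (frameD Om N).
Local Notation kap := (kappa Om N).
Local Notation sig := (sigma Om N).
Local Notation ta := (tau Om N).
Local Notation r u v := (enorm (frameE_raw Om N u v)).

Lemma smooth_N : smoothE Dom N.
Proof. apply (ED2_normal_smooth _ _ _ hframe). Qed.

Lemma smooth_T : smoothE Dom T.
Proof. apply smoothE_pdE, hOm. Qed.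

Lemma smooth_kappa : smooth Dom kap.
Proof. apply smooth_inner; [exact hDom|apply smoothE_pdE, smooth_T|apply smooth_N]. Qed.

Lemma NN_NT u v : Dom (u, v) -> inner (N u v) (N u v) = 1 /\ inner (N u v) (T u v) = 0.
Proof.
  intros Huv. destruct (ED2_normal _ _ _ hframe v) as (M & nu & HM & Hv).
  rewrite (proj2 (Hv u Huv)).
  apply (hypersurface_normal M nu (fun t => Om t v) u (T u v) HM).
  - destruct hOm as (H1 & H2 & H3 & H4).
    split; [|split; [|split]];
      [exact (smooth_is_derive_U Dom _ u v H1 Huv)|exact (smooth_is_derive_U Dom _ u v H2 Huv)
      |exact (smooth_is_derive_U Dom _ u v H3 Huv)|exact (smooth_is_derive_U Dom _ u v H4 Huv)].
  - generalize (open_line Dom hDom (fun u v => Dom (u, v)) U u v (fun _ _ h => h) Huv).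
    apply filter_imp. intros t Ht. destruct (ED2_normal _ _ _ hframe v) as (M' & nu' & _ & Hv').
    apply (Hv t Ht).
Qed.

Lemma T_unit u v : Dom (u, v) -> inner (T u v) (T u v) = 1.
Proof. apply (ED2_unit_speed _ _ _ hframe). Qed.

Lemma pdE_unit_perp i F u v : smoothE Dom F -> (forall u v, Dom (u, v) -> inner (F u v)
    (F u v) = 1) ->
  Dom (u, v) -> inner (pdE i F u v) (F u v) = 0.
Proof.
  intros HF H Huv. assert (P := pd_inner_const Dom hDom i F F 1 u v HF HF H Huv). lra.
Qed.

(** T_u is orthogonal to T, so pairing the dependence with T gives b = 0; then c = 0 would give a =
    0 by pairing with N. *)
Lemma T_u u v : Dom (u, v) -> pdE U T u v = scal (kap u v) (N u v).
Proof.
  intros Huv. destruct (NN_NT u v Huv) as [Hnn Hnt].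
  destruct (ED2_dep _ _ _ hframe u v Huv) as (a & b & c & H0 & Hz).
  assert (H1 := pdE_unit_perp U T u v smooth_T T_unit Huv).
  assert (HT := T_unit u v Huv).
  change (frameT Om u v) with (T u v) in Hz. change (Om_uu Om u v) with (pdE U T u v) in Hz.
  assert (Hin : forall y, a * inner (N u v) y + b * inner (T u v) y + c * inner (pdE U T u v) y
      = 0).
  { intros y. assert (Hy := f_equal (fun p => inner p y) Hz). cbv beta in Hy.
    rewrite !inner_plus_l, !inner_scal_l in Hy. rewrite Hy. unfold inner.
    change (x1 zero) with 0. change (x2 zero) with 0. change (x3 zero) with 0.
    change (x4 zero) with 0. ring. }
  assert (E1 := Hin (T u v)). rewrite Hnt, H1, HT in E1.
  assert (E2 := Hin (N u v)). rewrite Hnn, (inner_comm (T u v)), Hnt in E2.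
  change (inner (pdE U T u v) (N u v)) with (kap u v) in E2.
  assert (Hb : b = 0) by lra. subst b.
  assert (Hc : c <> 0) by (intros ->; apply H0; repeat split; lra).
  assert (Ea : a = - (c * kap u v)) by lra. subst a.
  apply inner_ext. intros y. rewrite inner_scal_l. specialize (Hin y).
  apply Rmult_eq_reg_l with c; [lra|exact Hc].
Qed.

Lemma N_u_T u v : Dom (u, v) -> inner (pdE U N u v) (T u v) = - kap u v.
Proof.
  intros Huv.
  rewrite (pd_inner_const Dom hDom U N T 0 u v smooth_N smooth_T (fun u v h => proj2 (NN_NT u v
      h)) Huv).
  reflexivity.
Qed.

Lemma N_u_N u v : Dom (u, v) -> inner (pdE U N u v) (N u v) = 0.
Proof. apply (pdE_unit_perp U N u v smooth_N (fun u v h => proj1 (NN_NT u v h))). Qed.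

Lemma Om_uuu_eq u v : Dom (u, v) ->
  Om_uuu Om u v = plus (scal (pd U kap u v) (N u v)) (scal (kap u v) (pdE U N u v)).
Proof.
  intros Huv. change (Om_uuu Om u v) with (pdE U (pdE U T) u v).
  rewrite (pdE_ext Dom hDom U _ _ u v T_u Huv).
  apply (pdE_scal Dom U kap N u v smooth_kappa smooth_N Huv).
Qed.

(** Shows that E is, up to sign, the direction of N_u + kappa T. This is why N_u has no component
    along D. *)
Lemma frameE_raw_eq u v : Dom (u, v) ->
  frameE_raw Om N u v = scal (kap u v) (plus (pdE U N u v) (scal (kap u v) (T u v))).
Proof.
  intros Huv. unfold frameE_raw. change (frameT Om u v) with (T u v).
  rewrite Om_uuu_eq by exact Huv. rewrite !inner_plus_l, !inner_scal_l.
  destruct (NN_NT u v Huv) as [-> ->]. rewrite N_u_T, N_u_N by exact Huv.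
  generalize (kap u v) (pd U kap u v) (N u v) (pdE U N u v) (T u v).
  intros k k' n n' t. e4_ring.
Qed.

Lemma smooth_raw : smoothE Dom (frameE_raw Om N).
Proof.
  assert (Hk := smooth_kappa).
  apply (smoothE_ext Dom hDom
    (fun u v => scal (kap u v) (minus (pdE U N u v) (scal (- kap u v) (T u v))))).
  2: { apply smoothE_scal, smoothE_minus; try assumption; [apply smoothE_pdE, smooth_N|].
       apply smoothE_scal; [exact hDom|apply smooth_opp; assumption|apply smooth_T]. }
  intros u v Huv. rewrite frameE_raw_eq by exact Huv. f_equal.
  generalize (kap u v) (pdE U N u v) (T u v).
  intros k n' t. e4_ring.
Qed.

Lemma raw_pos u v : Dom (u, v) -> 0 < r u v /\ r u v * r u v = inner (frameE_raw Om N u v)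
    (frameE_raw Om N u v).
Proof.
  intros Huv. assert (Hp := inner_pos _ (ED2_raw _ _ _ hframe u v Huv)).
  split; [apply sqrt_lt_R0; exact Hp|apply sqrt_sqrt; lra].
Qed.

Lemma smooth_E : smoothE Dom E.
Proof.
  apply smoothE_scal; [exact hDom| |exact smooth_raw].
  apply smooth_inv; [exact hDom| |].
  - intros u v Huv. destruct (raw_pos u v Huv) as [H _]. lra.
  - apply smooth_sqrt; [exact hDom| |apply smooth_inner; auto using smooth_raw].
    intros u v Huv. apply inner_pos, (ED2_raw _ _ _ hframe u v Huv).
Qed.

Lemma E_eq u v : Dom (u, v) ->
  E u v = scal (kap u v / r u v) (plus (pdE U N u v) (scal (kap u v) (T u v))).
Proof.
  intros Huv. apply inner_ext. intros y. unfold frameE.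
  transitivity (/ r u v * inner (scal (kap u v) (plus (pdE U N u v) (scal (kap u v) (T u v)))) y).
  - rewrite <- (frameE_raw_eq u v Huv). apply inner_scal_l.
  - rewrite !inner_scal_l. unfold Rdiv. ring.
Qed.

Lemma E_unit u v : Dom (u, v) -> inner (E u v) (E u v) = 1.
Proof.
  intros Huv. destruct (raw_pos u v Huv) as [H1 H2].
  unfold frameE.
  rewrite inner_scal_l, inner_comm, inner_scal_l, <- H2. field. lra.
Qed.

Lemma N_E u v : Dom (u, v) -> inner (N u v) (E u v) = 0.
Proof.
  intros Huv. rewrite inner_comm, E_eq, inner_scal_l, inner_plus_l, inner_scal_l,
    N_u_N, (inner_comm (T u v)), (proj2 (NN_NT u v Huv)) by exact Huv. ring.
Qed.

Lemma T_E u v : Dom (u, v) -> inner (T u v) (E u v) = 0.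
Proof.
  intros Huv. rewrite inner_comm, E_eq, inner_scal_l, inner_plus_l, inner_scal_l,
    N_u_T, T_unit by exact Huv. ring.
Qed.

Lemma ta_eq u v : Dom (u, v) -> ta u v = - inner (pdE U N u v) (E u v).
Proof.
  intros Huv. apply (pd_inner_const Dom hDom U E N 0 u v smooth_E smooth_N); [|exact Huv].
  intros x y Hxy. rewrite inner_comm. apply N_E; exact Hxy.
Qed.

Lemma N_u u v : Dom (u, v) ->
  pdE U N u v = minus (scal (- kap u v) (T u v)) (scal (ta u v) (E u v)).
Proof.
  intros Huv. destruct (raw_pos u v Huv) as [H1 _].
  assert (Hk := ED2_kappa _ _ _ hframe u v Huv). change (kap u v <> 0) in Hk.
  assert (Hy : forall y, inner (pdE U N u v) y
    = - kap u v * inner (T u v) y + r u v / kap u v * inner (E u v) y).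
  { intros y. rewrite E_eq, inner_scal_l, inner_plus_l, inner_scal_l by exact Huv.
    field. split; [lra|exact Hk]. }
  apply inner_ext. intros y. rewrite inner_minus_l, !inner_scal_l, ta_eq by exact Huv.
  rewrite (Hy (E u v)), (Hy y), T_E, E_unit by exact Huv. ring.
Qed.

Lemma smooth_D : smoothE Dom D.
Proof. apply smoothE_cross; [exact hDom|apply smooth_N|apply smooth_T|apply smooth_E]. Qed.

Lemma D_perp u v :
  inner (D u v) (N u v) = 0 /\ inner (D u v) (T u v) = 0 /\ inner (D u v) (E u v) = 0.
Proof. apply cross_perp. Qed.

Lemma D_unit u v : Dom (u, v) -> inner (D u v) (D u v) = 1.
Proof.
  intros Huv. destruct (NN_NT u v Huv).
  apply inner_cross_self; auto using T_unit, E_unit, N_E, T_E.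
Qed.

Lemma frame_expansion u v x y : Dom (u, v) ->
  inner x y = inner x (T u v) * inner y (T u v) + inner x (E u v) * inner y (E u v)
    + inner x (D u v) * inner y (D u v) + inner x (N u v) * inner y (N u v).
Proof.
  intros Huv. destruct (NN_NT u v Huv).
  apply inner_expansion; auto using T_unit, E_unit, N_E, T_E.
Qed.

Lemma E_u_T u v : Dom (u, v) -> inner (pdE U E u v) (T u v) = 0.
Proof.
  intros Huv. rewrite (pd_inner_const Dom hDom U E T 0 u v smooth_E smooth_T) by
    (try (intros x y Hxy; rewrite inner_comm; apply T_E); assumption).
  rewrite T_u, inner_scal_l, N_E by exact Huv. ring.
Qed.

Lemma D_u u v : Dom (u, v) -> pdE U D u v = scal (- sig u v) (E u v).
Proof.
  intros Huv. destruct (D_perp u v) as (P1 & P2 & P3).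
  assert (F1 : inner (pdE U D u v) (N u v) = 0).
  { rewrite (pd_inner_const Dom hDom U D N 0 u v smooth_D smooth_N (fun u v _ => proj1 (D_perp u
      v)) Huv).
    rewrite N_u, inner_minus_l, !inner_scal_l, (inner_comm (T u v)), (inner_comm (E u v)), P2, P3
      by exact Huv. ring. }
  assert (F2 : inner (pdE U D u v) (T u v) = 0).
  { rewrite (pd_inner_const Dom hDom U D T 0 u v smooth_D smooth_T
      (fun u v _ => proj1 (proj2 (D_perp u v))) Huv).
    rewrite T_u, inner_scal_l, (inner_comm (N u v)), P1 by exact Huv. ring. }
  assert (F3 : inner (pdE U D u v) (E u v) = - sig u v).
  { apply (pd_inner_const Dom hDom U D E 0 u v smooth_D smooth_E
      (fun u v _ => proj2 (proj2 (D_perp u v))) Huv). }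
  assert (F4 : inner (pdE U D u v) (D u v) =
      0) by (apply (pdE_unit_perp U D u v smooth_D D_unit Huv)).
  apply inner_ext. intros y.
  rewrite (frame_expansion u v _ y Huv), F1, F2, F3, F4, inner_scal_l, (inner_comm (E u v)). ring.
Qed.

Lemma E_u u v : Dom (u, v) ->
  pdE U E u v = plus (scal (sig u v) (D u v)) (scal (ta u v) (N u v)).
Proof.
  intros Huv. apply inner_ext. intros y.
  rewrite (frame_expansion u v _ y Huv), E_u_T, (pdE_unit_perp U E u v smooth_E E_unit Huv),
      inner_plus_l,
    !inner_scal_l, (inner_comm (D u v) y), (inner_comm (N u v) y) by exact Huv.
  change (inner (pdE U E u v) (D u v)) with (sig u v).
  change (inner (pdE U E u v) (N u v)) with (ta u v). ring.
Qed.

Hypothesis hBDR : betchov_da_rios Om Dom.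

Local Notation w := (W Om N).

Lemma smooth_sigma : smooth Dom sig.
Proof. apply smooth_inner; [exact hDom|apply smoothE_pdE, smooth_E|apply smooth_D]. Qed.

Lemma smooth_tau : smooth Dom ta.
Proof. apply smooth_inner; [exact hDom|apply smoothE_pdE, smooth_E|apply smooth_N]. Qed.

Lemma smooth_W : smooth Dom w.
Proof. apply smooth_mult; [exact hDom|apply (smooth_pow Dom hDom kap 2),
    smooth_kappa|exact smooth_tau]. Qed.

Lemma W_neq0 u v : Dom (u, v) -> w u v <> 0.
Proof.
  intros Huv. apply Rmult_integral_contrapositive_currified; [apply pow_nonzero|];
    [apply (ED2_kappa _ _ _ hframe)|apply (ED2_tau _ _ _ hframe)]; exact Huv.
Qed.

Lemma Om_v_eq u v : Dom (u, v) -> pdE V Om u v = scal (w u v) (D u v).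
Proof.
  intros Huv. transitivity (cross (T u v) (pdE U T u v) (Om_uuu Om u v)); [apply hBDR;
      exact Huv|].
  rewrite Om_uuu_eq, T_u, N_u by exact Huv.
  change (w u v) with (kap u v ^ 2 * ta u v). change (D u v) with (cross (N u v) (T u v) (E u v)).
  apply cross_acceleration.
Qed.

Lemma T_v u v : Dom (u, v) ->
  pdE V T u v = plus (scal (pd U w u v) (D u v)) (scal (- (w u v * sig u v)) (E u v)).
Proof.
  intros Huv. change (pdE V T u v) with (pdE V (pdE U Om) u v).
  rewrite (pdE_comm Dom hDom Om u v hOm Huv), (pdE_ext Dom hDom U _ _ u v Om_v_eq Huv).
  rewrite (pdE_scal Dom U w D u v smooth_W smooth_D Huv), D_u by exact Huv.
  apply inner_ext. intros y. rewrite !inner_plus_l, !inner_scal_l. ring.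
Qed.

Lemma frame_moving : moving_frame Dom T E D N kap sig ta w.
Proof.
  constructor.
  - exact hDom.
  - exact smooth_T.
  - exact smooth_E.
  - exact smooth_D.
  - exact smooth_N.
  - exact smooth_kappa.
  - exact smooth_sigma.
  - exact smooth_tau.
  - exact smooth_W.
  - exact T_unit.
  - exact E_unit.
  - exact D_unit.
  - intros u v Huv. apply (NN_NT u v Huv).
  - exact T_E.
  - intros u v _. rewrite inner_comm. apply (D_perp u v).
  - intros u v Huv. rewrite inner_comm. apply (NN_NT u v Huv).
  - intros u v _. rewrite inner_comm. apply (D_perp u v).
  - intros u v Huv. rewrite inner_comm. apply (N_E u v Huv).
  - intros u v _. apply (D_perp u v).
  - exact T_u.
  - exact E_u.
  - exact D_u.
  - exact N_u.
  - exact T_v.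
Qed.

End Frame.

(** * Wintgen ideal soliton surfaces *)

Lemma gauss_curvature_semigeodesic O Om w u v : open O -> smooth O w ->
  (forall u v, O (u, v) -> w u v <> 0) ->
  (forall u v, O (u, v) -> g Om U U u v = 1) ->
  (forall u v, O (u, v) -> g Om U V u v = 0) ->
  (forall u v, O (u, v) -> g Om V V u v = w u v ^ 2) ->
  O (u, v) -> gauss_curvature Om u v = - pd U (pd U w) u v / w u v.
Proof.
  intros hO Hw Hw0 UU UV VV Huv.
  assert (VU : forall u v, O (u, v) -> g Om V U u v = 0).
  { intros x y Hxy. rewrite <- (UV x y Hxy). apply inner_comm. }
  assert (dUU : forall i u v, O (u, v) -> pd i (g Om U U) u v = 0).
  { intros i x y Hxy. rewrite (pd_ext O hO i _ (fun _ _ => 1) x y UU Hxy). apply pd_const. }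
  assert (dUV : forall i u v, O (u, v) -> pd i (g Om U V) u v = 0).
  { intros i x y Hxy. rewrite (pd_ext O hO i _ (fun _ _ => 0) x y UV Hxy). apply pd_const. }
  assert (dVU : forall i u v, O (u, v) -> pd i (g Om V U) u v = 0).
  { intros i x y Hxy. rewrite (pd_ext O hO i _ (fun _ _ => 0) x y VU Hxy). apply pd_const. }
  assert (dVV : forall i u v, O (u, v) -> pd i (g Om V V) u v = 2 * w u v * pd i w u v).
  { intros i x y Hxy. rewrite (pd_ext O hO i _ (fun u v => w u v * w u v) x y) by
      (auto; intros; rewrite VV by assumption; ring).
    rewrite (pd_mult O) by assumption. ring. }
  assert (Hdet : forall u v, O (u, v) -> det_g Om u v = w u v ^ 2).
  { intros x y Hxy. unfold det_g. rewrite UU, UV, VV by exact Hxy. ring. }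
  (* As g_UV = 0, only the U-component of [Riem_uvv] contributes. It differentiates the symbols in
     [G1] and [G2], which are therefore computed on all of O, the others at the point. *)
  assert (G1 : forall u v, O (u, v) -> Gamma Om U V V u v = - (w u v * pd U w u v)).
  { intros x y Hxy. unfold Gamma, sum_coord, g_inv.
    rewrite Hdet, UV, VV, dVV, dVU by exact Hxy. field. apply Hw0; exact Hxy. }
  assert (G2 : forall u v, O (u, v) -> Gamma Om U U V u v = 0).
  { intros x y Hxy. unfold Gamma, sum_coord, g_inv.
    rewrite Hdet, UV, VV, dVU, dUU, dUV by exact Hxy. field. apply Hw0; exact Hxy. }
  assert (G3 : Gamma Om V U V u v = pd U w u v / w u v).
  { unfold Gamma, sum_coord, g_inv.
    rewrite Hdet, UU, UV, dVU, dUU, dUV, dVV by exact Huv. field. apply Hw0; exact Huv. }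
  assert (G4 : Gamma Om U U U u v = 0).
  { unfold Gamma, sum_coord, g_inv.
    rewrite Hdet, UV, VV, dUU, dUV by exact Huv. field. apply Hw0; exact Huv. }
  assert (G5 : Gamma Om U V U u v = 0).
  { unfold Gamma, sum_coord, g_inv.
    rewrite Hdet, UV, VV, dUU, dUV, dVU by exact Huv. field. apply Hw0; exact Huv. }
  unfold gauss_curvature, sum_coord at 1. rewrite UU, UV, Hdet by exact Huv.
  unfold Riem_uvv at 1, sum_coord.
  rewrite (pd_ext O hO U _ _ u v G1 Huv), (pd_ext O hO V _ _ u v G2 Huv), pd_const, G1, G2, G3,
    G4 by exact Huv.
  rewrite (pd_ext O hO U _ (fun u v => -1 * (w u v * pd U w u v))) by (auto; intros; ring).
  assert (Hc := smooth_const O hO (-1)). assert (Hw' := smooth_pd O U w Hw).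
  rewrite (pd_mult O U (fun _ _ => -1) (fun u v => w u v * pd U w u v)), (pd_mult O U w), pd_const
    by (try apply (smooth_mult O hO); assumption).
  rewrite ?G5. field. apply Hw0; exact Huv.
Qed.

(* With [a = - r / w] and [b = - p / w] the two sides of the Wintgen equality
   differ by [(a^2 + (|k - b| - 2 |s|)^2) / 4]. *)
Lemma wintgen_identity (k s w p r : R) : w <> 0 ->
  - (k * p + w * s ^ 2) / w + Rabs (s * (k + p / w))
  = / 4 * ((r / w) ^ 2 + (k - p / w) ^ 2) <->
  r = 0 /\ Rabs (k + p / w) = 2 * Rabs s.
Proof.
  intros Hw. rewrite Rabs_mult.
  assert (E1 : - (k * p + w * s ^ 2) / w = - (k * (p / w)) - s ^ 2) by (field; exact Hw).
  rewrite E1. assert (Hr : r = 0 <-> r / w = 0).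
  { split; intros E; [rewrite E; field; exact Hw|].
    replace r with (r / w * w) by (field; exact Hw). rewrite E; ring. }
  rewrite Hr. clear. generalize (r / w) (p / w). intros a b.
  assert (E2 : s ^ 2 = Rabs s * Rabs s) by (rewrite <- (Rsqr_abs s : _ = Rabs s * Rabs s);
      unfold Rsqr; ring).
  assert (E3 : (k + b) * (k + b) = Rabs (k + b) * Rabs (k + b))
    by exact (Rsqr_abs (k + b)).
  rewrite E2. revert E3. generalize (Rabs (k + b)) (Rabs s). intros x y E3.
  split.
  - intros E. assert (E4 : a² + (x - 2 * y)² = 0) by (unfold Rsqr; lra).
    apply Rplus_sqr_eq_0 in E4 as [E4 E5]. split; lra.
  - intros [E4 E5]. rewrite E5 in *. rewrite E4. lra.
Qed.

Lemma pd_square_mult O k k1 k2 k3 t t1 t2 t3 : open O ->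
  smooth O k -> smooth O k1 -> smooth O k2 -> smooth O t -> smooth O t1 -> smooth O t2 ->
  (forall u v, O (u, v) -> pd U k u v = k1 u v) ->
  (forall u v, O (u, v) -> pd U k1 u v = k2 u v) ->
  (forall u v, O (u, v) -> pd U k2 u v = k3 u v) ->
  (forall u v, O (u, v) -> pd U t u v = t1 u v) ->
  (forall u v, O (u, v) -> pd U t1 u v = t2 u v) ->
  (forall u v, O (u, v) -> pd U t2 u v = t3 u v) ->
  let w u v := k u v ^ 2 * t u v in
  (forall u v, O (u, v) -> pd U w u v = 2 * k u v * k1 u v * t u v + k u v ^ 2 * t1 u v) /\
  (forall u v, O (u, v) -> pd U (pd U w) u v
    = 2 * (k1 u v ^ 2 + k u v * k2 u v) * t u v + 4 * k u v * k1 u v * t1 u v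
      + k u v ^ 2 * t2 u v) /\
  (forall u v, O (u, v) -> pd U (pd U (pd U w)) u v
    = (6 * k1 u v * k2 u v + 2 * k u v * k3 u v) * t u v
      + 6 * (k1 u v ^ 2 + k u v * k2 u v) * t1 u v + 6 * k u v * k1 u v * t2 u v
      + k u v ^ 2 * t3 u v).
Proof.
  intros hO Hk Hk1 Hk2 Ht Ht1 Ht2 D1 D2 D3 D4 D5 D6 w.
  assert (W1 : forall u v, O (u, v) -> pd U w u v =
      2 * k u v * k1 u v * t u v + k u v ^ 2 * t1 u v).
  { intros u v Huv. etransitivity; [apply is_derive_unique; unfold w; auto_derive;
      [ex_der|reflexivity]|].
    change (Derive (fun x => k x v) u) with (pd U k u v).
    change (Derive (fun x => t x v) u) with (pd U t u v). rewrite D1, D4 by exact Huv. ring. }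
  assert (W2 : forall u v, O (u, v) -> pd U (pd U w) u v
    = 2 * (k1 u v ^ 2 + k u v * k2 u v) * t u v + 4 * k u v * k1 u v * t1 u v
      + k u v ^ 2 * t2 u v).
  { intros u v Huv. rewrite (pd_ext O hO U _ _ u v W1 Huv).
    etransitivity; [apply is_derive_unique; auto_derive; [ex_der|reflexivity]|].
    change (Derive (fun x => k x v) u) with (pd U k u v).
    change (Derive (fun x => t x v) u) with (pd U t u v).
    change (Derive (fun x => k1 x v) u) with (pd U k1 u v).
    change (Derive (fun x => t1 x v) u) with (pd U t1 u v).
    rewrite D1, D2, D4, D5 by exact Huv. ring. }
  split; [exact W1|split; [exact W2|]].
  intros u v Huv. rewrite (pd_ext O hO U _ _ u v W2 Huv).
  etransitivity; [apply is_derive_unique; auto_derive; [ex_der|reflexivity]|].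
  change (Derive (fun x => k x v) u) with (pd U k u v).
  change (Derive (fun x => t x v) u) with (pd U t u v).
  change (Derive (fun x => k1 x v) u) with (pd U k1 u v).
  change (Derive (fun x => t1 x v) u) with (pd U t1 u v).
  change (Derive (fun x => k2 x v) u) with (pd U k2 u v).
  change (Derive (fun x => t2 x v) u) with (pd U t2 u v).
  rewrite D1, D2, D3, D4, D5, D6 by exact Huv. ring.
Qed.

Section Surface.

Variables (Dom : R * R -> Prop) (Om N : R -> R -> E4).
Hypothesis hDom : open Dom.
Hypothesis hOm : smoothE Dom Om.
Hypothesis hframe : ED2_frame Om N Dom.
Hypothesis hBDR : betchov_da_rios Om Dom.

Local Notation T := (frameT Om).
Local Notation E := (frameE Om N).
Local Notation D := (frameD Om N).
Local Notation k := (kappa Om N).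
Local Notation s := (sigma Om N).
Local Notation t := (tau Om N).
Local Notation w := (W Om N).
Local Notation P := (rotation_v N D).
Local Notation Q := (rotation_v N E).
Local Notation R_ := (rotation_v E D).

Local Notation MF := (frame_moving Dom Om N hDom hOm hframe hBDR).

Lemma metric u v : Dom (u, v) ->
  g Om U U u v = 1 /\ g Om U V u v = 0 /\ g Om V V u v = w u v ^ 2.
Proof.
  intros Huv. assert (Hv := Om_v_eq Dom Om N hDom hOm hframe hBDR u v Huv).
  unfold g. rewrite Hv, inner_scal_l, !inner_scal_r.
  change (pdE U Om u v) with (T u v).
  rewrite (mf_TT _ _ _ _ _ _ _ _ _ MF), (mf_TD _ _ _ _ _ _ _ _ _ MF),
    (mf_DD _ _ _ _ _ _ _ _ _ MF) by exact Huv.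
  repeat split; ring.
Qed.

Lemma second_form_coefficients u v : Dom (u, v) ->
  (c1 Om N U U u v = 0 /\ c2 Om N U U u v = k u v) /\
  (c1 Om N U V u v = - (w u v * s u v) /\ c2 Om N U V u v = 0) /\
  (c1 Om N V V u v = - (w u v * R_ u v) /\ c2 Om N V V u v = - (w u v * P u v)).
Proof.
  intros Huv. assert (X := frame_rotation _ _ _ _ _ _ _ _ _ MF u v Huv).
  split; [|split].
  - unfold c1, c2. change (pdE U (pdE U Om) u v) with (pdE U T u v).
    rewrite (mf_Tu _ _ _ _ _ _ _ _ _ MF u v Huv), !inner_scal_l, (inner_comm (N u v) (E u v)),
      (mf_EN _ _ _ _ _ _ _ _ _ MF u v Huv), (mf_NN _ _ _ _ _ _ _ _ _ MF u v Huv).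
    split; ring.
  - split; apply X.
  - unfold c1, c2.
    rewrite (pdE_ext Dom hDom V _ _ u v (Om_v_eq Dom Om N hDom hOm hframe hBDR) Huv).
    rewrite (pdE_scal Dom V w D u v (mf_sw _ _ _ _ _ _ _ _ _ MF)
        (mf_sD _ _ _ _ _ _ _ _ _ MF) Huv).
    rewrite !inner_plus_l, !inner_scal_l, (rot_DE _ _ _ _ _ _ _ _ X), (rot_DN _ _ _ _ _ _ _ _ X),
      (inner_comm (D u v) (E u v)), (mf_ED _ _ _ _ _ _ _ _ _ MF u v Huv),
      (mf_DN _ _ _ _ _ _ _ _ _ MF u v Huv).
    split; ring.
Qed.

Lemma curvature u v : Dom (u, v) ->
  gauss_curvature Om u v = - (k u v * P u v + w u v * s u v ^ 2) / w u v.
Proof.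
  intros Huv. rewrite (frame_P _ _ _ _ _ _ _ _ _ MF u v Huv).
  rewrite (gauss_curvature_semigeodesic Dom Om w u v hDom (mf_sw _ _ _ _ _ _ _ _ _ MF) (W_neq0 Dom Om N hframe)
    (fun x y h => proj1 (metric x y h)) (fun x y h => proj1 (proj2 (metric x y h)))
    (fun x y h => proj2 (proj2 (metric x y h))) Huv).
  field. apply (W_neq0 Dom Om N hframe); exact Huv.
Qed.

Lemma torsion u v : Dom (u, v) -> gauss_torsion Om N u v = s u v * (k u v + P u v / w u v).
Proof.
  intros Huv. unfold gauss_torsion. destruct (metric u v Huv) as (-> & -> & ->).
  destruct (second_form_coefficients u v Huv) as ((-> & ->) & (-> & ->) & -> & ->).
  field. apply (W_neq0 Dom Om N hframe); exact Huv.
Qed.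

(** Twice the mean curvature vector has the components - R_ / w along E and k - P / w along N. *)
Lemma mean_square u v : Dom (u, v) ->
  enorm (mean_curvature Om N u v) ^ 2
  = / 4 * ((R_ u v / w u v) ^ 2 + (k u v - P u v / w u v) ^ 2).
Proof.
  intros Huv. assert (Hw := (W_neq0 Dom Om N hframe) u v Huv).
  assert (Hn : forall p, enorm p ^ 2 = inner p p).
  { intros p. unfold enorm. simpl. rewrite Rmult_1_r. apply sqrt_sqrt. unfold inner. nra. }
  rewrite Hn. unfold mean_curvature, second_form, g_inv, det_g.
  destruct (metric u v Huv) as (-> & -> & ->).
  destruct (second_form_coefficients u v Huv) as ((-> & ->) & (-> & ->) & -> & ->).
  repeat rewrite ?inner_scal_l, ?inner_scal_r, ?inner_plus_l, ?inner_plus_r.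
  rewrite (inner_comm (N u v) (E u v)), (mf_EN _ _ _ _ _ _ _ _ _ MF u v Huv),
    (mf_NN _ _ _ _ _ _ _ _ _ MF u v Huv), (mf_EE _ _ _ _ _ _ _ _ _ MF u v Huv).
  field. exact Hw.
Qed.

Lemma wintgen_at u v : Dom (u, v) ->
  gauss_curvature Om u v + Rabs (gauss_torsion Om N u v) = enorm (mean_curvature Om N u v) ^ 2
  <-> R_ u v = 0 /\ Rabs (k u v + P u v / w u v) = 2 * Rabs (s u v).
Proof.
  intros Huv. rewrite curvature, torsion, mean_square by exact Huv.
  apply wintgen_identity, (W_neq0 Dom Om N hframe), Huv.
Qed.

Lemma W_derivatives :
  (forall u v, Dom (u, v) -> pd U w u v
    = 2 * k u v * pd U k u v * t u v + k u v ^ 2 * pd U t u v) /\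
  (forall u v, Dom (u, v) -> pd U (pd U w) u v
    = 2 * (pd U k u v ^ 2 + k u v * pd U (pd U k) u v) * t u v
      + 4 * k u v * pd U k u v * pd U t u v + k u v ^ 2 * pd U (pd U t) u v) /\
  (forall u v, Dom (u, v) -> pd U (pd U (pd U w)) u v
    = (6 * pd U k u v * pd U (pd U k) u v + 2 * k u v * pd U (pd U (pd U k)) u v) * t u v
      + 6 * (pd U k u v ^ 2 + k u v * pd U (pd U k) u v) * pd U t u v
      + 6 * k u v * pd U k u v * pd U (pd U t) u v + k u v ^ 2 * pd U (pd U (pd U t)) u v).
Proof.
  assert (Hk := mf_sk _ _ _ _ _ _ _ _ _ MF). assert (Ht := mf_st _ _ _ _ _ _ _ _ _ MF).
  apply (pd_square_mult Dom k (pd U k) (pd U (pd U k)) (pd U (pd U (pd U k)))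
    t (pd U t) (pd U (pd U t)) (pd U (pd U (pd U t))) hDom); auto 10 using smooth_pd.
Qed.

Lemma a34_eq u v : Dom (u, v) -> a34 Om N u v = - P u v.
Proof.
  intros Huv. assert (Hk := ED2_kappa _ _ _ hframe u v Huv).
  assert (HP := frame_P _ _ _ _ _ _ _ _ _ MF u v Huv).
  rewrite (proj1 (proj2 W_derivatives) u v Huv) in HP.
  apply Rmult_eq_reg_l with (k u v); [|exact Hk].
  transitivity (- (k u v * P u v)); [|ring]. rewrite HP. unfold a34, W. field. exact Hk.
Qed.

Lemma a23_eq u v : Dom (u, v) -> a23 Om N u v = R_ u v.
Proof.
  intros Huv. assert (Hk := ED2_kappa _ _ _ hframe u v Huv).
  assert (Ht := ED2_tau _ _ _ hframe u v Huv).
  assert (sk := mf_sk _ _ _ _ _ _ _ _ _ MF). assert (ss := mf_ss _ _ _ _ _ _ _ _ _ MF).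
  assert (sw := mf_sw _ _ _ _ _ _ _ _ _ MF).
  destruct (frame_smooth _ _ _ _ _ _ _ _ _ MF) as (sP & _ & _).
  destruct W_derivatives as (W1 & W2 & W3).
  assert (HP := frame_P _ _ _ _ _ _ _ _ _ MF). assert (HPu := HP u v Huv).
  assert (HQ := frame_Q _ _ _ _ _ _ _ _ _ MF u v Huv).
  assert (HR := frame_R _ _ _ _ _ _ _ _ _ MF u v Huv).
  (* P_u enters [frame_R]; it is found by differentiating k P = W_uu - W s^2, which avoids the
     quotient by k. *)
  assert (HdP : pd U k u v * P u v + k u v * pd U P u v = pd U (pd U (pd U w)) u v
    - (pd U w u v * s u v ^ 2 + 2 * w u v * s u v * pd U s u v)).
  { rewrite <- (pd_mult Dom U k P u v sk sP Huv), (pd_ext Dom hDom U _ _ u v HP Huv).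
    assert (sw1 := smooth_pd Dom U w sw). assert (sw2 := smooth_pd Dom U _ sw1).
    revert sw sw1 sw2. generalize (pd U (pd U w)). intros w2 sw sw1 sw2.
    etransitivity; [apply is_derive_unique; auto_derive; [ex_der|reflexivity]|].
    repeat match goal with |- context [Derive (fun x => ?f x v) u] =>
      change (Derive (fun x => f x v) u) with (pd U f u v) end. ring. }
  rewrite W1 in HQ, HR, HdP by exact Huv. rewrite W2 in HPu by exact Huv.
  rewrite W3 in HdP by exact Huv.
  apply Rmult_eq_reg_l with (t u v); [|exact Ht]. rewrite HR.
  assert (EP : P u v = (2 * (pd U k u v ^ 2 + k u v * pd U (pd U k) u v) * t u v
      + 4 * k u v * pd U k u v * pd U t u v + k u v ^ 2 * pd U (pd U t) u v
      - w u v * s u v ^ 2) / k u v) by (rewrite <- HPu; field; exact Hk).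
  assert (EQ : Q u v = - (2 * (2 * k u v * pd U k u v * t u v + k u v ^ 2 * pd U t u v) * s u v
      + w u v * pd U s u v) / k u v) by (rewrite <- HQ; field; exact Hk).
  rewrite EQ. rewrite EP in HdP.
  match type of HdP with ?a + _ = ?b =>
    assert (EdP : pd U P u v = (b - a) / k u v) by (rewrite <- HdP; field; exact Hk) end.
  rewrite EdP. unfold a23, W. field. split; assumption.
Qed.

End Surface.

(** * Reduction of the wrong sign to the mirror system *)

Section Superconformal.

Variables (O : R * R -> Prop) (T E D N : R -> R -> E4) (k s t w : R -> R -> R).
Hypothesis H : moving_frame O T E D N k s t w.
Hypothesis Hw : forall u v, O (u, v) -> w u v = k u v ^ 2 * t u v.
Hypothesis Hk0 : forall u v, O (u, v) -> k u v <> 0.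
Hypothesis Ht0 : forall u v, O (u, v) -> t u v <> 0.
Hypothesis Hs0 : forall u v, O (u, v) -> s u v <> 0.
Hypothesis HR : forall u v, O (u, v) -> rotation_v E D u v = 0.
Hypothesis HP : forall u v, O (u, v) ->
  rotation_v N D u v = - (w u v * (k u v + 2 * s u v)).

Let l u v := pd U w u v / w u v.
(** Equal to <N_v, E> / w by [frame_Q]. *)
Let m u v := - (2 * l u v * s u v + pd U s u v) / k u v.

Local Notation hO := (mf_open _ _ _ _ _ _ _ _ _ H).

(** With R_ and P prescribed and Q = w m, the equation of the pair (D, N) turns into one for k_u and
    that of (T, D) into one for l_u, while t_u comes from w = k^2 t. *)
Lemma superconformal_mirror : mirror_system O k (fun u v => - s u v) t l m (fun u v => - w u v).
Proof.
  assert (sk := mf_sk _ _ _ _ _ _ _ _ _ H). assert (ss := mf_ss _ _ _ _ _ _ _ _ _ H).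
  assert (st := mf_st _ _ _ _ _ _ _ _ _ H). assert (sw := mf_sw _ _ _ _ _ _ _ _ _ H).
  assert (Hw0 : forall u v, O (u, v) -> w u v <> 0).
  { intros u v Huv. rewrite Hw by exact Huv.
    apply Rmult_integral_contrapositive_currified; [apply pow_nonzero|]; auto. }
  assert (sl : smooth O l) by (apply (smooth_div O hO); auto using smooth_pd).
  assert (Hc : forall r, smooth O (fun _ _ => r)) by (intros; apply smooth_const, hO).
  assert (sm : smooth O m).
  { apply (smooth_div O hO); auto. apply (smooth_opp O hO), (smooth_plus O hO);
      [|apply smooth_pd; exact ss].
    apply (smooth_mult O hO (fun u v => 2 * l u v) s); [|exact ss].
    apply (smooth_mult O hO (fun _ _ => 2) l); auto. }
  assert (Hsu : forall u v, O (u, v) -> pd U s u v = - (k u v * m u v + 2 * l u v * s u v)).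
  { intros u v Huv. unfold m. field. auto. }
  assert (Hwu : forall u v, O (u, v) -> pd U w u v = l u v * w u v).
  { intros u v Huv. unfold l. field. auto. }
  assert (HQ : forall u v, O (u, v) -> rotation_v N E u v = w u v * m u v).
  { intros u v Huv. apply Rmult_eq_reg_l with (k u v); [|auto].
    rewrite (frame_Q _ _ _ _ _ _ _ _ _ H u v Huv), Hsu, Hwu by exact Huv. ring. }
  assert (HPu : forall u v, O (u, v) -> pd U (rotation_v N D) u v
    = - (pd U w u v * (k u v + 2 * s u v) + w u v * (pd U k u v + 2 * pd U s u v))).
  { intros u v Huv. rewrite (pd_ext O hO U _ _ u v HP Huv).
    etransitivity; [apply is_derive_unique; auto_derive; [ex_der|reflexivity]|].
    repeat match goal with |- context [Derive (fun x => ?f x v) u] =>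
      change (Derive (fun x => f x v) u) with (pd U f u v) end. ring. }
  assert (HQu : forall u v, O (u, v) -> pd U (rotation_v N E) u v
    = pd U w u v * m u v + w u v * pd U m u v).
  { intros u v Huv. rewrite (pd_ext O hO U _ _ u v HQ Huv). apply (pd_mult O); assumption. }
  assert (Hku : forall u v, O (u, v) ->
    pd U k u v = (2 * k u v + s u v) * m u v + 2 * l u v * s u v).
  { intros u v Huv. assert (E1 := frame_R _ _ _ _ _ _ _ _ _ H u v Huv).
    rewrite HR, HPu, HQ, Hsu, Hwu in E1 by exact Huv.
    apply Rmult_eq_reg_l with (w u v); [lra|auto]. }
  assert (Hopp : forall i f u v, smooth O f -> O (u, v) ->
    pd i (fun u v => - f u v) u v = - pd i f u v).
  { intros i f u v Hf Huv. exact (pd_opp _ _ _ _ _ _ _ _ _ H i f u v Hf Huv). }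
  constructor; try assumption; try (apply (smooth_opp O hO); assumption).
  - exact hO.
  - intros u v Huv. specialize (Hs0 u v Huv). lra.
  - intros u v Huv. specialize (Hw0 u v Huv). lra.
  - intros u v Huv. rewrite Hku by exact Huv. ring.
  - intros u v Huv. rewrite Hopp, Hsu by assumption. ring.
  - intros u v Huv.
    assert (E1 := frame_P _ _ _ _ _ _ _ _ _ H u v Huv).
    rewrite HP, (pd_ext O hO U _ _ u v Hwu Huv), (pd_mult O), Hwu in E1 by assumption.
    apply Rmult_eq_reg_l with (w u v); [lra|auto].
  - intros u v Huv. assert (E1 := Hwu u v Huv).
    rewrite (pd_ext O hO U _ (fun u v => k u v * k u v * t u v) u v) in E1
      by (try assumption; intros; rewrite Hw by assumption; ring).
    rewrite (pd_mult O U (fun u v => k u v * k u v) t), (pd_mult O U k k), Hw in E1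
      by (try apply (smooth_mult O hO); assumption).
    specialize (Hk0 u v Huv). apply Rmult_eq_reg_l with (k u v ^ 2); [|apply pow_nonzero; auto].
    transitivity (l u v * (k u v ^ 2 * t u v) - 2 * k u v * pd U k u v * t u v);
      [rewrite <- E1; ring|field; assumption].
  - intros u v Huv. rewrite Hopp, Hwu by assumption. ring.
  - intros u v Huv. rewrite (frame_kv _ _ _ _ _ _ _ _ _ H u v Huv). ring.
  - intros u v Huv. rewrite Hopp, (frame_sv _ _ _ _ _ _ _ _ _ H u v Huv) by assumption.
    rewrite (pd_ext O hO U _ (fun _ _ => 0) u v HR Huv), pd_const, HP by exact Huv. ring.
  - intros u v Huv. rewrite (frame_tv _ _ _ _ _ _ _ _ _ H u v Huv), HQu, HP, Hwu by exact Huv.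
    ring.
Qed.

End Superconformal.

Lemma moving_frame_subset O O' T E D N k s t w :
  open O' -> (forall p, O' p -> O p) ->
  moving_frame O T E D N k s t w -> moving_frame O' T E D N k s t w.
Proof.
  assert (Hs : forall F, (forall p, O' p -> O p) -> smoothE O F -> smoothE O' F).
  { intros F Hsub (H1 & H2 & H3 & H4).
    split; [|split; [|split]]; apply (smooth_subset O); assumption. }
  intros hO' Hsub []; constructor; auto; apply (smooth_subset O); assumption.
Qed.

Theorem theorem10 (Dom : R * R -> Prop) (Om N : R -> R -> E4)
  (hDom : open Dom)
  (hOm : smoothE Dom Om)
  (hframe : ED2_frame Om N Dom)
  (hBDR : betchov_da_rios Om Dom) :
  wintgen_ideal Om N Dom <->
  (forall u v, Dom (u, v) ->
     a23 Om N u v = 0 /\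
     a34 Om N u v =
       (kappa Om N u v) ^ 2 * tau Om N u v
       * (kappa Om N u v - 2 * sigma Om N u v)).
Proof.
  assert (MF := frame_moving Dom Om N hDom hOm hframe hBDR).
  assert (Hw0 := W_neq0 Dom Om N hframe).
  assert (Hat := fun u v => wintgen_at Dom Om N hDom hOm hframe hBDR u v).
  assert (H23 := fun u v => a23_eq Dom Om N hDom hOm hframe hBDR u v).
  assert (H34 := fun u v => a34_eq Dom Om N hDom hOm hframe hBDR u v).
  set (k := kappa Om N) in *. set (s := sigma Om N) in *. set (t := tau Om N) in *.
  set (w := W Om N) in *.
  set (P := rotation_v N (frameD Om N)) in *.
  set (R_ := rotation_v (frameE Om N) (frameD Om N)) in *.
  assert (Hsign : forall u v, Dom (u, v) ->
    P u v + w u v * (k u v - 2 * s u v) = w u v * (k u v + P u v / w u v - 2 * s u v)).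
  { intros u v Huv. field. apply Hw0; exact Huv. }
  split.
  - intros HW u v Huv.
    assert (HR : forall u v, Dom (u, v) -> R_ u v = 0).
    { intros x y Hxy. apply (proj1 (Hat x y Hxy)), HW, Hxy. }
    split; [rewrite H23, HR; auto|]. rewrite H34 by exact Huv. apply NNPP. intros Hne.
    (* The failure of the wanted equation is the open condition f <> 0. There the equality of
       absolute values leaves only k + P / w = - 2 s, and s = 0 is impossible because both signs
       would then agree. *)
    set (f u v := P u v + w u v * (k u v - 2 * s u v)).
    set (O := fun p => Dom p /\ f (fst p) (snd p) <> 0).
    assert (hO : open O).
    { apply (open_neq Dom hDom). destruct (frame_smooth _ _ _ _ _ _ _ _ _ MF) as (sP & _ & _).
      apply (smooth_plus Dom hDom); [exact sP|].
      apply (smooth_mult Dom hDom); [apply (mf_sw _ _ _ _ _ _ _ _ _ MF)|].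
      apply (smooth_minus Dom hDom); [apply (mf_sk _ _ _ _ _ _ _ _ _ MF)|].
      apply (smooth_mult Dom hDom); [apply smooth_const;
          exact hDom|apply (mf_ss _ _ _ _ _ _ _ _ _ MF)]. }
    assert (Hf : forall u v, O (u, v) -> Dom (u, v) /\ k u v + P u v / w u v =
        - 2 * s u v /\ s u v <> 0).
    { intros x y [Hxy Hn]. simpl in Hn. split; [exact Hxy|].
      assert (Hn' : k x y + P x y / w x y <> 2 * s x y).
      { intros E. apply Hn. unfold f. rewrite Hsign by exact Hxy. rewrite E. ring. }
      destruct (proj1 (Hat x y Hxy) (HW x y Hxy)) as [_ Habs].
      revert Habs. unfold Rabs. destruct (Rcase_abs _), (Rcase_abs _); intros; split; lra. }
    assert (HO : O (u, v)).
    { split; [exact Huv|]. simpl. intros E. apply Hne. unfold f in E.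
      change (- P u v = w u v * (k u v - 2 * s u v)). lra. }
    refine (mirror_system_absurd _ _ _ _ _ _ _ u v
      (superconformal_mirror O (frameT Om) (frameE Om N)
          (frameD Om N) N k s t w _ _ _ _ _ _ _) HO).
    + apply (moving_frame_subset Dom); [exact hO|intros p []; assumption|exact MF].
    + reflexivity.
    + intros x y Hxy. apply (ED2_kappa _ _ _ hframe), Hf, Hxy.
    + intros x y Hxy. apply (ED2_tau _ _ _ hframe), Hf, Hxy.
    + intros x y Hxy. apply Hf, Hxy.
    + intros x y Hxy. apply HR, Hf, Hxy.
    + intros x y Hxy. destruct (Hf x y Hxy) as (Hd & E & _). specialize (Hw0 x y Hd).
      change (P x y = - (w x y * (k x y + 2 * s x y))).
      replace (P x y) with (w x y * (k x y + P x y / w x y) - w x y * k x y) by (field;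
          exact Hw0).
      rewrite E. ring.
  - intros HA u v Huv. destruct (HA u v Huv) as [HA1 HA2].
    rewrite H23 in HA1 by exact Huv. rewrite H34 in HA2 by exact Huv.
    change (- P u v = w u v * (k u v - 2 * s u v)) in HA2.
    apply (Hat u v Huv). split; [exact HA1|].
    replace (k u v + P u v / w u v) with (2 * s u v); [rewrite Rabs_mult, (Rabs_pos_eq 2); lra|].
    specialize (Hw0 u v Huv). apply Rmult_eq_reg_l with (w u v); [|exact Hw0].
    transitivity (w u v * k u v + P u v); [lra|field; exact Hw0].
Qed.
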